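(* Let $X$ be a geodesic metric space. Let $\lambda\ge 1$ and $\kappa\ge 0$ be constants, and for every pair of points $a,b\in X$ let $L(a,b)$ be a fixed non-empty set of $(\lambda,\kappa)$-quasi-geodesics of endpoints $a$ and $b$, such that every sub-quasi-geodesic of an element of $L=\bigcup_{a,b\in X}L(a,b)$ is again in $L$. Let $\mathfrak q$ be a bi-infinite quasi-geodesic in $X$, and for every two points $x,y$ on $\mathfrak q$ denote by $\mathfrak q_{xy}$ the maximal sub-quasi-geodesic of $\mathfrak q$ with endpoints $x$ and $y$. The following conditions are equivalent: (1) In every asymptotic cone of $X$, the ultralimit of $\mathfrak q$ is either empty or contained in a transversal tree for some tree-graded structure. (2) $\mathfrak q$ is a Morse quasi-geodesic. (3) For every $C\ge 1$ there exists $D\ge 0$ such that every path of length $\le Cn$ connecting two points $a,b$ on $\mathfrak q$ at distance $\ge n$ crosses the $D$-neighborhood of the middle third of $\mathfrak q_{ab}$. (4) For every $C\ge 1$ and every natural $k>0$ there exists $D\ge 0$ such that every $k$-piecewise $L$ quasi-path $\mathfrak p$ that connects two points $a,b\in\mathfrak q$ and has quasi-length $\le C\,\mathrm{dist}(a,b)$ crosses the $D$-neighborhood of the middle third of $\mathfrak q_{ab}$. (5) For every $C\ge 1$ and every $\epsilon>0$ there exists $D\ge 0$ such that for every $a,b\in\mathfrak q$ with $\mathrm{dist}(a,b)\ge D$, and every path $\mathfrak p$ connecting $a,b$ of length $\le C\,\mathrm{dist}(a,b)$, the sub-quasi-geodesic $\mathfrak q_{ab}$ is contained in the $(\epsilon\,\mathrm{dist}(a,b))$-neighborhood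 of $\mathfrak p$.
   Context: Quasi-geodesics. An $(L_0,C_0)$-quasi-geodesic is a map $\mathfrak p:I\to X$, $I\subseteq\mathbb R$ an interval, with $\frac1{L_0}|s-t|-C_0\le \mathrm{dist}(\mathfrak p(s),\mathfrak p(t))\le L_0|s-t|+C_0$; it is bi-infinite if $I=\mathbb R$; maps are identified with their images when convenient. A sub-quasi-geodesic is a restriction to a subinterval. If $I=[0,d]$, its quasi-length is $d$, and its middle third is its restriction to $[d/3,2d/3]$ (similarly for a general finite interval). A $k$-piecewise $L$ quasi-path is a concatenation of $k$ quasi-geodesics in $L$; its quasi-length is the sum of the quasi-lengths of its pieces. Morse. A quasi-geodesic $\mathfrak q$ is Morse if for every $L_0\ge1$, $C_0\ge0$ there is $M=M(L_0,C_0)$ such that every $(L_0,C_0)$-quasi-geodesic with endpoints on the image of $\mathfrak q$ is contained in the $M$-tubular neighborhood of $\mathfrak q$. Asymptotic cones. For a non-principal ultrafilter $\omega$ on $\mathbb N$, points $o_n\in X$ and $d_n>0$ with $\lim_\omega d_n=\infty$, $\mathrm{Con}^\omega(X,(o_n),(d_n))$ is the quotient of the set of sequences $(x_n)$ with $\lim_\omega\mathrm{dist}(x_n,o_n)/d_n<\infty$ by the relation $\lim_\omega\mathrm{dist}(x_n,y_n)/d_n=0$, with metric $\lim_\omega\mathrm{dist}(x_n,y_n)/d_n$. The ultralimit of a subset $A\subseteq X$ is the set of classes of sequences $(a_n)$ with $a_n\in A$. Tree-graded structures. A complete geodesic metric space $F$ is tree-graded with respect to a collection $\mathcal P$ of closed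 geodesic subsets (pieces) if (T1) every two different pieces have at most one common point, and (T2) every simple non-trivial geodesic triangle in $F$ is contained in one piece. For a point $x\in F$, the union of the topological arcs starting at $x$ and intersecting each piece in at most one point is a real tree, called the transversal tree at $x$. *)

(* Defs.v *)
From HB Require Import structures.
From mathcomp Require Import all_boot all_order all_algebra.
From mathcomp Require Import generic_quotient.
From mathcomp Require Import all_classical all_reals all_analysis.

Set Implicit Arguments.
Unset Strict Implicit.
Unset Printing Implicit Defensive.

Import Order.TTheory GRing.Theory Num.Theory.
Import numFieldNormedType.Exports.

Local Open Scope quotient_scope.
Local Open Scope classical_set_scope.
Local Open Scope ring_scope.

Section metric.
Context {R : realType} {X : metricType R}.
Implicit Types (A : set X) (f : R -> X).

Definition tubular A (r : R) : set X :=
  [set x | exists2 a, A a & mdist x a < r].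

Definition geodesic_on (u v : R) f :=
  {in `[u, v] &, forall s t, mdist (f s) (f t) = `|s - t|}.

Definition geodesic_set A := forall x y, A x -> A y ->
  exists f, [/\ geodesic_on 0 (mdist x y) f, f 0 = x, f (mdist x y) = y &
    f @` `[0, mdist x y] `<=` A].

Definition quasi_geodesic (L0 C0 : R) (I : interval R) f :=
  {in I &, forall s t, L0^-1 * `|s - t| - C0 <= mdist (f s) (f t)
                       /\ mdist (f s) (f t) <= L0 * `|s - t| + C0}.

Definition curve_length f (u v : R) : \bar R :=
  ereal_sup [set (\sum_(0 <= i < size s)
      mdist (f (nth u (u :: s) i)) (f (nth u (u :: s) i.+1)))%:E
    | s in [set s | itv_partition u v s]].

End metric.

(* A map from the compact interval [beg, end] to X. The values of the underlying
   function outside that interval carry no information. *)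
Record interval_map (R : realType) (X : Type) := IntervalMap {
  im_fun :> R -> X;
  im_beg : R;
  im_end : R;
  im_le : im_beg <= im_end }.

Section interval_maps.
Context {R : realType} {X : metricType R}.
Implicit Types (p : interval_map R X) (L : X -> X -> set (interval_map R X)).

Definition im_source p : X := p (im_beg p).
Definition im_target p : X := p (im_end p).
Definition im_width p : R := im_end p - im_beg p.
Definition im_image p : set X := p @` `[im_beg p, im_end p].

Definition restricts p' p := [/\ im_beg p <= im_beg p', im_end p' <= im_end p &
  {in `[im_beg p', im_end p'], p' =1 p}].

Definition finite_quasi_geodesic (L0 C0 : R) p :=
  quasi_geodesic L0 C0 `[im_beg p, im_end p] p.

Definition is_path p := {within `[im_beg p, im_end p], continuous p}.

Definition path_length p := curve_length p (im_beg p) (im_end p).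

Definition quasi_geodesic_system (lambda kappa : R) L :=
  [/\ forall a b, L a b !=set0,
      forall a b p, L a b p -> [/\ finite_quasi_geodesic lambda kappa p,
        im_source p = a & im_target p = b] &
      forall a b p p', L a b p -> restricts p' p -> exists a' b', L a' b' p'].

(* The list ps of elements of L is concatenable, from a to b. Consecutive pieces
   match at their endpoints in X; their parameter intervals need not be
   adjacent. *)
Fixpoint quasi_path L (ps : seq (interval_map R X)) (a b : X) : Prop :=
  if ps is p :: ps' then exists2 c, L a c p & quasi_path L ps' c b else a = b.

Definition quasi_length (ps : seq (interval_map R X)) : R :=
  \sum_(p <- ps) im_width p.

Definition quasi_path_image (ps : seq (interval_map R X)) : set X :=
  \big[setU/set0]_(p <- ps) im_image p.

Definition morse (q : R -> X) := forall L0 C0 : R, 1 <= L0 -> 0 <= C0 ->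
  exists M : R, forall p, finite_quasi_geodesic L0 C0 p ->
    range q (im_source p) -> range q (im_target p) ->
    im_image p `<=` tubular (range q) M.

(* The parameter interval of the maximal sub-quasi-geodesic q_{ab}: the union of
   all the intervals with one end sent to a by q and the other one to b (any two
   of them are linked by a third one, so that the union is an interval).  As q
   may be neither injective nor continuous, this interval can fail to be
   closed. *)
Definition between (q : R -> X) (a b : X) : set R :=
  [set r | exists s t, [/\ q s = a, q t = b & s <= r <= t \/ t <= r <= s]].

Definition sub_qg (q : R -> X) (a b : X) : set X := q @` between q a b.

Definition third (I : set R) : set R :=
  I `&` `[inf I + (sup I - inf I) / 3, sup I - (sup I - inf I) / 3].

Definition middle_third (q : R -> X) (a b : X) : set X :=
  q @` third (between q a b).

End interval_maps.

Record cone_data (R : realType) (X : metricType R) := ConeData {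
  omega : set_system nat;
  omega_ultra : UltraFilter omega;
  omega_nonprincipal : forall n, ~ omega [set n];
  basepoint : nat -> X;
  scale : nat -> R;
  scale_gt0 : forall n, 0 < scale n;
  scale_infty : scale n @[n --> omega] --> +oo }.
#[global] Existing Instance omega_ultra.

Section cone.
Context {R : realType} {X : metricType R} (c : cone_data X).

Definition scaled_dist (x y : nat -> X) : nat -> R := fun n => mdist (x n) (y n) / scale c n.

(* Scaled distances are nonnegative, hence have an omega-limit in [0, +oo];
   it is finite exactly when they converge in R. *)
Definition bounded_seq : set (nat -> X) :=
  [set x | cvg (scaled_dist x (basepoint c) @ omega c)].

Definition cone_seq := {x : nat -> X | x \in bounded_seq}.
HB.instance Definition _ := Choice.on cone_seq.

Definition cone_seq_dist (x y : cone_seq) : R :=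
  lim (scaled_dist (val x) (val y) @ omega c).

Lemma scaled_dist_ge0 x y n : 0 <= scaled_dist x y n.
Proof. by rewrite divr_ge0 ?mdist_ge0// ltW// scale_gt0. Qed.

Lemma scaled_distC x y : scaled_dist x y = scaled_dist y x.
Proof. by apply/funext => n; rewrite /scaled_dist metric_sym. Qed.

Lemma scaled_dist_triangle y x z n :
  scaled_dist x z n <= scaled_dist x y n + scaled_dist y z n.
Proof.
by rewrite -mulrDl ler_pM2r ?invr_gt0 ?scale_gt0// metric_triangle.
Qed.

Lemma ultra_bounded_cvg (u : nat -> R) (B : R) :
  (\forall n \near omega c, 0 <= u n <= B) -> cvg (u n @[n --> omega c]).
Proof.
move=> uB; have := @segment_compact R 0 B.
move=> /(_ (u @ omega c) _ uB) [l [_ ul]].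
apply/cvg_ex; exists l => V /= Vl.
have [//|nV] := in_ultra_setVsetC (u @^-1` V) (omega_ultra c).
have [r [nVr Vr]] := ul (~` V) V nV Vl.
by case: nVr.
Qed.

Lemma cone_seq_cvg (x y : cone_seq) :
  cvg (scaled_dist (val x) (val y) @ omega c).
Proof.
have /set_mem/= cx := valP x; have /set_mem/= cy := valP y.
pose l (z : cone_seq) := lim (scaled_dist (val z) (basepoint c) @ omega c).
apply: (@ultra_bounded_cvg _ (l x + 1 + (l y + 1))).
near=> n; rewrite scaled_dist_ge0/=.
apply: le_trans (scaled_dist_triangle (basepoint c) _ _ _) _.
rewrite (scaled_distC (basepoint c)); apply: lerD.
- by near: n; apply: (@cvgr_le _ _ _ _ _ (l x) cx); rewrite ltrDl.
- by near: n; apply: (@cvgr_le _ _ _ _ _ (l y) cy); rewrite ltrDl.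
Unshelve. all: by end_near. Qed.

Lemma cone_seq_dist_ge0 x y : 0 <= cone_seq_dist x y.
Proof.
apply: limr_ge; first exact: cone_seq_cvg.
by apply: nearW => n; exact: scaled_dist_ge0.
Qed.

Lemma cone_seq_distxx x : cone_seq_dist x x = 0.
Proof.
apply: cvg_lim => //; rewrite (_ : scaled_dist _ _ = fun=> 0); first exact: cvg_cst.
by apply/funext => n; rewrite /scaled_dist mdistxx mul0r.
Qed.

Lemma cone_seq_distC x y : cone_seq_dist x y = cone_seq_dist y x.
Proof. by rewrite /cone_seq_dist scaled_distC. Qed.

Lemma cone_seq_dist_triangle y x z :
  cone_seq_dist x z <= cone_seq_dist x y + cone_seq_dist y z.
Proof.
rewrite -limD; [|exact: cone_seq_cvg|exact: cone_seq_cvg].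
apply: ler_lim; [exact: cone_seq_cvg| |].
  by apply: is_cvgD; exact: cone_seq_cvg.
by apply: nearW => n; exact: scaled_dist_triangle.
Qed.

Definition cone_rel (x y : cone_seq) : bool := cone_seq_dist x y == 0.

Lemma cone_rel_refl : reflexive cone_rel.
Proof. by move=> x; rewrite /cone_rel cone_seq_distxx. Qed.

Lemma cone_rel_sym : symmetric cone_rel.
Proof. by move=> x y; rewrite /cone_rel cone_seq_distC. Qed.

Lemma cone_rel_trans : transitive cone_rel.
Proof.
move=> y x z /eqP xy /eqP yz; rewrite /cone_rel eq_le cone_seq_dist_ge0 andbT.
by have := cone_seq_dist_triangle y x z; rewrite xy yz addr0.
Qed.

Canonical cone_eqv := EquivRel cone_rel cone_rel_refl cone_rel_sym cone_rel_trans.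

Definition cone : Type := {eq_quot cone_eqv}.
HB.instance Definition _ := Choice.on cone.
HB.instance Definition _ := EqQuotient.on cone.

Definition cone_dist (x y : cone) : R := cone_seq_dist (repr x) (repr y).

Lemma cone_distxx x : cone_dist x x = 0.
Proof. exact: cone_seq_distxx. Qed.

Lemma cone_dist_positivity x y : cone_dist x y = 0 -> x = y.
Proof.
by move=> /eqP xy; rewrite -(reprK x) -(reprK y); apply/eqmodP.
Qed.

Lemma cone_distC x y : cone_dist x y = cone_dist y x.
Proof. exact: cone_seq_distC. Qed.

Lemma cone_dist_triangle y x z : cone_dist x z <= cone_dist x y + cone_dist y z.
Proof. exact: cone_seq_dist_triangle. Qed.

HB.instance Definition _ := isMetric.Build R cone
  cone_distxx cone_dist_positivity cone_distC cone_dist_triangle.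

Lemma cone_mdistE (x y : cone_seq) :
  mdist (\pi_cone x) (\pi_cone y) = cone_seq_dist x y.
Proof.
have E (z : cone_seq) : cone_seq_dist (repr (\pi_cone z)) z = 0.
  by apply/eqP; have /eqmodP := reprK (\pi_cone z).
rewrite [LHS]/(cone_seq_dist _ _); apply/eqP; rewrite eq_le; apply/andP; split.
- rewrite (le_trans (cone_seq_dist_triangle x _ _))// E add0r.
  rewrite (le_trans (cone_seq_dist_triangle y _ _))//.
  by rewrite (cone_seq_distC y (repr _)) E addr0.
- rewrite (le_trans (cone_seq_dist_triangle (repr (\pi_cone x)) _ _))//.
  rewrite cone_seq_distC E add0r.
  by rewrite (le_trans (cone_seq_dist_triangle (repr (\pi_cone y)) _ _))// E addr0.
Qed.

Definition ultralimit (A : set X) : set cone :=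
  [set \pi_cone x | x in [set x : cone_seq | forall n, A (val x n)]].

End cone.
Arguments ultralimit {R X} c A.

Section tree_graded.
Context {R : realType} {F : metricType R}.
Implicit Types (A B : set F) (P : set (set F)).

Definition is_complete :=
  forall G : set_system F, ProperFilter G -> cauchy G -> exists l : F, G --> l.

(* c runs along the three sides of the triangle, whose vertices are c 0 = c l,
   c s1 and c s2. *)
Definition simple_geodesic_triangle A := exists (l s1 s2 : R) (c : R -> F),
  [/\ [/\ 0 < l, 0 <= s1, s1 <= s2 & s2 <= l],
      [/\ geodesic_on 0 s1 c, geodesic_on s1 s2 c & geodesic_on s2 l c],
      c 0 = c l /\ {in `[0, l[ &, injective c} &
      A = c @` `[0, l]].

Definition tree_graded P :=
  [/\ is_complete /\ geodesic_set [set: F],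
      forall A, P A -> closed A /\ geodesic_set A,
      forall A B, P A -> P B -> A <> B -> is_subset1 (A `&` B) &
      forall A, simple_geodesic_triangle A -> exists2 B, P B & A `<=` B].

(* The degenerate arc {x} is allowed, so that the transversal tree at x always
   contains x. *)
Definition topological_arc (x : F) A := exists (u v : R) (f : R -> F),
  [/\ u <= v, {within `[u, v], continuous f}, {in `[u, v] &, injective f},
      f u = x & A = f @` `[u, v]].

Definition transversal_tree P (x : F) : set F :=
  [set y | exists A, [/\ topological_arc x A,
                         forall B, P B -> is_subset1 (A `&` B) & A y]].

End tree_graded.

(* Main.v *)
Require Import Defs.
From mathcomp Require Import all_boot all_order all_algebra.
From mathcomp Require Import generic_quotient.
From mathcomp Require Import all_classical all_reals all_analysis.
From mathcomp Require Import ring lra.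

Set Implicit Arguments.
Unset Strict Implicit.
Unset Printing Implicit Defensive.

Import Order.TTheory GRing.Theory Num.Theory.
Import numFieldNormedType.Exports.

Local Open Scope classical_set_scope.
Local Open Scope ring_scope.

(** All five conditions are compared with a statement about finite chains of
points, [chain_bottleneck]: a chain with at most N points and steps at most d
which joins two points of q comes within M d + D of every intermediate point of
q, where M is a universal constant and D depends on N only.

Each of (3), (4), (5) says that such a chain comes close to some point of the
middle half of the subsegment; applied to a maximal interval of q that stays
away from the chain, this yields the bottleneck property.  For (2), a chain of
N points is shadowed by a quasi-geodesic whose constants depend on N only,
built by going repeatedly to a nearest point of what has been constructed.

Conversely, the bottleneck property makes the nearest point projection on q
sublinearly contracting: moving by half the distance to q moves the projection
by a small fraction of that distance.  A path or quasi-geodesic which stays far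
from q must then be very long, whence (2), (3), (4), while (5) follows by
subdividing the path into a bounded number of steps.

In an asymptotic cone, the bottleneck property says that a closed connected set
containing two points of the limit line contains the segment between them, and
then the fibers of the nearest point projection on the line are the pieces of a
tree-graded structure.  Conversely, in a tree-graded space a geodesic between
two points of a transversal tree meets each piece at most once, hence lies in
every connected set containing its endpoints, and a sequence of chains
violating the bottleneck property would produce a chain in a cone, whose
connected hull misses a point of the limit line. *)

(** * Chains and paths *)

(** In [chain_bottleneck] the constant M does not depend on N, and the proof rests on this order of
    quantifiers. A path of given length can be cut into more and shorter steps, which makes the term
    M d an arbitrarily small fraction of the length; the price is a larger D, an additive constant
    that is negligible at large scale. Both the contraction of the projection and the covering of
    q_ab use this trade. The independence of M is inherited: a curve that interpolates a chain of
    step d stays within a fixed multiple of d of it, up to a constant, whatever the number of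
    points, and in the cone argument the scale is at least d. Chains are preferred to paths because
    finitely many points can be lifted from a cone to X and passed from X to a cone, whereas
    continuity does not survive the passage. As q is in general neither continuous nor injective,
    nearest points and first or last moments are taken up to an error of 1, and subsegments are
    handled through their parameters. *)

Section Chains.
Context {R : realType} {X : metricType R}.
Implicit Types (x y z a b : X) (s : seq X) (d e : R).

Definition step d : rel X := fun x y => mdist x y <= d.

Fixpoint clen a s : R := if s is b :: s' then mdist a b + clen b s' else 0.

Lemma clen_ge0 a s : 0 <= clen a s.
Proof. by elim: s a => //= b s IH a; rewrite addr_ge0 ?mdist_ge0. Qed.

Lemma clen_cat a s t : clen a (s ++ t) = clen a s + clen (last a s) t.
Proof. by elim: s a => [|b s IH] a /=; rewrite ?add0r// IH addrA. Qed.

Lemma mdist_last_clen a s : mdist a (last a s) <= clen a s.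
Proof.
elim: s a => [|b s IH] a /=; first by rewrite mdistxx.
by rewrite (le_trans (metric_triangle _ b _))// lerD2l.
Qed.

Lemma clen_mem a s z : z \in a :: s -> mdist a z <= clen a s.
Proof.
elim: s a => [|b s IH] a; first by rewrite inE => /eqP->; rewrite mdistxx.
rewrite inE => /predU1P[->|/IH zs]; first by rewrite mdistxx clen_ge0.
by rewrite (le_trans (metric_triangle _ b _))//= lerD2l.
Qed.

Lemma clen_step d a s : path (step d) a s -> clen a s <= (size s)%:R * d.
Proof.
elim: s a => [|b s IH] a /=; first by rewrite mul0r.
by move=> /andP[ab /IH bs]; rewrite -natr1 mulrDl mul1r addrC lerD.
Qed.

Lemma chain_le d e a s : d <= e -> path (step d) a s -> path (step e) a s.
Proof. by move=> de; apply: sub_path => x y /le_trans; apply. Qed.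

Lemma chain_rev d a s : path (step d) a s ->
  exists s', [/\ path (step d) (last a s) s', last (last a s) s' = a,
    size s' = size s, last a s :: s' =i a :: s & clen (last a s) s' = clen a s].
Proof.
move=> ps; exists (rev (belast a s)).
have E : last a s :: rev (belast a s) = rev (a :: s).
  by rewrite [a :: s]lastI rev_rcons.
split.
- rewrite rev_path; apply: sub_path ps => x y.
  by rewrite /step metric_sym.
- by case: s {ps E} => //= b s; rewrite rev_cons last_rcons.
- by rewrite size_rev size_belast.
- by move=> z; rewrite E mem_rev.
- move: {ps} E; elim: s a => [|b s IH] a //= E.
  rewrite rev_cons -cats1 clen_cat /=.
  rewrite IH; last by rewrite [b :: s]lastI rev_rcons.
  have -> : last (last b s) (rev (belast b s)) = b.
    by case: s {E IH} => //= c s; rewrite rev_cons last_rcons.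
  by rewrite addr0 metric_sym addrC.
Qed.

Lemma subchain d a s z w : 0 <= d -> path (step d) a s ->
  z \in a :: s -> w \in a :: s ->
  exists s', [/\ path (step d) z s', last z s' = w, (size s' <= size s)%N &
    {subset z :: s' <= a :: s}].
Proof.
move=> d0; elim: s a z w => [|b s IH] a z w /=.
  by rewrite !inE => _ /eqP-> /eqP->; exists [::]; split.
move=> /andP[ab bs]; rewrite inE => /predU1P[->|zs].
  rewrite inE => /predU1P[->|ws]; first by exists [::]; split => // x; rewrite !inE => ->.
  have [s' [? ? ? sub]] := IH b b w bs (mem_head _ _) ws.
  exists (b :: s'); split => //=; first by rewrite ab.
  move=> x; rewrite inE => /predU1P[->|]; first by rewrite inE eqxx.
  by move/sub => h; rewrite inE h orbT.
rewrite inE => /predU1P[->|ws].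
  have [s' [ps ls zs' sub]] := IH b z b bs zs (mem_head _ _).
  exists (rcons s' a); rewrite last_rcons rcons_path ps ls /= size_rcons ltnS.
  split => //; first by rewrite /step metric_sym.
  move=> x; rewrite -rcons_cons mem_rcons inE => /predU1P[->|]; first by rewrite inE eqxx.
  by move/sub => h; rewrite inE h orbT.
have [s' [? ? ? sub]] := IH b z w bs zs ws.
exists s'; split => //; first exact: leqW.
by move=> x /sub h; rewrite inE h orbT.
Qed.

Lemma geoE f (u v s t : R) : @geodesic_on R X u v f -> u <= s <= v -> u <= t <= v ->
  mdist (f s) (f t) = `|s - t|.
Proof. by move=> gf us ut; apply: gf; rewrite in_itv. Qed.

Lemma geodesic_between (geoX : geodesic_set [set: X]) x y (t : R) :
  0 <= t <= mdist x y -> exists w, mdist x w = t /\ mdist w y = mdist x y - t.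
Proof.
move=> /andP[t0 tD]; have [f [gf f0 fD _]] := geoX x y I I.
have D0 := mdist_ge0 x y.
exists (f t); split.
  by rewrite -[X in mdist X _]f0 (geoE gf) ?lexx ?t0// sub0r normrN ger0_norm.
rewrite -[X in mdist _ X = _]fD (geoE gf) ?lexx ?t0 ?D0//.
by rewrite distrC ger0_norm// subr_ge0.
Qed.

(** The betweenness equation is all that is kept of the geodesic; it bounds the distance from a
    chain point to either endpoint. *)
Lemma chain_geodesic (geoX : geodesic_set [set: X]) x y d (m : nat) :
  0 <= d -> mdist x y <= m%:R * d ->
  exists s, [/\ path (step d) x s, last x s = y, (size s <= m)%N &
    {in x :: s, forall w, mdist x w + mdist w y = mdist x y}].
Proof.
move=> d0; elim: m x => [|m IH] x xy.
  have {xy} -> : x = y.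
    by apply: mdist_positivity; apply/eqP; rewrite eq_le mdist_ge0 andbT -(mul0r d).
  by exists [::]; split => // w; rewrite inE => /eqP ->; rewrite mdistxx addr0.
have [w [xw wy]] : exists w, mdist x w = Order.min d (mdist x y) /\
    mdist w y = mdist x y - Order.min d (mdist x y).
  apply: geodesic_between => //.
  by rewrite le_min d0 mdist_ge0 ge_min lexx orbT.
have wy' : mdist w y <= m%:R * d.
  rewrite wy; case: (leP d (mdist x y)) => _; last by rewrite subrr mulr_ge0.
  by rewrite lerBlDr; move: xy; rewrite -natr1 mulrDl mul1r.
have [s [ps ls ss sub]] := IH w wy'.
exists (w :: s); split => //=.
  by rewrite ps andbT /step xw ge_min lexx.
move=> z; rewrite inE => /predU1P[->|/sub zs].
  by rewrite mdistxx add0r.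
apply/eqP; rewrite eq_le metric_triangle andbT.
have := metric_triangle x w z; lra.
Qed.

(** Repeating the last point adjusts the number of steps to exactly N, as required by a condition on
    paths with a prescribed number of pieces. *)
Lemma chain_pad d a s N : 0 <= d -> (size s <= N)%N -> path (step d) a s ->
  exists s', [/\ path (step d) a s', last a s' = last a s, size s' = N &
    a :: s' =i a :: s].
Proof.
move=> d0 sN ps; exists (s ++ nseq (N - size s) (last a s)).
split.
- rewrite cat_path ps /=; elim: (N - _)%N => //= n ->.
  by rewrite /step mdistxx d0.
- by rewrite last_cat; elim: (N - _)%N => //= n; case: n.
- by rewrite size_cat size_nseq subnKC.
- move=> z; rewrite -cat_cons mem_cat mem_nseq.
  apply/orP/idP => [[//|/andP[_ /eqP ->]]|->]; last by left.
  exact: mem_last.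
Qed.

(** From each kept point, the next one is the first at distance at least e. Such a jump uses up at
    least e of the length, so the number of jumps is governed by the length and not by the size of
    s; the summand e pays for the last, shorter jump. *)
Lemma chain_coarsen d e a s : 0 < e -> 0 <= d -> path (step d) a s ->
  exists s', [/\ path (step (e + d)) a s', last a s' = last a s,
    {subset a :: s' <= a :: s} & (size s')%:R * e <= clen a s + e].
Proof.
move=> e0 d0; have [n] := ubnP (size s); elim: n s a => // n IH s a sn ps.
have ed0 : 0 <= e + d by rewrite addr_ge0// ltW.
have [hs|hs] := boolP (has (fun z => e <= mdist a z) s); last first.
  case: (lastP s) hs ps => [|s1 b] hs ps.
    by exists [::]; split => //=; rewrite mul0r add0r ltW.
  exists [:: b]; rewrite /= !last_rcons andbT; split => //.
  - move/hasPn : hs => /(_ b); rewrite mem_rcons mem_head => /(_ isT).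
    by rewrite -ltNge /step => /ltW h; rewrite (le_trans h)// lerDl.
  - by move=> x; rewrite !inE mem_rcons inE orbA => /orP[] -> //=; rewrite orbT.
  - by rewrite mul1r lerDr clen_ge0.
case: (split_find hs) ps sn => z s1 s2 ez /hasPn as1 .
rewrite cat_path rcons_path last_rcons => /andP[/andP[ps1 zs1] ps2] sn.
have [|s' [ps' ls' sub' sz']] := IH s2 z _ ps2.
  by move: sn; rewrite size_cat size_rcons addSn ltnS; apply: leq_ltn_trans; rewrite leq_addl.
exists (z :: s'); split => /=.
- rewrite ps' andbT /step (le_trans (metric_triangle _ (last a s1) _))//.
  apply: lerD => //.
  have := mem_last a s1; rewrite inE => /predU1P[->|/as1]; first by rewrite mdistxx ltW.
  by rewrite /= -ltNge => /ltW.
- by rewrite last_cat last_rcons.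
- move=> x; rewrite inE => /predU1P[->|]; first by rewrite inE eqxx.
  move/sub' => h; rewrite cat_rcons inE mem_cat h; rewrite !orbT//.
- rewrite clen_cat last_rcons -cats1 clen_cat /= addr0 -natr1 mulrDl mul1r.
  have : mdist a z <= clen a s1 + mdist (last a s1) z.
    by rewrite (le_trans (metric_triangle _ (last a s1) _))// lerD2r mdist_last_clen.
  lra.
Qed.

End Chains.

(** * Curve length, and the passage between paths and chains *)

Section Lipschitz.
Context {R : realType} {X : metricType R}.
Implicit Types (f g : R -> X) (u v w d e : R).

Definition lip1 f u v := forall s t, u <= s <= v -> u <= t <= v ->
  mdist (f s) (f t) <= `|s - t|.

Lemma geodesic_lip1 f u v : geodesic_on u v f -> lip1 f u v.
Proof. by move=> gf s t us ut; rewrite (geoE gf). Qed.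

Lemma lip1_join f u v w : u <= v <= w -> lip1 f u v -> lip1 f v w -> lip1 f u w.
Proof.
move=> /andP[uv vw] f1 f2.
have H s t : s <= t -> u <= s -> t <= w -> mdist (f s) (f t) <= t - s.
  move=> st us tw; have [tv|vt] := leP t v.
    rewrite (le_trans (f1 _ _ _ _)) ?us ?tv ?(le_trans st) ?(le_trans us)//.
    by rewrite distrC ger0_norm// subr_ge0.
  have [sv|vs] := leP s v; last first.
    rewrite (le_trans (f2 _ _ _ _)) ?tw ?(ltW vt) ?(ltW vs) ?(le_trans st)//.
    by rewrite distrC ger0_norm// subr_ge0.
  rewrite (le_trans (metric_triangle _ (f v) _))//.
  have -> : t - s = (v - s) + (t - v) by ring.
  apply: lerD.
    rewrite (le_trans (f1 _ _ _ _)) ?us ?sv ?uv ?lexx//.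
    by rewrite distrC ger0_norm// subr_ge0.
  rewrite (le_trans (f2 _ _ _ _)) ?lexx ?(ltW vt) ?tw ?vw//.
  by rewrite distrC ger0_norm// subr_ge0 ltW.
move=> s t /andP[us sw] /andP[ut tw].
have [st|ts] := leP s t.
  by rewrite distrC ger0_norm ?subr_ge0// H.
by rewrite metric_sym gtr0_norm ?subr_gt0// H// ltW.
Qed.

Lemma lip1_shift f u v c : lip1 f u v -> lip1 (fun t => f (t - c)) (u + c) (v + c).
Proof.
move=> lf s t /andP[? ?] /andP[? ?].
rewrite (le_trans (lf _ _ _ _)) ?lerBrDr ?lerBlDr//; do ?[apply/andP; split=> //].
by have -> : s - c - (t - c) = s - t by ring.
Qed.

Lemma lip1_ext f g u v : (forall t, u <= t <= v -> f t = g t) -> lip1 f u v -> lip1 g u v.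
Proof. by move=> fg lf s t us ut; rewrite -!fg// lf. Qed.

Lemma lip1_cat f g a b : 0 <= a -> 0 <= b -> lip1 f 0 a -> lip1 g 0 b ->
  f a = g 0 -> lip1 (fun t => if t <= a then f t else g (t - a)) 0 (a + b).
Proof.
move=> a0 b0 lf lg fg; apply: (@lip1_join _ _ a).
- by rewrite a0 lerDl.
- by apply: lip1_ext lf => t /andP[_ ->].
- have := lip1_shift (c := a) lg; rewrite add0r addrC; apply: lip1_ext => t /andP[at_ _].
  case: ifPn => // ta; have -> : t = a by apply/eqP; rewrite eq_le ta at_.
  by rewrite subrr -fg.
Qed.

Import metricType_numDomainType.

Lemma within_contP f u v : {within `[u, v], continuous f} <->
  (forall x, u <= x <= v -> forall e : R, 0 < e -> exists2 d : R, 0 < d &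
    forall t, u <= t <= v -> `|x - t| < d -> mdist (f x) (f t) < e).
Proof.
rewrite subspace_continuousP; split=> [H x xuv e e0|H x /=].
  have := H x; rewrite /= in_itv/= => /(_ xuv) /cvgrPdist_lt/(_ e e0).
  move=> /nbhs_ballP[d /= d0 Hd]; exists d => // t tuv xt.
  by apply: Hd => //=; rewrite in_itv.
rewrite in_itv/= => xuv; apply/cvgrPdist_lt => e e0.
have [d d0 Hd] := H x xuv e e0.
apply/nbhs_ballP; exists d => //= t xt /=; rewrite in_itv/= => tuv.
exact: Hd.
Qed.

Lemma lip1_cont f u v : lip1 f u v -> {within `[u, v], continuous f}.
Proof.
move=> lf; apply/within_contP => x xuv e e0; exists e => // t tuv xt.
exact: le_lt_trans (lf _ _ xuv tuv) xt.
Qed.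

Lemma partition_sumE f u s :
  \sum_(0 <= i < size s) mdist (f (nth u (u :: s) i)) (f (nth u (u :: s) i.+1))
    = clen (f u) (map f s).
Proof.
have G w : \sum_(0 <= i < size s)
    mdist (f (nth w (u :: s) i)) (f (nth w (u :: s) i.+1)) = clen (f u) (map f s).
  elim: s u => [|t s IH] u; first by rewrite big_nil.
  by rewrite /= big_nat_recl// -IH.
exact: G.
Qed.

Lemma curve_length_ge f u v s : itv_partition u v s ->
  ((clen (f u) (map f s))%:E <= curve_length f u v)%E.
Proof.
by move=> us; apply: ereal_sup_ubound; exists s => //; rewrite partition_sumE.
Qed.

Lemma curve_length_lip f u v : lip1 f u v -> (curve_length f u v <= (v - u)%:E)%E.
Proof.
move=> lf; apply: ge_ereal_sup => _ [s [us /eqP ls] <-].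
rewrite lee_fin partition_sumE.
elim: s u lf us ls => [|t s IH] u lf /=; first by move=> _ ->; rewrite subrr.
move=> /andP[ut ts] ls.
have tv : t <= v by apply: (@itv_partition_le _ _ _ _ s); split => //; apply/eqP.
rewrite -(subrKA t v (- u)) [in leRHS]addrC; apply: lerD.
  rewrite (le_trans (lf _ _ _ _)) ?lexx ?(ltW ut) ?tv ?(le_trans (ltW ut))//.
  by rewrite distrC gtr0_norm ?subr_gt0// addrC.
rewrite IH// => x y /andP[tx xv] /andP[ty yv]; apply: lf.
  by rewrite (le_trans (ltW ut)).
by rewrite (le_trans (ltW ut)).
Qed.

(** The supremum of the parameters reachable from u is reachable and cannot be smaller than v, by
    continuity at that supremum. *)
Lemma path_sampling f u v e : u <= v -> 0 < e -> {within `[u, v], continuous f} ->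
  exists2 s, itv_partition u v s & path (step e) (f u) (map f s).
Proof.
move=> uv e0 /within_contP cf.
pose A := [set t | u <= t <= v /\
  exists2 s, itv_partition u t s & path (step e) (f u) (map f s)].
have Au : A u by split; rewrite ?lexx//; exists [::].
have hsA : has_sup A by split; [exists u|exists v => t [/andP[]]].
have cuv : u <= sup A <= v.
  rewrite (ub_le_sup _ Au)//=; last by case: hsA.
  by apply: ge_sup; [exists u|move=> t [/andP[]]].
have e20 : 0 < e / 2 by rewrite divr_gt0.
have [d d0 Hd] := cf _ cuv _ e20.
have [t At ct] := sup_adherent d0 hsA.
have tc : t <= sup A by apply: ub_le_sup => //; case: hsA.
(* [t'] is v if v is within d / 2 of the supremum, and lies beyond the supremum otherwise; since
   [t'] turns out to be reachable, it must be v. *)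
have [t' [t'v ct' t'd t'E]] : exists t', [/\ t' <= v, sup A <= t',
    t' <= sup A + d / 2 & t' <= sup A -> v = t'].
  move: cuv => /andP[_ cv].
  have [h|h] := leP v (sup A + d / 2); [exists v|exists (sup A + d / 2)];
    by split; lra.
have At' : A t'.
  have [tt'|t't] := ltP t t'; last first.
    by have -> : t' = t by lra.
  case: At => tuv [s [ps ls] cs]; split; first by rewrite t'v andbT; lra.
  exists (rcons s t').
    by split; rewrite ?last_rcons// rcons_path ps (eqP ls).
  rewrite map_rcons rcons_path cs /=. rewrite last_map (eqP ls) /step.
  rewrite (le_trans (metric_triangle _ (f (sup A)) _))// (splitr e); apply: lerD.
    by rewrite metric_sym ltW// Hd// ger0_norm ?subr_ge0//; lra.
  rewrite ltW// Hd//; first by rewrite t'v andbT; lra.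
  rewrite distrC ger0_norm ?subr_ge0// ltrBlDr.
  lra.
have t'c : t' <= sup A by apply: ub_le_sup => //; case: hsA.
by have -> := t'E t'c; case: At'.
Qed.

Lemma path_chain (p : interval_map R X) (l e : R) : is_path p ->
  (path_length p <= l%:E)%E -> 0 < e ->
  exists s, [/\ path (step e) (im_source p) s, last (im_source p) s = im_target p,
    {in im_source p :: s, forall z, im_image p z} & clen (im_source p) s <= l].
Proof.
move=> cp lp e0; have [s us cs] := path_sampling (im_le p) e0 cp.
exists (map p s); split => //.
- by rewrite /im_source last_map; case: us => _ /eqP ->.
- have [+ /eqP ls] := us; rewrite -[im_source p :: _]/(map p (im_beg p :: s)).
  move=> ps z /mapP[t ts ->]; exists t => //; rewrite /= in_itv/=.
  have : sorted <=%O (im_beg p :: s) by apply: sub_path ps => x y /ltW.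
  rewrite sorted_pairwise; last exact: le_trans.
  move=> H; apply/andP; split.
    move: ts; rewrite inE => /predU1P[->//|].
    by move: H => /= /andP[/allP H _] /H.
  move: H ts; rewrite -ls lastI pairwise_rcons => /andP[/allP H _].
  by rewrite mem_rcons inE => /predU1P[->//|/H].
- by rewrite -lee_fin (le_trans _ lp)// curve_length_ge.
Qed.

(** The geodesics between consecutive points are concatenated on [0, clen a s] into a 1-Lipschitz
    map, which yields continuity and the length bound at once. *)
Lemma chain_path (geoX : geodesic_set [set: X]) (d : R) a s : 0 <= d ->
  path (step d) a s ->
  exists p : interval_map R X, [/\ is_path p, im_source p = a, im_target p = last a s,
    (path_length p <= (clen a s)%:E)%E &
    forall x, im_image p x -> exists2 z, z \in a :: s & mdist z x <= d].
Proof.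
move=> d0 ps.
suff [f [lf f0 fT fi]] : exists f, [/\ lip1 f 0 (clen a s), f 0 = a,
    f (clen a s) = last a s & forall t, 0 <= t <= clen a s ->
    exists2 z, z \in a :: s & mdist z (f t) <= d].
  exists (IntervalMap f (clen_ge0 a s)); split => //=.
  - exact: lip1_cont.
  - by apply: le_trans (curve_length_lip _) _ => //=; rewrite subr0.
  - by move=> x [t /=]; rewrite in_itv/= => /fi h <-.
elim: s a ps => [|b s IH] a /=.
  move=> _; exists (fun=> a); split => //.
    by move=> s t _ _; rewrite mdistxx.
  by move=> t _; exists a; rewrite ?mdistxx ?inE.
move=> /andP[ab /IH [f [lf f0 fT fi]]].
have [g [gg g0 gD _]] := geoX a b I I.
have D0 := mdist_ge0 a b; have T0 := clen_ge0 b s.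
exists (fun t => if t <= mdist a b then g t else f (t - mdist a b)); split.
- by apply: lip1_cat => //; [exact: geodesic_lip1|rewrite gD].
- by rewrite D0.
- case: ifPn => [h|_]; last by rewrite addrAC subrr add0r.
  have E : clen b s = 0 by lra.
  by rewrite E addr0 gD -fT E f0.
- move=> t /andP[t0 tT]; case: ifPn => [tD|tD].
    exists a; first by rewrite mem_head.
    rewrite -{1}g0 (geoE gg) ?lexx ?t0//.
    by rewrite sub0r normrN ger0_norm// (le_trans tD).
  have [|z zs zd] := fi (t - mdist a b).
    by move: tD; rewrite -ltNge => tD; apply/andP; split; lra.
  by exists z => //; rewrite inE zs orbT.
Qed.

End Lipschitz.

(** * The bottleneck property *)

Lemma nat_ge (R : archiRealFieldType) (x : R) : exists m : nat, x <= m%:R.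
Proof.
exists (Num.bound `|x|); rewrite (le_trans (ler_norm _))// ltW//.
exact: archi_boundP.
Qed.

Section QuasiLine.
Context {R : realType} {X : metricType R} (geoX : geodesic_set [set: X]).
Context (q : R -> X) (L0 C0 : R) (L01 : 1 <= L0) (C00 : 0 <= C0).
Context (qgq : quasi_geodesic L0 C0 `]-oo, +oo[ q).
Implicit Types (s t r u d : R).

Let L00 : 0 < L0. Proof. exact: lt_le_trans ltr01 L01. Qed.

Lemma qg_upper s t : mdist (q s) (q t) <= L0 * `|s - t| + C0.
Proof. by have [] := @qgq s t isT isT. Qed.

Lemma qg_lower s t : `|s - t| <= L0 * (mdist (q s) (q t) + C0).
Proof.
have [h _] := @qgq s t isT isT.
by rewrite mulrC -ler_pdivrMr// mulrC; lra.
Qed.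

Definition bottleneck_for M N D := forall s r t d (c : seq X),
  s <= r <= t -> 0 <= d -> (size c <= N)%N -> path (step d) (q s) c ->
  last (q s) c = q t -> exists2 z, z \in q s :: c & mdist (q r) z <= M * d + D.

Definition chain_bottleneck := exists2 M : R, 0 <= M & forall N,
  exists2 D : R, 0 <= D & bottleneck_for M N D.

(** The requirement [d <= mdist (q s) (q t)] bounds the length of the chain by N times the distance
    of its endpoints, so that conditions on short paths apply to it. *)
Definition weak_bottleneck := exists2 M : R, 1 <= M & forall N,
  exists2 D : R, 0 <= D & forall s t d (c : seq X),
  s <= t -> d <= mdist (q s) (q t) -> 0 <= d -> (size c <= N)%N ->
  path (step d) (q s) c -> last (q s) c = q t ->
  exists r, s + (t - s) / 4 <= r <= t - (t - s) / 4 /\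
  exists2 z, z \in q s :: c & mdist (q r) z <= M * d + D.

(** U need not be closed, since q need not be continuous; so s1 is only within 1 of the supremum,
    and U is excluded from s1 + 1 on. *)
Lemma last_moment (U : R -> Prop) s r : U s -> s <= r ->
  exists s1, [/\ s <= s1 <= r, U s1 & forall u, s1 + 1 <= u <= r -> ~ U u].
Proof.
move=> Us sr; pose A := [set u | s <= u <= r /\ U u].
have hsA : has_sup A.
  by split; [exists s; rewrite /A/= lexx|exists r => u [/andP[]]].
have [s1 [s1r Us1] h] := sup_adherent ltr01 hsA.
exists s1; split => // u /andP[su ur] Uu.
have : u <= sup A.
  apply: ub_le_sup; [by case: hsA|split=> //].
  by rewrite ur andbT; move: s1r => /andP[]; lra.
lra.
Qed.

Lemma first_moment (U : R -> Prop) r t : U t -> r <= t ->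
  exists t1, [/\ r <= t1 <= t, U t1 & forall u, r <= u <= t1 - 1 -> ~ U u].
Proof.
move=> Ut rt; have [||s1 [/andP[h1 h2] Us1 H]] :=
  @last_moment (fun u => U (- u)) (- t) (- r).
- by rewrite opprK.
- by rewrite lerN2.
exists (- s1); split => //; first by rewrite lerNr h2 lerNl h1.
move=> u /andP[ru us]; have := H (- u); rewrite opprK; apply.
by apply/andP; split; lra.
Qed.

Lemma cat3_chain d a (c1 c2 c3 : seq X) b b' : path (step d) a c1 -> last a c1 = b ->
  path (step d) b c2 -> last b c2 = b' -> path (step d) b' c3 ->
  [/\ path (step d) a (c1 ++ c2 ++ c3), last a (c1 ++ c2 ++ c3) = last b' c3 &
   forall w, w \in a :: (c1 ++ c2 ++ c3) -> [\/ w \in a :: c1, w \in b :: c2 | w \in b' :: c3]].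
Proof.
move=> p1 l1 p2 l2 p3; rewrite !cat_path p1 l1 p2 l2 p3 !last_cat l1 l2.
split => // w; rewrite -cat_cons !mem_cat => /or3P[|h|h]; first by constructor 1.
  by constructor 2; rewrite inE h orbT.
by constructor 3; rewrite inE h orbT.
Qed.

End QuasiLine.

(** Let q r be far from the chain, and let [s1, t1] be, up to 1, a maximal interval around r on
    which q avoids the tau-neighborhood of the chain. Two geodesics of length at most tau connect q
    s1 and q t1 to a part of the chain, and the weak bottleneck gives a point q r' of the middle
    half close to the new chain. It is not close to the old chain, by the choice of the interval,
    nor to the two geodesics, whose points are close to q s1 or q t1 while r' is far from both
    parameters. *)
Lemma weak_bottleneckW {R : realType} {X : metricType R} (geoX : geodesic_set [set: X])
  (q : R -> X) (L0 C0 : R) (L01 : 1 <= L0) (C00 : 0 <= C0)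
  (qgq : quasi_geodesic L0 C0 `]-oo, +oo[ q) : weak_bottleneck q -> chain_bottleneck q.
Proof.
move=> [La La1 W].
have L00 : 0 < L0 by exact: lt_le_trans L01.
(* [mu * d + D1] will be the radius tau, and [E * d] a lower bound for the parameter distance from r
   to the points of q in the tau-neighborhood; M is large enough to imply this bound. E separates q
   r' from q s1 and q t1 by more than tau plus the error of the weak bottleneck. *)
have [mu muE] : exists mu : R, mu = La + 1 by exists (La + 1).
have [E EE] : exists E : R, E = 2 * L0 * (2 * La + 5) by exists (2 * L0 * (2 * La + 5)).
have [M ME] : exists M : R, M = mu + 2 + L0 * E by exists (mu + 2 + L0 * E).
have LLa : 0 <= L0 * La by apply: mulr_ge0; lra.
have ELa : 10 * L0 <= E by rewrite EE; lra.
have E0 : 0 <= E by lra.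
have LE : 10 <= L0 * E.
  by have : 1 * E <= L0 * E; [rewrite ler_wpM2r|lra].
have M0 : 0 <= M by rewrite ME muE; lra.
exists M => // N.
have [m hm] : exists m : nat, mu + 1 <= m%:R.
  exact: nat_ge.
have [D D0 HD] := W (m + N + m)%N.
(* For d at least D1, the constants D, 1 and C0 are all at most d. Smaller d are raised to D1, at
   the cost of the additive constant M * D1. *)
have [D1 D1E] : exists D1 : R, D1 = D + 1 + C0 by exists (D + 1 + C0).
have D10 : 0 <= D1 by rewrite D1E; lra.
suff H : forall (s r t d : R) (c : seq X),
  s <= r <= t -> D1 <= d -> (size c <= N)%N -> path (step d) (q s) c ->
  last (q s) c = q t -> exists2 z, z \in q s :: c & mdist (q r) z <= M * d.
  exists (M * D1); first exact: mulr_ge0.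
  move=> s r t d c srt d0 cN pc lc.
  have [dD|/ltW Dd] := leP d D1.
    have [z zc hz] := H s r t D1 c srt (lexx _) cN (chain_le dD pc) lc.
    by exists z => //; rewrite (le_trans hz)// lerDr mulr_ge0.
  have [z zc hz] := H s r t d c srt Dd cN pc lc.
  by exists z => //; rewrite (le_trans hz)// lerDl mulr_ge0.
move=> s r t d c /andP[sr rt] Dd cN pc lc.
apply: contrapT => far0.
have {}far z : z \in q s :: c -> M * d < mdist (q r) z.
  by move=> zc; rewrite ltNge; apply/negP => h; apply: far0; exists z.
have d1 : 1 <= d by move: Dd; rewrite D1E; lra.
have dC : C0 <= d by move: Dd; rewrite D1E; lra.
have d0 : 0 <= d by lra.
have [tau tauE] : exists tau : R, tau = mu * d + D1 by exists (mu * d + D1).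
have tau0 : 0 <= tau by rewrite tauE addr_ge0// mulr_ge0// muE; lra.
have taum : tau <= m%:R * d.
  by apply: (@le_trans _ _ ((mu + 1) * d)); [rewrite tauE; lra|rewrite ler_wpM2r].
pose U (u : R) := exists2 z, z \in q s :: c & mdist (q u) z <= tau.
have [|s1 [/andP[ss1 s1r] [zi zic hzi] Hs1]] := @last_moment _ U s r _ sr.
  by exists (q s); rewrite ?mem_head// mdistxx.
have [|t1 [/andP[rt1 t1t] [zj zjc hzj] Ht1]] := @first_moment _ U r t _ rt.
  by exists (q t); rewrite -?lc ?mem_last// mdistxx.
have gap u z : z \in q s :: c -> mdist (q u) z <= tau -> E * d <= `|u - r|.
  move=> zc uz; have h1 := far z zc; have h2 := metric_triangle (q r) (q u) z.
  have h3 : (M - mu - 1) * d < mdist (q r) (q u).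
    by move: uz h1; rewrite tauE; lra.
  have h4 := qg_upper qgq r u; rewrite distrC in h4.
  have h5 : L0 * (E * d) <= L0 * `|u - r|.
    rewrite mulrA; have -> : L0 * E = M - mu - 2 by rewrite ME; ring.
    lra.
  by rewrite ler_pM2l in h5.
have gs := gap _ _ zic hzi; have gt := gap _ _ zjc hzj.
rewrite distrC ger0_norm ?subr_ge0// in gs; rewrite ger0_norm ?subr_ge0// in gt.
have T2 : 2 * (E * d) <= t1 - s1 by clear -gs gt; lra.
have Ed : 10 <= E * d.
  have E10 : 10 <= E by clear -ELa L01; lra.
  by apply: (le_trans E10); rewrite ler_peMr.
have [c2 [pc2 lc2 sc2 sub2]] := subchain d0 pc zic zjc.
have [c1 [pc1 lc1 sc1 on1]] := chain_geodesic geoX d0 (le_trans hzi taum).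
have hzj' : mdist zj (q t1) <= m%:R * d by rewrite metric_sym (le_trans hzj).
have [c3 [pc3 lc3 sc3 on3]] := chain_geodesic geoX d0 hzj'.
have [pp ll mm] := cat3_chain pc1 lc1 pc2 lc2 pc3.
have dlow u v : 2 * (E * d) <= 4 * `|u - v| -> (2 * La + 5) * d - C0 <= mdist (q u) (q v).
  move=> h; have h1 := qg_lower L01 qgq u v.
  rewrite lerBlDr -(ler_pM2l L00); apply: le_trans h1.
  have -> : L0 * ((2 * La + 5) * d) = E * d / 2 by rewrite EE; field.
  by clear -h; lra.
have st1 : s1 <= t1 by exact: le_trans rt1.
have dst : d <= mdist (q s1) (q t1).
  have h := dlow s1 t1; rewrite distrC ger0_norm ?subr_ge0// in h.
  have h' : 2 * (E * d) <= 4 * (t1 - s1) by clear -T2 Ed; lra.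
  have Lad : 0 <= La * d by rewrite mulr_ge0// (le_trans ler01).
  by apply: le_trans (h h'); clear -Lad dC d1; lra.
have sN : (size (c1 ++ c2 ++ c3) <= m + N + m)%N.
  by rewrite !size_cat addnA leq_add// leq_add// (leq_trans sc2).
have [r' [/andP[r'1 r'2] [w wc hw]]] := HD s1 t1 d _ st1 dst d0 sN pp (etrans ll lc3).
have r's : s1 + 1 <= r' by clear -r'1 T2 Ed; lra.
have r't : r' <= t1 - 1 by clear -r'2 T2 Ed; lra.
have small : mdist (q r') w < tau by rewrite tauE muE D1E; clear -hw d1 C00; lra.
have far' z : z \in q s :: c -> tau < mdist (q r') z.
  move=> zc; rewrite ltNge; apply/negP => hz.
  have [r'r|/ltW rr'] := leP r' r.
    by apply: (Hs1 r'); [rewrite r's|exists z].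
  by apply: (Ht1 r'); [rewrite rr'|exists z].
have conn v : 2 * (E * d) <= 4 * `|r' - v| -> mdist (q v) w <= tau -> False.
  move=> /dlow h1; have := metric_triangle (q r') w (q v).
  rewrite (metric_sym w) tauE muE => h2 h3.
  by rewrite D1E in Dd h3; clear -h1 h2 h3 Dd hw d1; lra.
have [w1|/sub2 /far' w2|w3] := mm _ wc.
- apply: (conn s1).
    by rewrite ger0_norm; clear -r'1 r's T2; lra.
  by apply: le_trans hzi; rewrite -(on1 _ w1) lerDl mdist_ge0.
- by have := lt_trans w2 small; rewrite ltxx.
- apply: (conn t1).
    by rewrite distrC ger0_norm; clear -r'2 r't T2; lra.
  apply: le_trans hzj; rewrite (metric_sym (q t1) zj) -(on3 _ w3) metric_sym.
  by rewrite lerDr mdist_ge0.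
Qed.

(** * From the crossing and covering conditions to the weak bottleneck *)

Section Conditions.
Context {R : realType} {X : metricType R}.
Implicit Types (q : R -> X) (L : X -> X -> set (interval_map R X)).

Definition paths_cross_middle q := forall C : R, 1 <= C -> exists2 D : R, 0 <= D &
  forall (n : R) (p : interval_map R X), is_path p ->
    range q (im_source p) -> range q (im_target p) ->
    n <= mdist (im_source p) (im_target p) ->
    (path_length p <= (C * n)%:E)%E ->
    im_image p `&`
      tubular (middle_third q (im_source p) (im_target p)) D !=set0.

Definition quasi_paths_cross_middle L q := forall (C : R) (k : nat),
  1 <= C -> (0 < k)%N -> exists2 D : R, 0 <= D &
  forall (a b : X) (ps : seq (interval_map R X)),
    range q a -> range q b ->
    size ps = k -> quasi_path L ps a b ->
    quasi_length ps <= C * mdist a b ->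
    quasi_path_image ps `&` tubular (middle_third q a b) D !=set0.

Definition paths_cover q := forall C eps : R, 1 <= C -> 0 < eps ->
  exists2 D : R, 0 <= D &
  forall (a b : X) (p : interval_map R X),
    range q a -> range q b -> D <= mdist a b ->
    is_path p -> im_source p = a -> im_target p = b ->
    (path_length p <= (C * mdist a b)%:E)%E ->
    sub_qg q a b `<=` tubular (im_image p) (eps * mdist a b).

End Conditions.

Section Third.
Context {R : realType} {X : metricType R} (geoX : geodesic_set [set: X]).
Context (q : R -> X) (L0 C0 : R) (L01 : 1 <= L0) (C00 : 0 <= C0).
Context (qgq : quasi_geodesic L0 C0 `]-oo, +oo[ q).
Implicit Types (s t r u d : R).

Lemma between_itv s t r : s <= r <= t -> between q (q s) (q t) r.
Proof. by move=> h; exists s, t; split => //; left. Qed.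

(** q takes the value q s only at parameters within L0 C0 of s, so the maximal subsegment exceeds
    [s, t] by a bounded amount. *)
Lemma between_bound s t r : s <= t -> between q (q s) (q t) r ->
  s - L0 * C0 <= r <= t + L0 * C0.
Proof.
move=> st [s' [t' [es et h]]].
have := qg_lower L01 qgq s s'; have := qg_lower L01 qgq t t'.
rewrite es et !mdistxx !add0r !ler_norml => /andP[? ?] /andP[? ?].
by case: h => /andP[? ?]; apply/andP; split; lra.
Qed.

Lemma between_sym a b : between q a b = between q b a.
Proof.
by apply/seteqP; split => r [s [t [es et [h|h]]]]; exists t, s; split => //; [right|left|right|left].
Qed.

(** If m is covered by neither of the two given intervals, a parameter of a from one and a parameter
    of b from the other lie on both sides of m. *)
Lemma between_itvP a b u v m : between q a b u -> between q a b v -> u <= m <= v ->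
  between q a b m.
Proof.
move=> [s1 [t1 [es1 et1 h1]]] [s2 [t2 [es2 et2 h2]]] /andP[um mv].
have [m1|m1] := leP s1 m; have [m2|m2] := leP t1 m;
have [m3|m3] := leP s2 m; have [m4|m4] := leP t2 m;
  solve [ exists s1, t1; split => //; lra
        | exists s1, t2; split => //; lra
        | exists s2, t1; split => //; lra
        | exists s2, t2; split => //; lra
        | exfalso; lra].
Qed.

Lemma between_sup s t (I := between q (q s) (q t)) : s <= t ->
  [/\ has_sup I, has_inf I, s - L0 * C0 <= inf I <= s & t <= sup I <= t + L0 * C0].
Proof.
move=> st.
have Is : I s by apply: between_itv; rewrite lexx st.
have It : I t by apply: between_itv; rewrite lexx st.
have hs : has_sup I.
  by split; [exists s|exists (t + L0 * C0) => r /(between_bound st) /andP[]].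
have hi : has_inf I.
  by split; [exists s|exists (s - L0 * C0) => r /(between_bound st) /andP[]].
split => //; apply/andP; split.
- by apply: lb_le_inf; [case: hi|move=> r /(between_bound st) /andP[]].
- by apply: inf_lbound Is; case: hi.
- by apply: ub_le_sup => //; case: hs.
- by apply: ge_sup; [case: hs|move=> r /(between_bound st) /andP[]].
Qed.

Lemma third_bound s t r : s <= t -> third (between q (q s) (q t)) r ->
  s + (t - s) / 3 - L0 * C0 <= r <= t - (t - s) / 3 + L0 * C0.
Proof.
move=> st; have [_ _] := between_sup st.
rewrite /third /=; set i := inf _; set S := sup _.
move=> /andP[? ?] /andP[? ?] [_]; rewrite /= in_itv/= => /andP[? ?].
by apply/andP; split; lra.
Qed.

(** The middle fifth of [s, t] is an inner approximation of the middle third that is insensitive to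
    the overshoot L0 C0 of the maximal subsegment. *)
Lemma third_in s t r : s <= t -> 10 * (L0 * C0) <= t - s ->
  s + 2 / 5 * (t - s) <= r <= t - 2 / 5 * (t - s) ->
  third (between q (q s) (q t)) r.
Proof.
move=> st big /andP[r1 r2]; have [_ _ hI hS] := between_sup st.
rewrite /third /=; split; first by apply: between_itv; apply/andP; split; lra.
move: hI hS; set i := inf _; set S := sup _.
move=> /andP[? ?] /andP[? ?]; rewrite /= in_itv/=.
by apply/andP; split; lra.
Qed.

(** The interval need not be closed, but its midpoint is interior unless the interval is reduced to
    s. *)
Lemma third_nonempty s t : s <= t -> third (between q (q s) (q t)) !=set0.
Proof.
move=> st; have [hs hi hI hS] := between_sup st.
pose I := between q (q s) (q t); rewrite -/I in hs hi hI hS *.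
have iS : inf I <= sup I by move: hI hS => /andP[_ ?] /andP[? _]; lra.
exists ((inf I + sup I) / 2); split; last by rewrite /= in_itv/=; apply/andP; split; lra.
have [E|E] := eqVneq (inf I) (sup I).
  have -> : (inf I + sup I) / 2 = s by move: hI hS => /andP[? ?] /andP[? _]; lra.
  by apply: between_itv; rewrite lexx st.
have lt : inf I < sup I by rewrite lt_neqAle E.
have e0 : 0 < (sup I - inf I) / 2 by lra.
have [u Iu hu] := sup_adherent e0 hs.
have [v Iv hv] := inf_adherent e0 hi.
by apply: between_itvP Iv Iu _; apply/andP; split; lra.
Qed.

Lemma near_start s t r B : s <= t -> s <= r <= t -> mdist (q s) (q t) <= B ->
  mdist (q r) (q s) <= L0 * (L0 * (B + C0)) + C0.
Proof.
move=> st /andP[sr rt] B0; have L1 := L01.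
rewrite (le_trans (qg_upper qgq _ _))// lerD2r ler_wpM2l; [|lra|].
  by [].
have : `|s - t| <= L0 * (B + C0).
  by rewrite (le_trans (qg_lower L01 qgq _ _))// ler_wpM2l ?lerD2r//; lra.
by rewrite distrC !ger0_norm ?subr_ge0//; lra.
Qed.

End Third.

Section ToWeak.
Context {R : realType} {X : metricType R} (geoX : geodesic_set [set: X]).
Context (q : R -> X) (L0 C0 : R) (L01 : 1 <= L0) (C00 : 0 <= C0).
Context (qgq : quasi_geodesic L0 C0 `]-oo, +oo[ q).
Implicit Types (s t r u d : R).

(** On an interval shorter than B, the midpoint is mapped within L0 B + C0 of q s, which is itself a
    point of the chain. *)
Lemma weak_from_long (M : R) : 1 <= M ->
  (forall N, exists2 B : R, 0 <= B & exists2 D : R, 0 <= D &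
    forall s t d (c : seq X), s <= t -> B <= t - s -> d <= mdist (q s) (q t) ->
    0 <= d -> (size c <= N)%N -> path (step d) (q s) c -> last (q s) c = q t ->
    exists r, s + (t - s) / 4 <= r <= t - (t - s) / 4 /\
    exists2 z, z \in q s :: c & mdist (q r) z <= M * d + D) ->
  weak_bottleneck q.
Proof.
move=> M1 H; exists M => // N; have [B B0 [D D0 HD]] := H N.
have L1 := L01; have C00' := C00.
exists (D + (L0 * B + C0)); first by rewrite !addr_ge0// mulr_ge0//; lra.
move=> s t d c st dst d0 cN pc lc.
have Md0 : 0 <= M * d by rewrite mulr_ge0//; lra.
have [tsB|Bts] := ltP (t - s) B; last first.
  have [r [hr [z zc hz]]] := HD s t d c st Bts dst d0 cN pc lc.
  exists r; split => //; exists z => //.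
  have : 0 <= L0 * B by rewrite mulr_ge0//; lra.
  lra.
exists (s + (t - s) / 2); split; first by apply/andP; split; lra.
exists (q s); first exact: mem_head.
have h := qg_upper qgq (s + (t - s) / 2) s.
have : L0 * `|s + (t - s) / 2 - s| <= L0 * B.
  by rewrite ler_wpM2l; [|lra|rewrite ger0_norm; lra].
lra.
Qed.

Lemma dist_long (B : R) s t : s <= t -> L0 * (B + C0) <= t - s -> B <= mdist (q s) (q t).
Proof.
move=> st h; have := qg_lower L01 qgq s t; rewrite distrC ger0_norm ?subr_ge0//.
have L1 := L01; have L2 : 0 < L0 by lra.
by move=> /(le_trans h); rewrite ler_pM2l//; lra.
Qed.

Lemma third_weak s t r : s <= t -> 12 * (L0 * C0) <= t - s ->
  third (between q (q s) (q t)) r -> s + (t - s) / 4 <= r <= t - (t - s) / 4.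
Proof.
move=> st h /(third_bound L01 qgq st) /andP[? ?]; apply/andP; split; lra.
Qed.

Lemma paths_cross_weak : paths_cross_middle q -> weak_bottleneck q.
Proof.
move=> H; apply: (@weak_from_long 1) => // N.
have N1 : 1 <= N.+1%:R :> R by rewrite ler1n.
have [D D0 HD] := H _ N1.
exists (12 * (L0 * C0)); first by rewrite !mulr_ge0//; have := L01; lra.
exists D => // s t d c st big dst d0 cN pc lc.
have [p [cp ps pt lp ip]] := chain_path geoX d0 pc.
have [||||x [px [y [r hr <-] hy]]] := HD (mdist (q s) (q t)) p cp.
- by rewrite ps; exists s.
- by rewrite pt lc; exists t.
- by rewrite ps pt lc.
- rewrite (le_trans lp)// lee_fin (le_trans (clen_step pc))//.
  by rewrite ler_pM//; rewrite ler_nat leqW.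
rewrite ps pt lc in hr.
exists r; split; first exact: third_weak hr.
have [z zc hz] := ip x px; exists z => //.
have := metric_triangle (q r) x z; rewrite (metric_sym x z) (metric_sym (q r) x) mul1r; lra.
Qed.

Lemma paths_cover_weak : paths_cover q -> weak_bottleneck q.
Proof.
move=> H; apply: (@weak_from_long 2); first by rewrite ler1n.
move=> N.
have N1 : 1 <= N.+1%:R :> R by rewrite ler1n.
have N0 : 0 < N.+1%:R :> R by rewrite ltr0n.
(* The endpoints are at distance at most (N + 1) d, so covering with eps = 1 / (N + 1) means
   covering up to d. *)
have N0' : 0 < N.+1%:R^-1 :> R by rewrite invr_gt0.
have [D D0 HD] := H _ _ N1 N0'.
have L1 := L01; have C00' := C00.
exists (L0 * (D + C0)); first by rewrite mulr_ge0; lra.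
exists 0 => // s t d c st big dst d0 cN pc lc.
have [p [cp ps pt lp ip]] := chain_path geoX d0 pc.
have Nd : mdist (q s) (q t) <= N.+1%:R * d.
  rewrite -lc (le_trans (mdist_last_clen _ _))// (le_trans (clen_step pc))//.
  by rewrite ler_wpM2r// ler_nat leqW.
have rs : range q (q s) by exists s.
have rt : range q (q t) by exists t.
rewrite lc in pt.
have lpC : (path_length p <= (N.+1%:R * mdist (q s) (q t))%:E)%E.
  rewrite (le_trans lp)// lee_fin (le_trans (clen_step pc))//.
  by rewrite ler_pM//; rewrite ler_nat leqW.
have mid : sub_qg q (q s) (q t) (q (s + (t - s) / 2)).
  exists (s + (t - s) / 2); last reflexivity.
  by apply: between_itv; apply/andP; split; lra.
have [x px hx] := HD _ _ p rs rt (dist_long st big) cp ps pt lpC _ mid.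
exists (s + (t - s) / 2); split; first by apply/andP; split; lra.
have [z zc hz] := ip x px; exists z => //.
have : N.+1%:R^-1 * mdist (q s) (q t) <= d by rewrite mulrC ler_pdivrMr// mulrC.
move=> /(lt_le_trans hx) {}hx.
have := metric_triangle (q (s + (t - s) / 2)) x z.
by rewrite (metric_sym x z); lra.
Qed.

(** By the lower quasi-geodesic bound, an element of L between points at distance at most d has
    width at most lambda (d + kappa); by the upper bound it strays at most lambda times that, plus
    kappa, from its source. This is why lambda squared plays the part of M. *)
Lemma system_chain (lambda kappa d : R) L a (c : seq X) : 1 <= lambda -> 0 <= kappa ->
  0 <= d -> quasi_geodesic_system lambda kappa L -> path (step d) a c ->
  exists ps, [/\ size ps = size c, quasi_path L ps a (last a c),
    quasi_length ps <= (size c)%:R * (lambda * (d + kappa)) &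
    forall x, quasi_path_image ps x -> exists2 z, z \in a :: c &
      mdist z x <= lambda * (lambda * (d + kappa)) + kappa].
Proof.
move=> l1 k0 d0 [Lne Lqg _]; elim: c a => [|b c IH] a /=.
  move=> _; exists [::]; split => //; first by rewrite /quasi_length big_nil mul0r.
  by move=> x; rewrite /quasi_path_image big_nil.
move=> /andP[ab /IH [ps [sps qps lps ips]]].
have [p Lp] := Lne a b; have [qp sp tp] := Lqg _ _ _ Lp.
have pe := im_le p.
have lam0 : 0 < lambda by lra.
have pw : im_width p <= lambda * (d + kappa).
  have [h _] := qp (im_beg p) (im_end p) ltac:(by rewrite in_itv/= lexx pe)
    ltac:(by rewrite in_itv/= lexx pe).
  move: h; rewrite -[p (im_beg p)]/(im_source p) -[p (im_end p)]/(im_target p) sp tp.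
  rewrite distrC ger0_norm ?subr_ge0// -/(im_width p) => h.
  rewrite -ler_pdivrMl//.
  by move: ab; rewrite /step; lra.
exists (p :: ps); split => /=.
- by rewrite sps.
- by exists b.
- by rewrite /quasi_length big_cons -natr1 mulrDl mul1r addrC lerD.
- move=> x; rewrite /quasi_path_image big_cons => -[[u /=]|/ips [z zc hz]].
    rewrite in_itv/= => ui <-; exists a; first exact: mem_head.
    have [_ h] := qp (im_beg p) u ltac:(by rewrite in_itv/= lexx pe) ltac:(by rewrite in_itv/=).
    move: h; rewrite -[p (im_beg p)]/(im_source p) sp => h.
    rewrite (le_trans h)// lerD2r ler_wpM2l//; first lra.
    apply: le_trans pw; move: ui => /andP[? ?].
    by rewrite distrC ger0_norm ?subr_ge0// /im_width lerD2r.
  by exists z => //; rewrite inE zc orbT.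
Qed.

Lemma quasi_paths_cross_weak (lambda kappa : R) L : 1 <= lambda -> 0 <= kappa ->
  quasi_geodesic_system lambda kappa L -> quasi_paths_cross_middle L q ->
  weak_bottleneck q.
Proof.
move=> l1 k0 sysL H.
have ll : lambda <= lambda * lambda by rewrite ler_peMl//; lra.
apply: (@weak_from_long (lambda * lambda)); first lra.
move=> N.
have N0 : 0 <= N.+1%:R :> R by rewrite ler0n.
have NL0 : 0 <= N.+1%:R * lambda by rewrite mulr_ge0//; lra.
(* The N + 1 pieces have total width at most (N + 1) lambda (d + kappa), and both d and kappa are at
   most the distance of the endpoints once s and t are far apart. *)
have C1 : 1 <= 2 * (N.+1%:R * lambda) + 1 by lra.
have [D D0 HD] := H _ N.+1 C1 isT.
have L1 := L01; have C00' := C00.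
have LC : 0 <= L0 * C0 by rewrite mulr_ge0//; lra.
have Lk : 0 <= L0 * kappa by rewrite mulr_ge0//; lra.
have llk : 0 <= lambda * lambda * kappa by rewrite mulr_ge0//; lra.
exists (L0 * (kappa + C0) + 12 * (L0 * C0)); first by rewrite mulrDr; lra.
exists (lambda * lambda * kappa + kappa + D); first lra.
move=> s t d c0 st big dst d0 cN0 pc0 lc0.
have [c [pc lc cN cm]] := chain_pad d0 (leqW cN0) pc0; rewrite lc0 in lc.
have [ps [sps qps lps ips]] := system_chain l1 k0 d0 sysL pc.
rewrite lc in qps; rewrite cN in sps lps.
have kd : kappa <= mdist (q s) (q t) by apply: dist_long => //; lra.
have rs : range q (q s) by exists s.
have rt : range q (q t) by exists t.
have [|x [px [y [r hr <-] hy]]] := HD _ _ ps rs rt sps qps.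
  apply: (le_trans lps); rewrite mulrA.
  have : N.+1%:R * lambda * (d + kappa) <= N.+1%:R * lambda * (2 * mdist (q s) (q t)).
    by rewrite ler_wpM2l//; lra.
  have := mdist_ge0 (q s) (q t); lra.
exists r; split; first by apply: third_weak hr => //; rewrite mulrDr in big; lra.
have [z zc hz] := ips x px; exists z; first by rewrite -cm.
have := metric_triangle (q r) x z; rewrite (metric_sym x z) (metric_sym (q r) x) => h.
apply: (le_trans h); move: hz; rewrite mulrDr mulrDr !mulrA; lra.
Qed.

End ToWeak.

(** * Contraction of the projection *)

(* Points are advanced greedily: from x to the first point at distance at least rho x / 4, a displacement which the chain has paid for with at least rho x / 4 of length. *)
Lemma drift {R : realType} {X : metricType R} (rho phi : X -> R) (eps theta sigma : R) :
  0 <= eps -> (forall x, 0 <= rho x) -> (forall x y, rho x <= mdist x y + rho y) ->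
  sigma <= theta / 4 ->
  (forall x y, theta <= rho x -> mdist x y <= rho x / 2 ->
    `|phi x - phi y| <= eps * rho x) ->
  forall a s,
  path (fun x y => (mdist x y <= sigma) && ((rho x < theta) ==> (phi x == phi y))) a s ->
  `|phi a - phi (last a s)| <= eps * (4 * clen a s + 2 * rho (last a s)).
Proof.
move=> e0 r0 rl st H a s; have [n] := ubnP (size s).
elim: n s a => // n IH [|b s] a sn ps.
  by rewrite /= subrr normr0 mulr_ge0// mulr0 add0r mulr_ge0.
have [ra|ra] := ltP (rho a) theta.
  move: ps => /= /andP[/andP[_ /implyP/(_ ra)/eqP ->] ps].
  apply: le_trans (IH s b sn ps) _; rewrite ler_wpM2l//.
  by have := mdist_ge0 a b; lra.
have [hs|hs] := boolP (has (fun z => rho a / 4 <= mdist a z) (b :: s)); last first.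
  have al : mdist a (last a (b :: s)) < rho a / 4.
    by rewrite ltNge; move/hasPn : hs; apply; rewrite /= mem_last.
  apply: (le_trans (H _ _ ra _)).
    by have := r0 a; lra.
  rewrite ler_wpM2l//; have := clen_ge0 a (b :: s).
  by have := rl a (last a (b :: s)); have := r0 a; lra.
case: (split_find hs) ps sn => z s1 s2 ez /hasPn as1.
rewrite cat_path rcons_path last_rcons => /andP[/andP[ps1 /andP[zs1 _]] ps2] sn.
have IH2 : `|phi z - phi (last z s2)| <= eps * (4 * clen z s2 + 2 * rho (last z s2)).
  apply: IH => //; move: sn; rewrite size_cat size_rcons addSn ltnS.
  by apply: leq_ltn_trans; rewrite leq_addl.
rewrite last_cat last_rcons clen_cat last_rcons.
have az : mdist a z <= clen a (rcons s1 z).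
  by have := mdist_last_clen a (rcons s1 z); rewrite last_rcons.
have az2 : mdist a z <= rho a / 2.
  apply: (le_trans (metric_triangle _ (last a s1) _)).
  have : mdist a (last a s1) <= rho a / 4.
    have := mem_last a s1; rewrite inE => /predU1P[->|/as1].
      by rewrite mdistxx; have := r0 a; lra.
    by rewrite -ltNge => /ltW.
  lra.
have h := H _ _ ra az2.
rewrite -(subrKA (phi z)) (le_trans (ler_normD _ _))//.
apply: (le_trans (lerD h IH2)).
rewrite -mulrDr ler_wpM2l//; lra.
Qed.

Section Contraction.
Context {R : realType} {X : metricType R} (geoX : geodesic_set [set: X]).
Context (q : R -> X) (L0 C0 : R) (L01 : 1 <= L0) (C00 : 0 <= C0).
Context (qgq : quasi_geodesic L0 C0 `]-oo, +oo[ q).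
Implicit Types (s t r u d : R) (x y : X).

Definition rho x := inf (range (fun v => mdist x (q v))).

Lemma rho_ge0 x : 0 <= rho x.
Proof.
apply: lb_le_inf; first by exists (mdist x (q 0)), 0.
by move=> _ [v _ <-]; exact: mdist_ge0.
Qed.

Lemma rho_le x v : rho x <= mdist x (q v).
Proof.
by apply: inf_lbound; [exists 0 => _ [u _ <-]; exact: mdist_ge0|exists v].
Qed.

Lemma rho_lip x y : rho x <= mdist x y + rho y.
Proof.
rewrite -lerBlDl; apply: lb_le_inf; first by exists (mdist y (q 0)), 0.
move=> _ [v _ <-]; rewrite lerBlDl (le_trans (rho_le _ v))//.
exact: metric_triangle.
Qed.

Lemma rho_q v : rho (q v) = 0.
Proof.
by apply/eqP; rewrite eq_le rho_ge0 andbT (le_trans (rho_le _ v))// mdistxx.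
Qed.

(** The infimum need not be attained, but the slack 1 makes the set nonempty. The value is a
    parameter and not a point, so that displacements along q are measured on the real line. *)
Definition qproj x := xget 0 [set v | mdist x (q v) <= rho x + 1].

Lemma qprojP x : mdist x (q (qproj x)) <= rho x + 1.
Proof.
rewrite /qproj; case: xgetP => // H; exfalso.
have hi : has_inf (range (fun v => mdist x (q v))).
  by split; [exists (mdist x (q 0)), 0|exists 0 => _ [v _ <-]; exact: mdist_ge0].
have [_ [v _ <-] hv] := inf_adherent ltr01 hi.
by apply: (H v) => /=; exact: ltW.
Qed.

Lemma bottleneck_sym M N D : bottleneck_for q M N D -> forall s r t d (c : seq X),
  s <= r <= t \/ t <= r <= s -> 0 <= d -> (size c <= N)%N -> path (step d) (q s) c ->
  last (q s) c = q t -> exists2 z, z \in q s :: c & mdist (q r) z <= M * d + D.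
Proof.
move=> H s r t d c [srt|trs] d0 cN pc lc; first exact: (H s r t d c).
have [c' [pc' lc' sc' mc' _]] := chain_rev pc; rewrite lc in pc' lc' mc'.
have [|z zc hz] := H t r s d c' trs d0 _ pc' lc'; first by rewrite sc'.
by exists z => //; rewrite -mc'.
Qed.

End Contraction.

(** A chain goes from the projection of x to x, to y, and to the projection of y; the bottleneck
    property gives w on it close to q u, where u is the midpoint of the two projection parameters.
    The leg from x to y stays at distance at least r / 2 from q, so w is on another leg. There, the
    almost minimality of the projection forces q u close to it, so u is close to one of the two
    parameters and both are close to each other. *)
Lemma proj_contraction {R : realType} {X : metricType R} (geoX : geodesic_set [set: X])
  (q : R -> X) (L0 C0 : R) (L01 : 1 <= L0) (C00 : 0 <= C0)
  (qgq : quasi_geodesic L0 C0 `]-oo, +oo[ q) :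
  chain_bottleneck q -> forall eps : R, 0 < eps ->
  exists2 theta : R, 1 <= theta & forall x y, theta <= rho q x -> mdist x y <= rho q x / 2 ->
  `|qproj q x - qproj q y| <= eps * rho q x.
Proof.
move=> [M M0 H] eps e0.
(* With steps d = r / m, this gives M d <= r / 8 and 8 L0 M d <= eps r. *)
have [m hm] := nat_ge (8 * L0 * M / eps + 8 * M + 1).
have LM : 0 <= 8 * L0 * M by rewrite !mulr_ge0//; lra.
have LMe : 0 <= 8 * L0 * M / eps by rewrite divr_ge0// ltW.
have m0 : 0 < m%:R :> R by lra.
have m1 : 8 * M <= m%:R by lra.
have m2 : 8 * L0 * M <= m%:R * eps by rewrite -ler_pdivrMr//; lra.
(* The legs have lengths at most 2 r, r and 3 r: the projections of x and y are at distance at most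
   r + 1 and 3 r / 2 + 1, and r >= 1. *)
have [D D0 HD] := H (2 * m + m + 3 * m)%N.
have K0 : 0 <= 4 * L0 * (2 * D + 1 + C0) by rewrite !mulr_ge0//; lra.
have K1 : 0 <= 4 * L0 * (2 * D + 1 + C0) / eps by rewrite divr_ge0// ltW.
(* The summands give, in order, r >= 1, D <= r / 8 and 4 L0 (2 D + 1 + C0) <= eps r. *)
exists (1 + 8 * D + 4 * L0 * (2 * D + 1 + C0) / eps); first by clear -K1 D0; lra.
move=> x y rx xy; set r := rho q x in rx xy *.
have r1 : 1 <= r.
  by clear -K1 rx D0; lra.
have rD : 8 * D <= r.
  by clear -K1 rx D0; lra.
have rK : 4 * L0 * (2 * D + 1 + C0) <= r * eps.
  by rewrite -ler_pdivrMr//; clear -K1 rx D0; lra.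
have [d d0 md] : exists2 d, 0 <= d & m%:R * d = r.
  exists (r / m%:R); last by rewrite mulrC divfK// gt_eqF.
  by apply: divr_ge0; [clear -r1|clear -m0]; lra.
have Md : 8 * (M * d) <= r.
  by rewrite -[leRHS]md mulrA ler_wpM2r.
have LMd : 8 * L0 * (M * d) <= r * eps.
  have -> : 8 * L0 * (M * d) = 8 * L0 * M * d by ring.
  have -> : r * eps = m%:R * eps * d by rewrite -md; ring.
  by rewrite ler_wpM2r.
have rxy : rho q y <= mdist x y + r by rewrite metric_sym rho_lip.
have [c1 [pc1 lc1 sc1 on1]] : exists c, [/\ path (step d) (q (qproj q x)) c,
    last (q (qproj q x)) c = x, (size c <= 2 * m)%N &
    {in q (qproj q x) :: c, forall w, mdist (q (qproj q x)) w + mdist w x = mdist (q (qproj q x)) x}].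
  apply: chain_geodesic => //.
  by rewrite natrM -mulrA md metric_sym (le_trans (qprojP q x))// -/r; lra.
have [c2 [pc2 lc2 sc2 on2]] : exists c, [/\ path (step d) x c,
    last x c = y, (size c <= m)%N &
    {in x :: c, forall w, mdist x w + mdist w y = mdist x y}].
  by apply: chain_geodesic => //; rewrite md; clear -xy r1; lra.
have [c3 [pc3 lc3 sc3 on3]] : exists c, [/\ path (step d) y c,
    last y c = q (qproj q y), (size c <= 3 * m)%N &
    {in y :: c, forall w, mdist y w + mdist w (q (qproj q y)) = mdist y (q (qproj q y))}].
  apply: chain_geodesic => //.
  by rewrite natrM -mulrA md (le_trans (qprojP q y))//; clear -rxy xy r1; lra.
have [pp ll mm] := cat3_chain pc1 lc1 pc2 lc2 pc3; rewrite lc3 in ll.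
pose u := (qproj q x + qproj q y) / 2.
have [||w wc hw] := bottleneck_sym HD (r := u) _ d0 _ pp ll.
- rewrite /u; have [h|h] := leP (qproj q x) (qproj q y); [left|right]; apply/andP; clear -h; split; lra.
- by rewrite !size_cat addnA leq_add// leq_add.
have close v : mdist (q v) (q u) <= 2 * (M * d + D) + 1 -> 2 * `|v - u| <= eps * r.
  move=> h; have := qg_lower L01 qgq v u.
  have : L0 * (mdist (q v) (q u) + C0) <= L0 * (2 * (M * d + D) + 1 + C0).
    by rewrite ler_wpM2l ?(le_trans ler01)// lerD2r.
  clear -LMd rK; lra.
have onproj z : mdist z w + mdist w (q (qproj q z)) = mdist z (q (qproj q z)) ->
    mdist (q (qproj q z)) (q u) <= 2 * (M * d + D) + 1.
  move=> hz; have h1 := qprojP q z; have h2 := rho_le q z u.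
  have h3 := metric_triangle z w (q u); have h4 := metric_triangle (q (qproj q z)) w (q u).
  rewrite (metric_sym w (q u)) in h3; rewrite (metric_sym (q (qproj q z)) w) (metric_sym w (q u)) in h4.
  clear -h1 h2 h3 h4 hw hz; lra.
have [w1|w2|w3] := mm _ wc.
- have : 2 * `|qproj q x - u| <= eps * r.
    apply/close/onproj.
    rewrite (metric_sym x w) (metric_sym w (q _)) (metric_sym x (q _)) addrC.
    exact: on1.
  have -> : qproj q x - u = (qproj q x - qproj q y) / 2 by rewrite /u; field.
  by rewrite normrM (ger0_norm (_ : 0 <= 2^-1)) ?invr_ge0//; clear; lra.
- exfalso; have h1 := on2 _ w2; have h2 := mdist_ge0 w y; have h3 := rho_lip q x w.
  have h4 := rho_le q w u; rewrite -/r in h3; rewrite (metric_sym w (q u)) in h4.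
  clear -h1 h2 h3 h4 hw xy Md rD r1; lra.
- have : 2 * `|qproj q y - u| <= eps * r by apply/close/onproj; exact: on3.
  have -> : qproj q y - u = (qproj q y - qproj q x) / 2 by rewrite /u; field.
  by rewrite normrM (ger0_norm (_ : 0 <= 2^-1)) ?invr_ge0// distrC; clear; lra.
Qed.

(** * Crossing and covering from the bottleneck property *)

Lemma max_lip {R : realDomainType} (u x y : R) : `|Num.max u x - Num.max u y| <= `|x - y|.
Proof.
have := ler_norm (x - y); have := ler_norm (y - x); rewrite (distrC y x) => h1 h2.
by rewrite ler_norml; case: (leP u x); case: (leP u y) => *; apply/andP; split; lra.
Qed.

Lemma min_lip {R : realDomainType} (u x y : R) : `|Num.min u x - Num.min u y| <= `|x - y|.
Proof.
have := ler_norm (x - y); have := ler_norm (y - x); rewrite (distrC y x) => h1 h2.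
by rewrite ler_norml; case: (leP u x); case: (leP u y) => *; apply/andP; split; lra.
Qed.

(** Two points outside [u, v] and less than v - u apart lie on the same side of it. *)
Lemma clamp_out {R : realDomainType} (u v x y : R) : u <= v -> ~ (u <= x <= v) -> ~ (u <= y <= v) ->
  `|x - y| < v - u -> Num.max u (Num.min v x) = Num.max u (Num.min v y).
Proof.
have lo z : u <= v -> z < u -> Num.max u (Num.min v z) = u.
  by move=> uv zu; rewrite min_r ?max_l//; lra.
move=> uv; rewrite ltr_norml => ox oy /andP[h1 h2].
have [xu|ux] := ltP x u; have [yu|uy] := ltP y u.
- by rewrite !lo.
- have [vy|yv] := ltP v y; first by exfalso; lra.
  by exfalso; apply: oy; rewrite uy.
- have [vx|xv] := ltP v x; first by exfalso; lra.
  by exfalso; apply: ox; rewrite ux.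
- have [vx|xv] := ltP v x; last by exfalso; apply: ox; rewrite ux.
  have [vy|yv] := ltP v y; last by exfalso; apply: oy; rewrite uy.
  by [].
Qed.

(** The chain may follow q closely outside the middle third, where the projection does not contract.
    Clamping the projection to an interval inside the middle third removes this motion: the clamped
    projection still has to travel from one end of the interval to the other, and it moves only
    while the chain is far from q, hence slowly. *)
Lemma bottleneck_cross_sorted {R : realType} {X : metricType R}
  (geoX : geodesic_set [set: X]) (q : R -> X) (L0 C0 : R) (L01 : 1 <= L0) (C00 : 0 <= C0)
  (qgq : quasi_geodesic L0 C0 `]-oo, +oo[ q) :
  chain_bottleneck q -> forall sigma C : R, 0 < sigma -> 0 <= C ->
  exists2 D : R, 0 <= D & forall s t (c : seq X), s <= t -> path (step sigma) (q s) c ->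
  last (q s) c = q t -> clen (q s) c <= C * mdist (q s) (q t) + C ->
  exists2 z, z \in q s :: c & exists2 r, third (between q (q s) (q t)) r & mdist z (q r) <= D.
Proof.
move=> H sigma C s0 C1.
have CL : 0 < 40 * (C + 1) * L0 by rewrite !mulr_gt0; clear -L01 C1; lra.
(* This eps bounds the drift along the whole chain by (t - s + C0 + 1) / 10, roughly half the length
   (t - s) / 5 of the clamping interval. *)
have [eps e0 eCL] : exists2 eps : R, 0 < eps & eps * (40 * (C + 1) * L0) = 1.
  by exists (40 * (C + 1) * L0)^-1; [rewrite invr_gt0|rewrite mulVf// gt_eqF].
have [theta0 th1 Hth] := proj_contraction geoX L01 C00 qgq H e0.
have L00 : 0 <= L0 by exact: le_trans L01.
have [theta [th0 sth A0]] : exists theta : R, [/\ 0 < theta, sigma <= theta / 4 &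
    forall x y, theta <= rho q x -> mdist x y <= rho q x / 2 ->
      `|qproj q x - qproj q y| <= eps * rho q x].
  exists (theta0 + 4 * sigma); split; [by clear -th1 s0; lra|by clear -th1; lra|].
  by move=> x y h; apply: Hth; apply: le_trans h; rewrite lerDl mulr_ge0// ltW.
have [J JE] : exists J : R, J = L0 * (2 * theta + 2 * sigma + 2 + C0).
  by exists (L0 * (2 * theta + 2 * sigma + 2 + C0)).
have J0 : 0 <= J by rewrite JE mulr_ge0//; clear -th0 s0 C00; lra.
have LC : 0 <= L0 * C0 by rewrite mulr_ge0.
have LC1 : 0 <= L0 * (1 + C0) by rewrite mulr_ge0// addr_ge0.
(* Shorter intervals are settled by q s, which is then at bounded distance from the middle third.
   Beyond T0 the summands guarantee, in order, the final contradiction, [third_in], jumps of the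
   projection shorter than v - u, and projections of q s and q t on the two sides of [u, v]. *)
have [T0 T0E] : exists T0 : R,
    T0 = 10 * (C0 + 1) + 10 * (L0 * C0) + 5 * (J + 1) + 5 * (L0 * (1 + C0)).
  by exists (10 * (C0 + 1) + 10 * (L0 * C0) + 5 * (J + 1) + 5 * (L0 * (1 + C0))).
have T00 : 0 <= T0 by rewrite T0E; clear -LC LC1 J0 C00; lra.
have LT : 0 <= L0 * (T0 + L0 * C0) by rewrite mulr_ge0// addr_ge0.
exists (L0 * (T0 + L0 * C0) + C0 + theta + sigma + 2).
  by clear -LT C00 th0 s0; lra.
move=> s t c st pc lc cl.
have [tsT|Tts] := leP (t - s) T0.
  exists (q s); first exact: mem_head.
  have [r hr] := third_nonempty L01 qgq st.
  exists r => //; apply: (le_trans (qg_upper qgq _ _)).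
  have : L0 * `|s - r| <= L0 * (T0 + L0 * C0).
    rewrite ler_wpM2l//.
    have /andP[h1 h2] := third_bound L01 qgq st hr.
    by rewrite ler_norml; apply/andP; clear -h1 h2 tsT st; split; lra.
  by clear -th0 s0; lra.
apply: contrapT => far0.
have {}far z r : z \in q s :: c -> third (between q (q s) (q t)) r ->
    theta + sigma + 1 < mdist z (q r).
  move=> zc hr; rewrite ltNge; apply/negP => h; apply: far0.
  exists z => //; exists r => //; apply: (le_trans h); by clear -LT C00; lra.
have [u uE] : exists u : R, u = s + 2 / 5 * (t - s) by exists (s + 2 / 5 * (t - s)).
have [v vE] : exists v : R, v = t - 2 / 5 * (t - s) by exists (t - 2 / 5 * (t - s)).
have uv : u <= v by rewrite uE vE; clear -st; lra.
(* When a chain point is near q but not near the middle third, its projection is outside [u, v], and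
   so is that of the next point; the jump J is shorter than v - u, so phi does not change. *)
pose phi x := Num.max u (Num.min v (qproj q x)).
have big : 10 * (L0 * C0) <= t - s.
  by clear -Tts T0E C00 J0 LC1; lra.
have inner w : u <= w <= v -> third (between q (q s) (q t)) w.
  by rewrite uE vE => h; exact: (third_in L01 qgq st big h).
have out x : x \in q s :: c -> rho q x < theta + sigma -> ~ (u <= qproj q x <= v).
  move=> xc rx /inner /(far x _ xc) h; have := lt_le_trans h (qprojP q x).
  by rewrite ltrD2r ltNge (ltW rx).
have A x y : theta <= rho q x -> mdist x y <= rho q x / 2 ->
    `|phi x - phi y| <= eps * rho q x.
  move=> rx xy; apply: (le_trans (max_lip _ _ _)).
  by apply: (le_trans (min_lip _ _ _)); exact: A0.
have B x y : x \in q s :: c -> y \in q s :: c -> mdist x y <= sigma ->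
    rho q x < theta -> phi x = phi y.
  move=> xc yc xy rx.
  have ox : ~ (u <= qproj q x <= v) by apply: out => //; rewrite ltr_wpDr// ltW.
  have ry : rho q y < theta + sigma.
    by apply: (le_lt_trans (rho_lip q y x)); rewrite metric_sym addrC ltr_leD.
  have oy := out y yc ry.
  have : `|qproj q x - qproj q y| <= J.
    apply: (le_trans (qg_lower L01 qgq _ _)); rewrite JE ler_wpM2l// lerD2r.
    have h1 := metric_triangle (q (qproj q x)) x (q (qproj q y)).
    have h2 := metric_triangle x y (q (qproj q y)).
    rewrite (metric_sym (q (qproj q x)) x) in h1.
    have h3 := qprojP q x; have h4 := qprojP q y.
    by clear -h1 h2 h3 h4 rx ry xy; lra.
  have Jvu : J < v - u by rewrite uE vE; clear -Tts T0E LC LC1 C00; lra.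
  by move=> /le_lt_trans/(_ Jvu); exact: clamp_out.
have := drift (ltW e0) (rho_ge0 q) (rho_lip q) sth A (a := q s) (s := c).
rewrite lc rho_q mulr0 addr0 => dr.
have {}dr : `|phi (q s) - phi (q t)| <= eps * (4 * clen (q s) c).
  apply: dr; apply: (sub_in_path (P := [in q s :: c]) _ _ pc); last exact/allP.
  move=> x y xc yc xy; apply/andP; split => //.
  by apply/implyP => rx; apply/eqP; apply: B.
have qprojq w : `|qproj q (q w) - w| <= L0 * (1 + C0).
  apply: (le_trans (qg_lower L01 qgq _ _)); rewrite ler_wpM2l// lerD2r.
  by rewrite metric_sym (le_trans (qprojP q (q w)))// rho_q add0r.
have phis : phi (q s) = u.
  have := qprojq s; rewrite ler_norml => /andP[h1 h2].
  have psu : qproj q (q s) <= u by rewrite uE; clear -h2 Tts T0E LC LC1 C00 J0; lra.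
  by rewrite /phi min_r ?max_l// (le_trans psu).
have phit : phi (q t) = v.
  have := qprojq t; rewrite ler_norml => /andP[h1 h2].
  have psv : v <= qproj q (q t) by rewrite vE; clear -h1 Tts T0E LC LC1 C00 J0; lra.
  by rewrite /phi min_l ?max_r.
rewrite phis phit distrC ger0_norm ?subr_ge0// in dr.
have dub : mdist (q s) (q t) <= L0 * (t - s) + C0.
  by rewrite (le_trans (qg_upper qgq _ _))// distrC ger0_norm ?subr_ge0.
have LCC : C0 + 1 <= L0 * (C0 + 1) by rewrite ler_peMl// addr_ge0.
have cl2 : clen (q s) c <= (C + 1) * (L0 * (t - s + C0 + 1)).
  apply: (le_trans cl).
  have -> : C * mdist (q s) (q t) + C = C * (mdist (q s) (q t) + 1) by ring.
  apply: ler_pM => //; first by rewrite addr_ge0 ?mdist_ge0.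
    by rewrite lerDl.
  by clear -dub LCC; lra.
have cl3 : eps * (4 * clen (q s) c) <= eps * (4 * ((C + 1) * (L0 * (t - s + C0 + 1)))).
  by rewrite (ler_wpM2l (ltW e0))// ler_wpM2l.
have E : eps * (4 * ((C + 1) * (L0 * (t - s + C0 + 1)))) = (t - s + C0 + 1) / 10.
  transitivity (eps * (40 * (C + 1) * L0) * ((t - s + C0 + 1) / 10)); first by field.
  by rewrite eCL mul1r.
have := le_trans dr cl3; rewrite E uE vE.
by clear -Tts T0E LC LC1 C00 J0; lra.
Qed.

Section FromBottleneck.
Context {R : realType} {X : metricType R} (geoX : geodesic_set [set: X]).
Context (q : R -> X) (L0 C0 : R) (L01 : 1 <= L0) (C00 : 0 <= C0).
Context (qgq : quasi_geodesic L0 C0 `]-oo, +oo[ q).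
Implicit Types (s t r u d : R) (x y : X).

(** A path of length C l is cut into steps of length at most 2 k l, whose number depends on C / k
    only, hence so does D. The error 2 M k l + D stays below eps l, since M k is at most eps / 4 and
    l exceeds 2 D / eps. *)
Lemma bottleneck_cover : chain_bottleneck q -> paths_cover q.
Proof.
move=> [M M0 H] C eps C1 e0.
have M1 : 0 < 4 * (M + 1) by lra.
pose k := eps / (4 * (M + 1)).
have k0 : 0 < k by rewrite divr_gt0.
have Mk : 4 * (M * k) <= eps.
  have : k * (4 * (M + 1)) = eps by rewrite /k divfK// ?gt_eqF.
  lra.
have [N hN] := nat_ge (C / k + 1).
have [D D0 HD] := H N.
have De0 : 0 <= 2 * D / eps by rewrite divr_ge0; lra.
exists (2 * D / eps + 1); first lra.
move=> a b p _ _ + cp ea eb; rewrite -ea -eb => Dab lp _ [r [s [t [es et srt]]] <-].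
move: Dab lp; set l := mdist _ _ => Dl lp.
have l0 : 0 < l by lra.
have e'0 : 0 < k * l by rewrite mulr_gt0.
have [c [pc lc ic cl]] := path_chain cp lp e'0.
have [c' [pc' lc' sub cl']] := chain_coarsen e'0 (ltW e'0) pc.
have cN : (size c' <= N)%N.
  rewrite -(ler_nat R); apply: (le_trans _ hN); rewrite -(ler_pM2r e'0).
  apply: (le_trans cl'); rewrite mulrDl mul1r lerD2r (le_trans cl)//.
  by rewrite mulrA divfK ?gt_eqF.
have d0 : 0 <= k * l + k * l by lra.
rewrite lc -et in lc'; rewrite -es in pc' lc' sub.
have [z zc hz] := bottleneck_sym HD srt d0 cN pc' lc'.
exists z; first by apply: ic; rewrite -es; exact: sub.
apply: (le_lt_trans hz).
have : 4 * (M * k) * l <= eps * l by rewrite ler_wpM2r// ltW.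
have : 2 * D < eps * l.
  by rewrite [ltRHS]mulrC -ltr_pdivrMr//; lra.
have -> : M * (k * l + k * l) = 2 * (M * k * l) by ring.
lra.
Qed.

Lemma bottleneck_cross : chain_bottleneck q -> forall sigma C : R, 0 < sigma -> 0 <= C ->
  exists2 D : R, 0 <= D & forall a b (c : seq X), range q a -> range q b ->
  path (step sigma) a c -> last a c = b -> clen a c <= C * mdist a b + C ->
  exists2 z, z \in a :: c & tubular (middle_third q a b) D z.
Proof.
move=> H sigma C s0 C1; have [D D0 HD] := bottleneck_cross_sorted geoX L01 C00 qgq H s0 C1.
exists (D + 1); first lra.
move=> _ _ c [s _ <-] [t _ <-] pc lc cl.
have [st|/ltW ts] := leP s t.
  have [z zc [r hr hz]] := HD s t c st pc lc cl.
  by exists z => //; exists (q r); [exists r|lra].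
have [c' [pc' lc' sc' mc' cc']] := chain_rev pc; rewrite lc in pc' lc' mc' cc'.
have [|z zc [r hr hz]] := HD t s c' ts pc' lc'; first by rewrite cc' metric_sym.
exists z; first by rewrite -mc'.
by exists (q r); [exists r => //; rewrite between_sym|lra].
Qed.

Lemma bottleneck_paths_cross : chain_bottleneck q -> paths_cross_middle q.
Proof.
move=> H C C1; have [|D D0 HD] := bottleneck_cross H ltr01 (_ : 0 <= C); first lra.
exists D => // n p cp rs rt nd lp.
have [c [pc lc ic cl]] := path_chain cp lp ltr01.
have [|z zc hz] := HD _ _ c rs rt pc lc.
  apply: (le_trans cl); have : C * n <= C * mdist (im_source p) (im_target p).
    by rewrite ler_wpM2l//; lra.
  lra.
by exists z; split => //; exact: ic.
Qed.

(** A quasi-geodesic may be discontinuous, so it is sampled at unit parameter steps, each of which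
    moves by at most A + B. *)
Lemma qg_chain (f : R -> X) (A B x y : R) n : 0 <= A -> x <= y ->
  quasi_geodesic A B `[x, y] f -> y - x <= n%:R ->
  exists c, [/\ path (step (A + B)) (f x) c, last (f x) c = f y, (size c <= n)%N &
    {in f x :: c, forall z, exists2 u, x <= u <= y & z = f u}].
Proof.
move=> A0; elim: n x => [|n IH] x xy qf yxn.
  have -> : x = y by lra.
  exists [::]; split => // z; rewrite inE => /eqP ->; exists y => //.
  by rewrite lexx.
have [yx|yx] := leP y (x + 1).
  exists [:: f y]; split => //=.
    rewrite andbT /step.
    have [||_ h] := qf x y; rewrite ?in_itv/= ?lexx ?xy//.
    rewrite (le_trans h)// lerD2r -[leRHS]mulr1 ler_wpM2l//.
    by rewrite distrC ger0_norm ?subr_ge0//; lra.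
  move=> z; rewrite !inE => /orP[]/eqP->; first by exists x; rewrite ?lexx.
  by exists y; rewrite ?lexx ?xy.
have qf' : quasi_geodesic A B `[x + 1, y] f.
  move=> u v; rewrite !in_itv/= => /andP[? ?] /andP[? ?]; apply: qf; rewrite in_itv/=; apply/andP; split; lra.
have [||c [pc lc sc ic]] := IH (x + 1) _ qf'; [lra|rewrite -natr1 in yxn; lra|].
exists (f (x + 1) :: c); split => //=.
- rewrite pc andbT /step.
  have [||_ h] := qf x (x + 1); rewrite ?in_itv/= ?lexx ?xy//.
    by apply/andP; split; lra.
  by rewrite (le_trans h)// opprD addNKr normrN normr1 mulr1.
- move=> z; rewrite inE => /predU1P[->|/ic [u /andP[? ?] ->]].
    by exists x; rewrite ?lexx.
  by exists u => //; apply/andP; split; lra.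
Qed.

Lemma qg_sampling (f : R -> X) (A B x y : R) : 0 <= A -> 0 <= B -> x <= y ->
  quasi_geodesic A B `[x, y] f ->
  exists c, [/\ path (step (A + B)) (f x) c, last (f x) c = f y,
    clen (f x) c <= (A + B) * (y - x + 1) &
    {in f x :: c, forall z, exists2 u, x <= u <= y & z = f u}].
Proof.
move=> A0 B0 xy qf; have yx0 : 0 <= y - x by lra.
have /andP[t1 t2] := truncn_itv yx0.
have [c [pc lc sc ic]] := qg_chain A0 xy qf (ltW t2).
exists c; split => //; apply: (le_trans (clen_step pc)).
rewrite mulrC ler_wpM2l//; first lra.
have : (size c)%:R <= (Num.truncn (y - x)).+1%:R :> R by rewrite ler_nat.
rewrite -natr1; lra.
Qed.

(** The alternative z = b accounts for the empty list, whose image is empty while the chain contains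
    b. *)
Lemma quasi_path_sampling (lambda kappa : R) L (a b : X) (ps : seq (interval_map R X)) : 0 <= lambda -> 0 <= kappa ->
  quasi_geodesic_system lambda kappa L -> quasi_path L ps a b ->
  exists c, [/\ path (step (lambda + kappa)) a c, last a c = b,
    clen a c <= (lambda + kappa) * (quasi_length ps + (size ps)%:R) &
    {in a :: c, forall z, z = b \/ quasi_path_image ps z}].
Proof.
move=> l0 k0 [_ Lqg _]; elim: ps a => [|p ps IH] a /=.
  move=> ->; exists [::]; split => //.
    by rewrite /quasi_length big_nil addr0 mulr0.
  by move=> z; rewrite inE => /eqP ->; left.
move=> [m Lp /IH [c [pc lc cl ic]]].
have [qp sp tp] := Lqg _ _ _ Lp.
have [c1 [pc1 lc1 cl1 ic1]] := qg_sampling l0 k0 (im_le p) qp.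
rewrite -/(im_source p) -/(im_target p) sp tp in pc1 lc1 cl1 ic1.
exists (c1 ++ c); split.
- by rewrite cat_path pc1 lc1.
- by rewrite last_cat lc1.
- rewrite clen_cat lc1 /quasi_length big_cons -natr1 -/(quasi_length ps).
  have -> : (lambda + kappa) * (im_width p + quasi_length ps + ((size ps)%:R + 1)) =
    (lambda + kappa) * (im_width p + 1) + (lambda + kappa) * (quasi_length ps + (size ps)%:R).
    by ring.
  exact: lerD.
- move=> z; rewrite /quasi_path_image big_cons -cat_cons mem_cat => /orP[/ic1 [u hu ->]|zc].
    by right; left; exists u => //; rewrite /= in_itv.
  have [|->|h] := ic z; first by rewrite inE zc orbT.
    by left.
  by right; right.
Qed.

Lemma quasi_path_target (lambda kappa : R) L (a b : X) (ps : seq (interval_map R X)) : quasi_geodesic_system lambda kappa L ->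
  (0 < size ps)%N -> quasi_path L ps a b -> quasi_path_image ps b.
Proof.
move=> [_ Lqg _]; elim: ps a => //= p ps IH a _ [m Lp].
case: ps IH => [|p' ps] IH qps; rewrite /quasi_path_image big_cons.
  left; move: qps => /= <-; have [_ _ <-] := Lqg _ _ _ Lp.
  by exists (im_end p) => //=; rewrite in_itv/= lexx im_le.
by right; exact: IH qps.
Qed.

Lemma bottleneck_quasi_paths_cross (lambda kappa : R) L : 1 <= lambda -> 0 <= kappa ->
  quasi_geodesic_system lambda kappa L -> chain_bottleneck q ->
  quasi_paths_cross_middle L q.
Proof.
move=> l1 k0 sysL H C k C1 k1.
have s0 : 0 < lambda + kappa by lra.
have kR : 0 <= k%:R :> R by [].
(* Each piece may cost one sampling step beyond its width, whence the summand k. *)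
have CC : 0 <= (lambda + kappa) * (C + k%:R) by rewrite mulr_ge0; lra.
have [D D0 HD] := bottleneck_cross H s0 CC.
exists D => // a b ps ra rb sps qps lps.
have [|c [pc lc cl ic]] := quasi_path_sampling _ k0 sysL qps; first lra.
have [|z zc hz] := HD a b c ra rb pc lc.
  apply: (le_trans cl); rewrite sps.
  have -> : (lambda + kappa) * (C + k%:R) * mdist a b + (lambda + kappa) * (C + k%:R)
     = (lambda + kappa) * ((C * mdist a b + k%:R) + (C + k%:R * mdist a b)) by ring.
  rewrite ler_wpM2l//; first lra.
  have : 0 <= k%:R * mdist a b by rewrite mulr_ge0// mdist_ge0.
  lra.
exists z; split => //; have [->|//] := ic z zc.
by apply: quasi_path_target sysL _ qps; rewrite sps.
Qed.

End FromBottleneck.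

(** * The Morse property from the bottleneck property *)

(** The last moment before w and the first moment after w at which g is below theta bound a stretch
    where g is at least theta. These moments are known up to 1 only, so the stretch is shrunk by 1
    at both ends, where theta' bounds g; if w falls in the discarded margin, the first alternative
    holds. *)
Lemma high_stretch {R : realType} (g : R -> R) (theta theta' b w e : R) :
  g b < theta -> g e < theta -> b <= w <= e ->
  (forall x y, b <= x <= e -> b <= y <= e -> `|x - y| <= 1 -> g x < theta -> g y <= theta') ->
  g w <= theta' \/ exists x y, [/\ b <= x <= w, w <= y <= e, g x <= theta', g y <= theta' &
    forall u, x <= u <= y -> theta <= g u].
Proof.
move=> gb ge /andP[bw we] nb.
have [s1 [/andP[bs1 s1w] rs1 H1]] := @last_moment _ (fun u => g u < theta) _ _ gb bw.
have [t1 [/andP[wt1 t1e] rt1 H2]] := @first_moment _ (fun u => g u < theta) _ _ ge we.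
have is1 : b <= s1 <= e by rewrite bs1 (le_trans s1w).
have it1 : b <= t1 <= e by rewrite t1e (le_trans bw).
have iw : b <= w <= e by rewrite bw.
have [w1|w1] := leP (s1 + 1) w; last first.
  left; apply: (nb s1) => //.
  by rewrite distrC ger0_norm ?subr_ge0// lerBlDl ltW.
have [w2|w2] := leP w (t1 - 1); last first.
  left; apply: (nb t1) => //.
  by rewrite ger0_norm ?subr_ge0// lerBlDl -lerBlDr ltW.
have ix : b <= s1 + 1 <= e by apply/andP; split; lra.
have iy : b <= t1 - 1 <= e by apply/andP; split; lra.
right; exists (s1 + 1), (t1 - 1); split.
- by apply/andP; split => //; lra.
- by apply/andP; split => //; lra.
- by apply: (nb s1) => //; rewrite distrC ger0_norm; lra.
- by apply: (nb t1) => //; rewrite ger0_norm; lra.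
- move=> u /andP[xu uy]; rewrite leNgt; apply/negP.
  by have [uw|/ltW wu] := leP u w; [apply: H1|apply: H2]; apply/andP.
Qed.

(** The choice of eps turns the term proportional to T on the right into half of the lower bound T /
    A, so that T can be absorbed. *)
Lemma stretch_bound {R : realFieldType} (A B L eps sigma T K K' d : R) :
  0 < A -> eps * (8 * A * L * sigma) = 1 -> A^-1 * T - B <= d ->
  d <= K + L * (eps * (4 * sigma * T) + eps * K') ->
  T <= 2 * A * (B + K + L * (eps * K')).
Proof.
move=> A0 eAL d1; rewrite mulrDr.
have -> : L * (eps * (4 * sigma * T)) = A^-1 * T / 2.
  transitivity (eps * (8 * A * L * sigma) * (A^-1 * T / 2)).
    by field; rewrite gt_eqF.
  by rewrite eAL mul1r.
move=> d2; have : A^-1 * T <= 2 * (B + K + L * (eps * K')) by lra.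
by rewrite ler_pdivrMl// => h; lra.
Qed.

Section ToMorse.
Context {R : realType} {X : metricType R} (geoX : geodesic_set [set: X]).
Context (q : R -> X) (L0 C0 : R) (L01 : 1 <= L0) (C00 : 0 <= C0).
Context (qgq : quasi_geodesic L0 C0 `]-oo, +oo[ q).

(** During an excursion at distance at least theta from q, the projection drifts by at most eps
    times the length, up to a constant. Both ends of the excursion are close to q, so their distance
    is at most L0 times the drift, again up to a constant. For small eps the lower quasi-geodesic
    bound then limits the duration of the excursion. *)
Lemma bottleneck_morse : chain_bottleneck q -> morse q.
Proof.
have [L1 C00'] := (L01, C00).
move=> H A B A1 B0.
have A0 : 0 <= A by lra.
have A00 : 0 < A by lra.
have [sigma sE] : exists sigma : R, sigma = A + B by exists (A + B).
have s0 : 0 < sigma by rewrite sE; lra.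
have AL : 0 < 8 * A * L0 * sigma by rewrite !mulr_gt0//; lra.
have [eps e0 eAL] : exists2 eps : R, 0 < eps & eps * (8 * A * L0 * sigma) = 1.
  by exists (8 * A * L0 * sigma)^-1; [rewrite invr_gt0|rewrite mulVf// gt_eqF].
have [theta0 th1 Hth0] := proj_contraction geoX L01 C00 qgq H e0.
have [theta [th0 sth Hth]] : exists theta : R, [/\ 0 < theta, sigma <= theta / 4 &
    forall x y, theta <= rho q x -> mdist x y <= rho q x / 2 ->
      `|qproj q x - qproj q y| <= eps * rho q x].
  exists (theta0 + 4 * sigma); split; [lra|lra|].
  by move=> x y h; apply: Hth0; apply: le_trans h; rewrite lerDl mulr_ge0// ltW.
(* K collects the constants of [stretch_bound]: an excursion lasts at most 2 A K, so each of its
   points is within A (2 A K) + B of its start. *)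
pose K := B + (2 * (theta + sigma + 1) + C0) + L0 * (eps * (4 * sigma + 2 * (theta + sigma))).
exists (theta + sigma + A * (2 * A * K) + B + 2) => p qp [a _ qa] [b _ qb] _ [w /= + <-].
rewrite in_itv/= => bwe.
have K0 : 0 <= K.
  have : 0 <= L0 * (eps * (4 * sigma + 2 * (theta + sigma))).
    by apply: mulr_ge0; [lra|apply: mulr_ge0; lra].
  by rewrite /K; lra.
have AAK : 0 <= A * (2 * A * K) by rewrite !mulr_ge0.
suff : rho q (p w) <= theta + sigma + A * (2 * A * K) + B.
  move=> h; exists (q (qproj q (p w))); first by exists (qproj q (p w)).
  by have := qprojP q (p w); lra.
have pd (x y : R) : im_beg p <= x <= im_end p -> im_beg p <= y <= im_end p ->
    A^-1 * `|x - y| - B <= mdist (p x) (p y) /\ mdist (p x) (p y) <= A * `|x - y| + B.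
  by move=> hx hy; apply: qp; rewrite in_itv.
have nb (x y : R) : im_beg p <= x <= im_end p -> im_beg p <= y <= im_end p -> `|x - y| <= 1 ->
    rho q (p x) < theta -> rho q (p y) <= theta + sigma.
  move=> hx hy xy rx; have [_ h] := pd x y hx hy.
  apply: le_trans (rho_lip q (p y) (p x)) _; rewrite addrC.
  apply: lerD; first exact: ltW.
  rewrite metric_sym (le_trans h)// sE lerD2r.
  by rewrite ler_piMr.
have rb : rho q (p (im_beg p)) < theta.
  by rewrite -[p _]/(im_source p) -qa rho_q.
have re : rho q (p (im_end p)) < theta.
  by rewrite -[p _]/(im_target p) -qb rho_q.
have [rw|[x [y [/andP[bx xw] /andP[wy ye] rx ry far]]]] :=
  @high_stretch _ (rho q \o p) _ _ _ _ _ rb re bwe nb.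
  by rewrite (le_trans rw)// -addrA lerDl addr_ge0.
rewrite /comp in rx ry far.
have xy : x <= y by exact: le_trans wy.
have ix : im_beg p <= x <= im_end p by rewrite bx (le_trans xy).
have iy : im_beg p <= y <= im_end p by rewrite ye (le_trans bx).
have qxy : quasi_geodesic A B `[x, y] p.
  move=> u v; rewrite !in_itv/= => /andP[? ?] /andP[? ?].
  by apply: qp; rewrite in_itv/= (le_trans bx)//= (le_trans _ ye).
have [c [pc lc cl ic]] := qg_sampling A0 B0 xy qxy; rewrite -sE in pc cl.
have := drift (ltW e0) (rho_ge0 q) (rho_lip q) sth Hth (a := p x) (s := c).
rewrite lc => dr.
have {}dr : `|qproj q (p x) - qproj q (p y)| <= eps * (4 * clen (p x) c + 2 * rho q (p y)).
  apply: dr; apply: (sub_in_path (P := [in p x :: c]) _ _ pc); last exact/allP.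
  move=> z z' /ic [u hu ->] _ zz'; apply/andP; split => //.
  by have := far u hu; rewrite leNgt => /negbTE ->.
have {}dr : `|qproj q (p x) - qproj q (p y)| <=
    eps * (4 * sigma * (y - x)) + eps * (4 * sigma + 2 * (theta + sigma)).
  apply: (le_trans dr); rewrite -mulrDr (ler_wpM2l (ltW e0))//.
  by move: cl ry; clear; move: (clen _ _) (rho q _) => l r; lra.
have dub : mdist (p x) (p y) <= 2 * (theta + sigma + 1) + C0 + L0 *
    (eps * (4 * sigma * (y - x)) + eps * (4 * sigma + 2 * (theta + sigma))).
  have h1 := qprojP q (p x); have h2 := qprojP q (p y).
  have h3 := metric_triangle (p x) (q (qproj q (p x))) (p y).
  have h4 := metric_triangle (q (qproj q (p x))) (q (qproj q (p y))) (p y).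
  have h5 := qg_upper qgq (qproj q (p x)) (qproj q (p y)).
  have h6 := ler_wpM2l (ltW (lt_le_trans ltr01 L01)) dr.
  rewrite (metric_sym (q (qproj q (p y))) (p y)) in h4.
  have h7 : L0 * `|qproj q (p x) - qproj q (p y)| + C0 <= L0 *
    (eps * (4 * sigma * (y - x)) + eps * (4 * sigma + 2 * (theta + sigma))) + C0.
    by rewrite lerD2r.
  move: (le_trans h5 h7) h1 h2 h3 h4 rx ry.
  move: (L0 * _) (mdist _ _) (mdist _ _) (mdist _ _) (mdist _ _) (mdist _ _) (rho _ _) (rho _ _).
  by clear => *; lra.
have [dlb _] := pd x y ix iy.
rewrite distrC ger0_norm ?subr_ge0// in dlb.
have TK := stretch_bound A00 eAL dlb dub; rewrite -/K in TK.
have [_ h1] := pd w x bwe ix.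
rewrite ger0_norm ?subr_ge0// in h1.
apply: (le_trans (rho_lip q (p w) (p x))).
have h2 : A * (w - x) <= A * (2 * A * K).
  by rewrite ler_wpM2l// (le_trans _ TK)// lerD2r.
have -> : theta + sigma + A * (2 * A * K) + B = A * (2 * A * K) + B + (theta + sigma) by ring.
by rewrite lerD// (le_trans h1)// lerD2r.
Qed.

End ToMorse.

(** * Shadowing chains by quasi-geodesics *)

Lemma qg_lowerE {R : realFieldType} (A B x d : R) : 0 < A ->
  (A^-1 * x - B <= d) = (x <= A * (d + B)).
Proof. by move=> A0; rewrite lerBlDr ler_pdivrMl. Qed.

(* The broken line runs along p up to a nearly closest point p t0 to z and then along a geodesic to z. *)
Lemma broken_line_arith {R : realFieldType} (A B s t d D dz e : R) : 1 <= A -> 0 <= B ->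
  s <= A * (e + B) -> e <= A * s + B -> e <= D + t -> D <= e + t -> 0 <= s -> 0 <= t ->
  d <= dz + 1 -> dz <= D + (d - t) ->
  s + t <= (2 * A + 1) * (D + (B + 1)) /\ D <= (2 * A + 1) * (s + t) + (B + 1).
Proof.
move=> A1 B0 h1 h2 h3 h4 s0 t0 h5 h6.
have tD : t <= D + 1 by lra.
have D0 : 0 <= D + 1 by lra.
have h7 : A * (e + B) <= A * (2 * D + 1 + B) by rewrite ler_wpM2l//; lra.
have AB : 0 <= A * B by rewrite mulr_ge0//; lra.
have As : 0 <= A * s by rewrite mulr_ge0//; lra.
have At : 0 <= A * t by rewrite mulr_ge0//; lra.
by split; lra.
Qed.

Section MorseBottleneck.
Context {R : realType} {X : metricType R} (geoX : geodesic_set [set: X]).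
Context (q : R -> X) (L0 C0 : R) (L01 : 1 <= L0) (C00 : 0 <= C0).
Context (qgq : quasi_geodesic L0 C0 `]-oo, +oo[ q).
Implicit Types (s t r u d : R) (x y : X).

(** p may be discontinuous, so p t0 is nearest to z only up to 1. The target of p is a competitor
    for the nearest point, which bounds the length of the added geodesic by the distance from z to
    that target, plus 1. *)
Lemma qg_extend (A B : R) (p : interval_map R X) (z : X) : 1 <= A -> 0 <= B ->
  finite_quasi_geodesic A B p ->
  exists p' : interval_map R X, [/\ finite_quasi_geodesic (2 * A + 1) (B + 1) p',
    im_source p' = im_source p, im_target p' = z &
    forall x, im_image p' x -> im_image p x \/ mdist z x <= mdist z (im_target p) + 1].
Proof.
move=> A1 B0 qp; have pe := im_le p.
pose S := [set mdist z (p t) | t in `[im_beg p, im_end p]%classic].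
have Send : S (mdist z (p (im_end p))).
  by exists (im_end p) => //=; rewrite in_itv/= lexx pe.
have hS : has_inf S.
  by split; [exists (mdist z (p (im_end p)))|exists 0 => _ [t _ <-]; exact: mdist_ge0].
have [_ [t0 /= + <-] ht0] := inf_adherent ltr01 hS.
rewrite in_itv/= => /andP[bt0 t0e].
have near t : im_beg p <= t <= im_end p -> mdist z (p t0) <= mdist z (p t) + 1.
  move=> tb; apply: (le_trans (ltW ht0)); rewrite lerD2r.
  by apply: inf_lbound; [case: hS|exists t => //=; rewrite in_itv].
have [g [gg g0 gD _]] := @geoX (p t0) z I I.
have D0 := mdist_ge0 (p t0) z.
set D := mdist (p t0) z in gg gD D0.
pose f t := if t <= t0 then p t else g (t - t0).
have bT : im_beg p <= t0 + D by rewrite (le_trans bt0)// lerDl.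
have A0 : 0 < A by exact: lt_le_trans A1.
have A'0 : 0 < 2 * A + 1 by lra.
have E1 : f (im_beg p) = im_source p by rewrite /f bt0.
have E2 : f (t0 + D) = z.
  rewrite /f; case: ifPn => [h|_]; last by rewrite addrAC subrr add0r.
  have DD : D = 0 by apply/eqP; rewrite eq_le D0 andbT -(lerD2l t0) addr0.
  by rewrite DD addr0 -g0 -{1}DD gD.
exists (IntervalMap f bT); split => //=.
- have H u v : im_beg p <= u <= t0 + D -> im_beg p <= v <= t0 + D -> u <= v ->
     `|u - v| <= (2 * A + 1) * (mdist (f u) (f v) + (B + 1)) /\
     mdist (f u) (f v) <= (2 * A + 1) * `|u - v| + (B + 1).
    move=> /andP[bu uD] /andP[bv vD] uv.
    have uv0 : 0 <= v - u by rewrite subr_ge0.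
    rewrite distrC (ger0_norm uv0).
    have Auv : 0 <= A * (v - u) by rewrite mulr_ge0// ltW.
    rewrite /f; have [ut0|t0u] := leP u t0; have [vt0|t0v] := leP v t0.
    + have iu : u \in `[im_beg p, im_end p] by rewrite in_itv/= bu (le_trans ut0).
      have iv : v \in `[im_beg p, im_end p] by rewrite in_itv/= bv (le_trans vt0).
      have [h1 h2] := qp u v iu iv.
      rewrite distrC (ger0_norm uv0) (qg_lowerE _ _ _ A0) in h1.
      rewrite distrC (ger0_norm uv0) in h2.
      have Ad : 0 <= A * mdist (p u) (p v) by rewrite mulr_ge0 ?mdist_ge0// ltW.
      have AB : 0 <= A * B by rewrite mulr_ge0// ltW.
      have dist0 := mdist_ge0 (p u) (p v).
      by split; lra.
    + have hu : im_beg p <= u <= im_end p by rewrite bu (le_trans ut0).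
      have iu : u \in `[im_beg p, im_end p] by rewrite in_itv.
      have it : t0 \in `[im_beg p, im_end p] by rewrite in_itv/= bt0.
      have [h1 h2] := qp u t0 iu it.
      rewrite distrC (ger0_norm (_ : 0 <= t0 - u)) ?subr_ge0// in h2.
      rewrite distrC (ger0_norm (_ : 0 <= t0 - u)) ?subr_ge0// (qg_lowerE _ _ _ A0) in h1.
      have tv : 0 <= v - t0 by rewrite subr_ge0 ltW.
      have tv' : v - t0 <= D by rewrite lerBlDl.
      have gv : mdist (p t0) (g (v - t0)) = v - t0.
        by rewrite -g0 (geoE gg) ?lexx ?D0 ?tv// sub0r normrN ger0_norm.
      have gz : mdist (g (v - t0)) z = D - (v - t0).
        by rewrite -gD (geoE gg) ?lexx ?D0 ?tv// distrC ger0_norm// subr_ge0.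
      have -> : v - u = (t0 - u) + (v - t0) by ring.
      apply: (@broken_line_arith _ A B (t0 - u) (v - t0) D _ (mdist z (p u)) (mdist (p u) (p t0))) => //.
      * by have := metric_triangle (p u) (g (v - t0)) (p t0); rewrite (metric_sym (g _)) gv.
      * by have := metric_triangle (p u) (p t0) (g (v - t0)); rewrite gv.
      * by rewrite subr_ge0.
      * by rewrite /D metric_sym near.
      * by have := metric_triangle (p u) (g (v - t0)) z; rewrite gz (metric_sym (p u) z).
    + by have := lt_le_trans t0u (le_trans uv vt0); rewrite ltxx.
    + have -> : mdist (g (u - t0)) (g (v - t0)) = v - u.
        rewrite (geoE gg) ?lerBlDl ?uD ?vD ?subr_ge0 ?(ltW t0u) ?(ltW t0v)//.
        have -> : u - t0 - (v - t0) = - (v - u) by ring.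
        by rewrite normrN ger0_norm.
      have AB : 0 <= A * B by rewrite mulr_ge0// ltW.
      by split; lra.
  move=> u v; rewrite !in_itv/= => hu hv; rewrite (qg_lowerE _ _ _ A'0).
  have [uv|/ltW vu] := leP u v; first exact: H.
  by rewrite metric_sym distrC; exact: H.
- move=> x [t /=]; rewrite in_itv/= => /andP[bt tD] <-.
  rewrite /f; case: ifPn => tt0.
    by left; exists t => //=; rewrite in_itv/= bt (le_trans tt0).
  right; rewrite metric_sym -[X in mdist _ X]gD (geoE gg) ?lexx ?D0 ?lerBlDl ?tD ?subr_ge0 ?andbT//.
    rewrite distrC ger0_norm; last by rewrite subr_ge0 lerBlDl.
    apply: (@le_trans _ _ D); first by rewrite gerBl subr_ge0 ltW// ltNge.
    by rewrite /D metric_sym near// pe lexx.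
  by rewrite ltW// ltNge.
Qed.

(** Each further point replaces A by 2 A + 1 and B by B + 1, independently of d. An extension may
    cut off the end of the previous curve, so the curve need not visit the chain points; it only
    stays close to them. *)
Lemma chain_quasi_geodesic N : exists A B : R, [/\ 1 <= A, 0 <= B &
  forall d a (c : seq X), 0 <= d -> (size c <= N)%N -> path (step d) a c ->
  exists p : interval_map R X, [/\ finite_quasi_geodesic A B p, im_source p = a,
    im_target p = last a c &
    forall x, im_image p x -> exists2 z, z \in a :: c & mdist z x <= d + 1]].
Proof.
have cst A B (a : X) : 1 <= A -> 0 <= B ->
    finite_quasi_geodesic A B (IntervalMap (fun=> a) (lexx (0 : R))).
  move=> A1 B0 u v /=; rewrite !in_itv/= => /le_anti <- /le_anti <-.
  by rewrite subrr normr0 !mulr0 mdistxx; split; lra.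
have cst2 d (a : X) x : 0 <= d -> im_image (IntervalMap (fun=> a) (lexx (0 : R))) x ->
    mdist a x <= d + 1.
  by move=> d0 [? _ <-]; rewrite mdistxx; lra.
elim: N => [|N [A [B [A1 B0 IH]]]].
  exists 1, 0; split => // d a [|//] d0 _ _.
  exists (IntervalMap (fun=> a) (lexx 0)); split => //; first exact: cst.
  by move=> x /(cst2 d _ _ d0) h; exists a; rewrite ?mem_head.
exists (2 * A + 1), (B + 1); split; [lra|lra|].
move=> d a c d0; case: (lastP c) => [_ _|{}c z].
  exists (IntervalMap (fun=> a) (lexx 0)); split => //; first by apply: cst; lra.
  by move=> x /(cst2 d _ _ d0) h; exists a; rewrite ?mem_head.
rewrite size_rcons ltnS rcons_path last_rcons => cN /andP[pc cz].
have [p [qp sp tp ip]] := IH d a c d0 cN pc.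
have [p' [qp' sp' tp' ip']] := qg_extend z A1 B0 qp.
exists p'; split => //; first by rewrite sp'.
move=> x /ip' [/ip [w wc hw]|hx].
  by exists w => //; rewrite -rcons_cons mem_rcons inE wc orbT.
exists z; first by rewrite -rcons_cons mem_rcons mem_head.
by rewrite (le_trans hx)// lerD2r metric_sym tp.
Qed.

(** Every point of the shadowing quasi-geodesic is matched with a point of q. Take a nearly last
    parameter matched to the left of r, and one at most 1 later matched to the right of r: the two
    matched parameters are boundedly close and enclose r, so q r is close to the curve, and hence to
    the chain up to d. *)
Lemma morse_bottleneck : morse q -> chain_bottleneck q.
Proof.
move=> mq; exists 1 => // N.
have [A [B [A1 B0 H]]] := chain_quasi_geodesic N.
have [M HM] := mq A B A1 B0.
have L1 := L01; have C00' := C00.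
have M0 := normr_ge0 M.
have LL : 0 <= L0 * (L0 * (2 * `|M| + A + B + C0)).
  by rewrite mulr_ge0//; [lra|rewrite mulr_ge0; lra].
exists (1 + `|M| + L0 * (L0 * (2 * `|M| + A + B + C0)) + C0); first lra.
move=> s r t d c /andP[sr rt] d0 cN pc lc.
have [p [qp sp tp ip]] := H d (q s) c d0 cN pc.
have rs : range q (im_source p) by rewrite sp; exists s.
have rt' : range q (im_target p) by rewrite tp lc; exists t.
have HMp u : im_beg p <= u <= im_end p -> exists v, mdist (p u) (q v) <= `|M|.
  move=> hu; have [|_ [v _ <-] hv] := HM p qp rs rt' (p u).
    by exists u => //=; rewrite in_itv.
  by exists v; rewrite (le_trans (ltW hv))// ler_norm.
pose U u := exists2 v, v <= r & mdist (p u) (q v) <= `|M|.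
have Ub : U (im_beg p).
  by exists s => //; rewrite -[p _]/(im_source p) sp mdistxx.
have [u1 [/andP[bu1 u1e] [v1 v1r hv1] Hu1]] := last_moment Ub (im_le p).
have iu1 : im_beg p <= u1 <= im_end p by rewrite bu1.
have [u2 [iu2 u12 [v2 rv2 hv2]]] : exists u2, [/\ im_beg p <= u2 <= im_end p,
    `|u1 - u2| <= 1 & exists2 v2, r <= v2 & mdist (p u2) (q v2) <= `|M|].
  have [h|h] := leP (u1 + 1) (im_end p).
    have i2 : im_beg p <= u1 + 1 <= im_end p by rewrite h andbT; lra.
    exists (u1 + 1); split => //.
      by rewrite opprD addNKr normrN normr1.
    have [v hv] := HMp _ i2; exists v => //.
    rewrite leNgt; apply/negP => vr; apply: (Hu1 (u1 + 1)); first by rewrite lexx h.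
    by exists v => //; exact: ltW.
  exists (im_end p); split; first by rewrite im_le lexx.
    by rewrite distrC ger0_norm; lra.
  by exists t => //; rewrite -[p _]/(im_target p) tp lc mdistxx.
have pu : mdist (p u1) (p u2) <= A + B.
  have i1 : u1 \in `[im_beg p, im_end p] by rewrite in_itv.
  have i2 : u2 \in `[im_beg p, im_end p] by rewrite in_itv.
  have [_ h] := qp u1 u2 i1 i2.
  by rewrite (le_trans h)// lerD2r ler_piMr//; lra.
have v12 : `|v1 - v2| <= L0 * (2 * `|M| + A + B + C0).
  apply: (le_trans (qg_lower L01 qgq _ _)); rewrite ler_wpM2l//; first lra.
  have := metric_triangle (q v1) (p u1) (q v2).
  have := metric_triangle (p u1) (p u2) (q v2).
  by rewrite (metric_sym (q v1) (p u1)); lra.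
have rv1 : mdist (q r) (q v1) <= L0 * (L0 * (2 * `|M| + A + B + C0)) + C0.
  apply: (le_trans (qg_upper qgq _ _)); rewrite lerD2r ler_wpM2l//; first lra.
  apply: le_trans v12; rewrite ger0_norm ?subr_ge0//.
  by rewrite distrC ger0_norm ?subr_ge0 ?(le_trans v1r)// lerD2r.
have [|z zc hz] := ip (p u1); first by exists u1 => //=; rewrite in_itv.
exists z => //; rewrite mul1r.
have h1 := metric_triangle (q r) (q v1) z; have h2 := metric_triangle (q v1) (p u1) z.
rewrite (metric_sym (q v1) (p u1)) (metric_sym (p u1) z) in h2; lra.
Qed.

End MorseBottleneck.

(** * Tree-graded spaces *)

Section MetricTopology.
Context {R : realType} {F : metricType R}.
Implicit Types (x y z : F) (G S : set F) (f g h : R -> F) (d t s : R).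
Import metricType_numDomainType.

Lemma open_mdist G : (forall x, G x -> exists2 e : R, 0 < e & forall y, mdist x y < e -> G y) ->
  open G.
Proof.
move=> H; rewrite openE => x /H [e e0 He]; by apply/nbhs_mdistP; exists e.
Qed.

Lemma closed_mdist G : (forall x, ~ G x -> exists2 e : R, 0 < e & forall y, mdist x y < e -> ~ G y) ->
  closed G.
Proof. by move=> H; rewrite -openC; apply: open_mdist. Qed.

Lemma closed_far G x : closed G -> ~ G x ->
  exists2 e : R, 0 < e & forall y, mdist x y < e -> ~ G y.
Proof.
rewrite -openC openE => cG nGx; have := cG x nGx => /nbhs_mdistP[e e0 He].
by exists e => // y xy; exact: (He y).
Qed.

Lemma lip1_connected f u v : lip1 f u v -> connected (f @` `[u, v]).
Proof.
move=> lf; have cf := lip1_cont lf.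
exact: connected_continuous_connected (@segment_connected R u v) cf.
Qed.

Lemma lip1_closed f u v : lip1 f u v -> closed (f @` `[u, v]).
Proof.
move=> lf; apply: compact_closed; first exact: metric_hausdorff.
by apply: continuous_compact; [exact: lip1_cont|exact: segment_compact].
Qed.

Lemma first_hit f d G : closed G -> 0 <= d -> lip1 f 0 d -> G (f d) ->
  exists t0, [/\ 0 <= t0 <= d, G (f t0) & forall t, 0 <= t < t0 -> ~ G (f t)].
Proof.
move=> cG d0 lf Gd; pose T := [set t | 0 <= t <= d /\ G (f t)].
have hT : has_inf T.
  by split; [exists d; rewrite /T/= lexx d0|exists 0 => t [/andP[]]].
have i0 : 0 <= inf T by apply: lb_le_inf; [case: hT|move=> t [/andP[]]].
have iD : inf T <= d by apply: inf_lbound; [case: hT|rewrite /T/= lexx d0].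
exists (inf T); split.
- by rewrite i0.
- apply: contrapT => /(closed_far cG) [e e0 He].
  have [t [/andP[t0 td] Gt] te] := inf_adherent e0 hT.
  have it : inf T <= t by apply: inf_lbound; [case: hT|split; rewrite ?t0].
  apply: (He (f t)) => //; apply: (le_lt_trans (lf _ _ _ _)); rewrite ?i0 ?t0//.
  by rewrite distrC ger0_norm ?subr_ge0// ltrBlDl.
- move=> t /andP[t0 ti] Gt; have : inf T <= t.
    apply: inf_lbound; [by case: hT|split => //].
    by rewrite t0 (le_trans (ltW ti)).
  by rewrite leNgt ti.
Qed.

Lemma geodesic_on_iso f (phi : R -> R) u v u' v' : geodesic_on u v f ->
  (forall t, u' <= t <= v' -> u <= phi t <= v) ->
  (forall s t, `|phi s - phi t| = `|s - t|) -> geodesic_on u' v' (f \o phi).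
Proof.
move=> gf H1 H2 s t; rewrite !in_itv/= => hs ht.
by rewrite (geoE gf) ?H1.
Qed.

Lemma geodesic_rev f d : geodesic_on 0 d f -> geodesic_on 0 d (fun t => f (d - t)).
Proof.
move=> gf; apply: (geodesic_on_iso (phi := fun t => d - t) gf).
  by move=> t /andP[? ?]; apply/andP; split; lra.
by move=> s t; rewrite distrC; congr `|_|; ring.
Qed.

Lemma geodesic_drop f a d : geodesic_on 0 d f -> 0 <= a ->
  geodesic_on 0 (d - a) (fun t => f (a + t)).
Proof.
move=> gf a0; apply: (geodesic_on_iso (phi := fun t => a + t) gf).
  by move=> t /andP[? ?]; apply/andP; split; lra.
by move=> s t; congr `|_|; ring.
Qed.

Lemma geodesic_take f a d : geodesic_on 0 d f -> a <= d -> geodesic_on 0 a f.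
Proof.
move=> gf ad s t; rewrite !in_itv/= => /andP[? ?] /andP[? ?].
by rewrite (geoE gf)//; apply/andP; split; lra.
Qed.

Lemma geodesic_inj f d s t : geodesic_on 0 d f -> 0 <= s <= d -> 0 <= t <= d ->
  f s = f t -> s = t.
Proof.
move=> gf hs ht E; have := geoE gf hs ht; rewrite E mdistxx => /esym/normr0_eq0/eqP.
by rewrite subr_eq0 => /eqP.
Qed.

Lemma last_hit f d G : closed G -> 0 <= d -> geodesic_on 0 d f -> G (f 0) ->
  exists t0, [/\ 0 <= t0 <= d, G (f t0) & forall t, t0 < t <= d -> ~ G (f t)].
Proof.
move=> cG d0 gf G0.
have [|t0 [/andP[t00 t0d] Gt0 H]] := first_hit cG d0 (geodesic_lip1 (geodesic_rev gf)).
  by rewrite subrr.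
exists (d - t0); split => //; first by apply/andP; split; lra.
move=> t /andP[tt td]; have -> : f t = f (d - (d - t)) by congr f; ring.
by apply: H; apply/andP; split; lra.
Qed.

Lemma lip1_geodesic f d : 0 <= d -> lip1 f 0 d -> mdist (f 0) (f d) = d ->
  geodesic_on 0 d f.
Proof.
move=> d0 lf E.
have H s t : 0 <= s -> s <= t -> t <= d -> mdist (f s) (f t) = `|s - t|.
  move=> s0 st td; apply/eqP; rewrite eq_le lf ?s0 ?td ?(le_trans s0) ?(le_trans st)//=.
  have h1 := lf 0 s; rewrite lexx d0 s0 (le_trans st td) in h1.
  have h2 := lf t d; rewrite lexx d0 td (le_trans s0 st) in h2.
  have {}h1 := h1 isT isT; have {}h2 := h2 isT isT.
  rewrite sub0r normrN ger0_norm// in h1; rewrite distrC ger0_norm ?subr_ge0// in h2.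
  rewrite distrC ger0_norm ?subr_ge0//.
  have := metric_triangle (f 0) (f s) (f d); have := metric_triangle (f s) (f t) (f d).
  by rewrite E; lra.
move=> s t; rewrite !in_itv/= => /andP[s0 sd] /andP[t0 td].
have [st|/ltW ts] := leP s t; first exact: H.
by rewrite metric_sym distrC H.
Qed.

Lemma geodesic_cat f g a b : 0 <= a -> 0 <= b -> geodesic_on 0 a f -> geodesic_on 0 b g ->
  f a = g 0 -> mdist (f 0) (g b) = a + b ->
  geodesic_on 0 (a + b) (fun t => if t <= a then f t else g (t - a)).
Proof.
move=> a0 b0 gf gg fg E; apply: lip1_geodesic; first exact: addr_ge0.
  by apply: lip1_cat => //; exact: geodesic_lip1.
rewrite a0; case: ifPn => [h|_]; last by rewrite addrAC subrr add0r.
have b00 : b = 0 by apply/eqP; rewrite eq_le b0 andbT -(lerD2l a) addr0.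
by have -> : f (a + b) = g b by rewrite b00 addr0 fg.
Qed.

(** The last three hypotheses make the sides meet only at common vertices, so that the concatenation
    is injective on the half-open interval. *)
Lemma simple_triangle f1 f2 f3 l1 l2 l3 : 0 < l1 -> 0 < l2 -> 0 < l3 ->
  geodesic_on 0 l1 f1 -> geodesic_on 0 l2 f2 -> geodesic_on 0 l3 f3 ->
  f1 l1 = f2 0 -> f2 l2 = f3 0 -> f3 l3 = f1 0 ->
  (forall s t, 0 <= s <= l1 -> 0 <= t <= l2 -> f1 s = f2 t -> t = 0) ->
  (forall s t, 0 <= s <= l2 -> 0 <= t <= l3 -> f2 s = f3 t -> t = 0) ->
  (forall s t, 0 <= s <= l3 -> 0 <= t <= l1 -> f3 s = f1 t -> s = l3) ->
  exists D, [/\ simple_geodesic_triangle D, forall t, 0 <= t <= l1 -> D (f1 t),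
    forall t, 0 <= t <= l2 -> D (f2 t) & forall t, 0 <= t <= l3 -> D (f3 t)].
Proof.
move=> l10 l20 l30 g1 g2 g3 e12 e23 e31 H12 H23 H31.
pose c t := if t <= l1 then f1 t else if t <= l1 + l2 then f2 (t - l1) else f3 (t - l1 - l2).
pose l := l1 + l2 + l3.
have c1 t : t <= l1 -> c t = f1 t by rewrite /c => ->.
have c2 t : l1 <= t <= l1 + l2 -> c t = f2 (t - l1).
  rewrite /c => /andP[h ->]; case: ifPn => // h'.
  have -> : t = l1 by apply/eqP; rewrite eq_le h h'.
  by rewrite subrr.
have c3 t : l1 + l2 <= t -> c t = f3 (t - l1 - l2).
  rewrite /c => h; case: ifPn => [h'|_]; first by exfalso; lra.
  case: ifPn => // h'.
  have -> : t = l1 + l2 by apply/eqP; rewrite eq_le h h'.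
  have -> : l1 + l2 - l1 = l2 by ring.
  by rewrite subrr.
exists (c @` `[0, l]); split.
- exists l, l1, (l1 + l2), c; split => //.
  + by rewrite /l; split; lra.
  + split.
    * move=> s t; rewrite !in_itv/= => /andP[s0 s1] /andP[t0 t1].
      by rewrite !c1// (geoE g1) ?s0 ?t0.
    * move=> s t; rewrite !in_itv/= => hs ht; rewrite !c2// (geoE g2).
      -- by have -> : s - l1 - (t - l1) = s - t by ring.
      -- by move: hs => /andP[? ?]; apply/andP; split; lra.
      -- by move: ht => /andP[? ?]; apply/andP; split; lra.
    * move=> s t; rewrite !in_itv/= /l => /andP[? ?] /andP[? ?]; rewrite !c3// (geoE g3).
      -- by have -> : s - l1 - l2 - (t - l1 - l2) = s - t by ring.
      -- by apply/andP; split; lra.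
      -- by apply/andP; split; lra.
  + split.
    rewrite (c1 0 (ltW l10)) (c3 l); last by rewrite /l; lra.
    have -> : l - l1 - l2 = l3 by rewrite /l; ring.
    by rewrite e31.
    have H s t : 0 <= s -> s <= t -> t < l -> c s = c t -> s = t.
      move=> s0 st tl; have [s1|s1] := leP s l1.
        have [t1|t1] := leP t l1.
          by rewrite !c1// => /(geodesic_inj g1); apply; apply/andP; split; lra.
        have [t2|t2] := leP t (l1 + l2).
          rewrite c1// c2 ?(ltW t1)// => /H12 h; exfalso.
          have : t - l1 = 0 by apply: h; apply/andP; split; lra.
          lra.
        rewrite c1// c3 ?(ltW t2)// => /esym /H31 h; exfalso.
        have : t - l1 - l2 = l3.
          by apply: h; apply/andP; split; move: tl; rewrite /l; lra.
        by move: tl; rewrite /l; lra.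
      have t1 := lt_le_trans s1 st.
      have [s2|s2] := leP s (l1 + l2).
        have [t2|t2] := leP t (l1 + l2).
          rewrite !c2 ?(ltW s1) ?(ltW t1)// => /(geodesic_inj g2) h.
          have : s - l1 = t - l1 by apply: h; apply/andP; split; lra.
          by move/addIr.
        rewrite c2 ?(ltW s1)// c3 ?(ltW t2)// => /H23 h; exfalso.
        have : t - l1 - l2 = 0.
          by apply: h; apply/andP; split; move: tl; rewrite /l; lra.
        by lra.
      have t2 := lt_le_trans s2 st.
      rewrite !c3 ?(ltW s2) ?(ltW t2)// => /(geodesic_inj g3) h.
      have : s - l1 - l2 = t - l1 - l2.
        by apply: h; apply/andP; split; move: tl; rewrite /l; lra.
      by move/addIr/addIr.
    move=> s t; rewrite !in_itv/= => /andP[s0 sl] /andP[t0 tl] E.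
    have [st|/ltW ts] := leP s t; first exact: H.
    by apply/esym; exact: H.
- move=> t /andP[t0 t1]; exists t; last by rewrite c1.
  by rewrite /= in_itv/= /l; apply/andP; split; lra.
- move=> t /andP[t0 t1]; exists (l1 + t).
    by rewrite /= in_itv/= /l; apply/andP; split; lra.
  rewrite c2; last by apply/andP; split; lra.
  by rewrite addrC addKr.
- move=> t /andP[t0 t1]; exists (l1 + l2 + t).
    by rewrite /= in_itv/= /l; apply/andP; split; lra.
  rewrite c3; last by lra.
  by have -> : l1 + l2 + t - l1 - l2 = t by ring.
Qed.

End MetricTopology.

(** * Projections onto saturated sets, and geodesics in transversal trees *)

Section Entry.
Context {R : realType} {F : metricType R} (geoF : geodesic_set [set: F]).
Implicit Types (x y z u v : F) (G S : set F) (f g h k : R -> F) (d t s : R).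

(* Satisfied by the pieces of a tree-graded space, and by the geodesics which meet every piece in at most one point. *)
Definition triangle_saturated G := [/\ closed G, geodesic_set G &
  forall D, simple_geodesic_triangle D -> forall u v, D u -> D v -> G u -> G v ->
    u <> v -> D `<=` G].

(** This is the projection onto a piece of a tree-graded space. It is a relation because the point
    depends a priori on the geodesic chosen; its uniqueness is a theorem about saturated sets. *)
Definition entry G z u := G u /\ exists f, [/\ geodesic_on 0 (mdist z u) f, f 0 = z,
  f (mdist z u) = u & forall t, 0 <= t < mdist z u -> ~ G (f t)].

Lemma entry_refl G z : G z -> entry G z z.
Proof.
move=> Gz; split => //; exists (fun=> z); split => //.
  by rewrite mdistxx => s t; rewrite !in_itv/= => /le_anti <- /le_anti <-; rewrite mdistxx subrr normr0.
by rewrite mdistxx => t /andP[t0 /(le_lt_trans t0)]; rewrite ltxx.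
Qed.

Lemma entry_sub G f d s : geodesic_on 0 d f -> 0 <= s <= d -> G (f d) ->
  (forall t, 0 <= t < d -> ~ G (f t)) -> entry G (f s) (f d).
Proof.
move=> gf /andP[s0 sd] Gd av; split => //.
have E : mdist (f s) (f d) = d - s.
  by rewrite (geoE gf) ?s0 ?sd ?lexx ?(le_trans s0)// distrC ger0_norm ?subr_ge0.
exists (fun t => f (s + t)); rewrite E; split.
- exact: geodesic_drop.
- by rewrite addr0.
- by congr f; ring.
- by move=> t /andP[t0 td]; apply: av; apply/andP; split; lra.
Qed.

Lemma entry_geodesic G f d : closed G -> 0 <= d -> geodesic_on 0 d f -> G (f d) ->
  exists2 t0, 0 <= t0 <= d & entry G (f 0) (f t0).
Proof.
move=> cG d0 gf Gd; have [t0 [/andP[h0 h1] Gt av]] := first_hit cG d0 (geodesic_lip1 gf) Gd.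
exists t0; first by rewrite h0.
by apply: (entry_sub (geodesic_take gf h1)); rewrite ?lexx.
Qed.

Section Saturated.
Context (G : set F) (satG : triangle_saturated G).

(** Two geodesics from z that enter G at different points part at a last common parameter m. With a
    geodesic of G between the two entries they form a simple triangle with two vertices in G; so it
    lies in G, and G is met at the branching point, too early. *)
Lemma entry_unique z u v : entry G z u -> entry G z v -> u = v.
Proof.
have [cG gG HG] := satG.
move=> [Gu [f [gf f0 fu fG]]] [Gv [g [gg g0 gv gG']]].
apply: contrapT => uv.
set du := mdist z u in gf fu fG *; set dv := mdist z v in gg gv gG' *.
have du0 : 0 <= du by exact: mdist_ge0.
have dv0 : 0 <= dv by exact: mdist_ge0.
pose T := [set t | 0 <= t <= Order.min du dv /\ f t = g t].
have T0 : T 0 by rewrite /T/= lexx le_min du0 dv0 f0 g0.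
have hT : has_sup T by split; [exists 0|exists (Order.min du dv) => t [/andP[]]].
pose m := sup T.
have m0 : 0 <= m by apply: ub_le_sup => //; case: hT.
have : m <= Order.min du dv by apply: ge_sup; [exists 0|move=> t [/andP[]]].
rewrite le_min => /andP[mu mv].
have fgm : f m = g m.
  apply: mdist_positivity; apply/eqP; rewrite eq_le mdist_ge0 andbT.
  apply/ler_addgt0Pl => e e0; rewrite addr0.
  have e20 : 0 < e / 2 by rewrite divr_gt0.
  have [t [/andP[t0]]] := sup_adherent e20 hT; rewrite le_min => /andP[tu tv] E te.
  have tm : t <= m by apply: ub_le_sup; [case: hT|split; rewrite ?t0 ?le_min ?tu].
  apply: (le_trans (metric_triangle _ (f t) _)); rewrite {2}E.
  rewrite (geoE gf) ?(geoE gg) ?m0 ?t0//.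
  rewrite ger0_norm ?subr_ge0// distrC ger0_norm ?subr_ge0// -/m in te *.
  by move: te; rewrite -/m; lra.
have mu' : m < du.
  rewrite lt_neqAle mu andbT; apply/eqP => E.
  have Gm : G (g m) by rewrite -fgm E fu.
  have dvm : dv <= m by rewrite leNgt; apply/negP => h; apply: (gG' m) => //; rewrite m0.
  by apply: uv; rewrite -fu -gv -E fgm; congr g; apply/eqP; rewrite eq_le mv dvm.
have mv' : m < dv.
  rewrite lt_neqAle mv andbT; apply/eqP => E.
  by apply: (fG m); [rewrite m0|rewrite fgm E gv].
have [h [gh h0 hd hG]] := gG u v Gu Gv.
have uv0 : 0 < mdist u v by rewrite mdist_gt0; apply/eqP.
have lu : 0 < du - m by rewrite subr_gt0.
have lv : 0 < dv - m by rewrite subr_gt0.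
have hGt t : 0 <= t <= mdist u v -> G (h t) by move=> ht; apply: hG; exists t => //=; rewrite in_itv.
have [|||||||D [sD D1 D2 _]] := simple_triangle lu uv0 lv (geodesic_drop gf m0) gh
    (geodesic_take (geodesic_rev gg) (_ : dv - m <= dv)).
- by rewrite gerBl.
- by rewrite h0 -fu; congr f; ring.
- by rewrite subr0 gv.
- by rewrite addr0 fgm; congr g; ring.
- move=> s t /andP[s0 s1] ht E; apply: (geodesic_inj gh ht); first by rewrite lexx ltW.
  rewrite -E h0 -fu; congr f; apply/eqP; rewrite eq_le; apply/andP; split; first lra.
  rewrite leNgt; apply/negP => h'; apply: (fG (m + s)); last by rewrite E; exact: hGt.
  by apply/andP; split; lra.
- move=> s t hs /andP[t0 t1] E; apply/eqP; rewrite eq_le t0 andbT leNgt; apply/negP => h'.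
  by apply: (gG' (dv - t)); [apply/andP; split; lra|rewrite -E; exact: hGt].
- move=> s t /andP[s0 s1] /andP[t0 t1] E.
  (* A point common to both geodesics has the same parameter on each, namely its distance to z. *)
  have E' : dv - s = m + t.
    have : mdist (g 0) (g (dv - s)) = mdist (f 0) (f (m + t)) by rewrite g0 f0 E.
    rewrite (geoE gg) ?lexx//; last by apply/andP; split; lra.
    rewrite (geoE gf) ?lexx//; last by apply/andP; split; lra.
    by rewrite !sub0r !normrN !ger0_norm//; lra.
  have : m + t <= m.
    apply: ub_le_sup; [by case: hT|split; last by rewrite -E E'].
    by rewrite le_min; apply/andP; split; [lra|apply/andP; split; lra].
  by lra.
have Du : D u by have := D2 0; rewrite h0; apply; rewrite lexx ltW.
have Dv : D v by have := D2 (mdist u v); rewrite hd; apply; rewrite lexx ltW.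
apply: (fG m); first by rewrite m0.
apply: (HG D sD u v Du Dv Gu Gv uv).
by have := D1 0; rewrite addr0; apply; rewrite lexx ltW.
Qed.

(** Every geodesic from z to b first meets G at the unique entry. *)
Lemma entry_dist z u b : entry G z u -> G b -> mdist z b = mdist z u + mdist u b.
Proof.
have [cG gG HG] := satG.
move=> ezu Gb; have [f [gf f0 fb _]] := geoF (x := z) (y := b) I I.
have D0 := mdist_ge0 z b.
have Gfb : G (f (mdist z b)) by rewrite fb.
have [t0 /andP[h0 h1]] := entry_geodesic cG D0 gf Gfb.
rewrite f0 => /(entry_unique ezu) ->.
have -> : mdist z (f t0) = t0.
  by rewrite -[X in mdist X _]f0 (geoE gf) ?lexx ?h0// sub0r normrN ger0_norm.
have -> : mdist (f t0) b = mdist z b - t0.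
  rewrite -[X in mdist _ X = _]fb (geoE gf) ?lexx ?h0 ?h1 ?D0//.
  by rewrite distrC ger0_norm ?subr_ge0.
by ring.
Qed.

Lemma entry_exists z b : G b -> exists u, entry G z u.
Proof.
have [cG gG HG] := satG.
move=> Gb; have [f [gf f0 fb _]] := geoF (x := z) (y := b) I I.
have Gfb : G (f (mdist z b)) by rewrite fb.
have [t0 _] := entry_geodesic cG (mdist_ge0 z b) gf Gfb.
by rewrite f0; exists (f t0).
Qed.

(** If the entries differ, the curve A through z, u, u' and the curve B from z' to u' meet only at
    u', since another common point would have two entries. The last point of k on A and the next
    point of k on B then cut out a simple triangle with vertex u' that contains u. It lies in G,
    although k avoids G. *)
Lemma entry_avoid z z' u u' k d : 0 <= d -> geodesic_on 0 d k -> k 0 = z -> k d = z' ->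
  (forall t, 0 <= t <= d -> ~ G (k t)) -> entry G z u -> entry G z' u' -> u = u'.
Proof.
have [cG gG HG] := satG.
move=> d0 gk k0 kd kG ezu ezu'; apply: contrapT => uu'.
have [Gu [f [gf f0 fu fG]]] := ezu; have [Gu' [B [gB B0 Bu BG]]] := ezu'.
set du := mdist z u in gf fu fG *; set dB := mdist z' u' in gB Bu BG *.
have du0 : 0 <= du by exact: mdist_ge0.
have dB0 : 0 <= dB by exact: mdist_ge0.
have [h [gh h0 hd hG]] := gG u u' Gu Gu'.
set e := mdist u u' in gh hd hG *.
have e0 : 0 < e by rewrite mdist_gt0; apply/eqP.
have hGt t : 0 <= t <= e -> G (h t) by move=> ht; apply: hG; exists t => //=; rewrite in_itv.
(* By [entry_dist], going from z to u and on to u' is geodesic, so the figure cut out has three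
   sides and not four. *)
pose dA := du + e.
pose A t := if t <= du then f t else h (t - du).
have dAu : du < dA by rewrite ltrDl.
have gA : geodesic_on 0 dA A.
  apply: geodesic_cat => //; [exact: ltW|by rewrite fu|].
  by rewrite f0 hd (entry_dist ezu Gu').
have A0 : A 0 = z by rewrite /A du0.
have Adu : A du = u by rewrite /A lexx.
have AdA : A dA = u'.
  by rewrite /A leNgt dAu/= -hd; congr h; rewrite /dA; ring.
have AG t : du <= t <= dA -> G (A t).
  rewrite /A => /andP[t1 t2]; case: ifPn => [t3|_].
    by have -> : t = du; [lra|rewrite fu].
  by apply: hGt; apply/andP; split; rewrite /dA in t2; lra.
have dA0 : 0 <= dA by rewrite (le_trans du0)// ltW.
have AB s t : 0 <= s <= dA -> 0 <= t <= dB -> A s = B t -> s = dA /\ t = dB.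
  move=> hs ht E.
  have [tE|tB] := eqVneq t dB.
    split => //; apply: (geodesic_inj gA hs); first by rewrite dA0 lexx.
    by rewrite AdA E tE Bu.
  exfalso; have tB' : t < dB by rewrite lt_neqAle tB; case/andP: ht.
  have nG : ~ G (B t) by apply: BG; rewrite tB'; case/andP: ht => ->.
  have su : s <= du.
    rewrite leNgt; apply/negP => us; apply: nG; rewrite -E; apply: AG.
    by rewrite (ltW us); case/andP: hs.
  have es : s <= du by [].
  have e1 : entry G (B t) u'.
    by rewrite -Bu; apply: entry_sub => //; rewrite Bu.
  have e2 : entry G (A s) u.
    rewrite /A su -fu; apply: entry_sub => //; last by rewrite fu.
    by rewrite su; case/andP: hs => ->.
  by apply: uu'; apply: entry_unique e2 _; rewrite E.
pose iA := A @` `[0, dA]; pose iB := B @` `[0, dB].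
have ciA : closed iA by apply: lip1_closed; exact: geodesic_lip1.
have ciB : closed iB by apply: lip1_closed; exact: geodesic_lip1.
have [|p [/andP[p0 pd] [sp /= + Ep] plast]] := last_hit ciA d0 gk.
  by rewrite k0; exists 0 => //=; rewrite in_itv/= lexx.
rewrite in_itv/= => hsp.
have dp0 : 0 <= d - p by rewrite subr_ge0.
have [|r0 [/andP[r00 r0d] [tr /= + Er] rfirst]] :=
    first_hit ciB dp0 (geodesic_lip1 (geodesic_drop gk p0)).
  exists 0; first by rewrite /= in_itv/= dB0 lexx.
  by rewrite B0; have -> : p + (d - p) = d by ring.
rewrite in_itv/= => htr.
have kpG : ~ G (k p) by apply: kG; rewrite p0.
have krG : ~ G (k (p + r0)) by apply: kG; apply/andP; clear -p0 r00 r0d; split; lra.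
have spu : sp < du.
  rewrite ltNge; apply/negP => h'; apply: kpG; rewrite -Ep; apply: AG.
  by rewrite h'; case/andP: hsp.
have trB : tr < dB.
  rewrite lt_neqAle; case/andP: (htr) => _ ->; rewrite andbT; apply/eqP => E.
  by apply: krG; rewrite -Er E Bu.
have r0p : 0 < r0.
  rewrite lt_neqAle r00 andbT; apply/eqP => E.
  have [E' _] : sp = dA /\ tr = dB.
    by apply: AB => //; rewrite Ep Er -E addr0.
  by move: spu; rewrite E' ltNge (ltW dAu).
have lA : 0 < dA - sp by rewrite subr_gt0; exact: lt_trans dAu.
have lB : 0 < dB - tr by rewrite subr_gt0.
have ltB : dB - tr <= dB by rewrite gerBl; case/andP: htr.
have sp0 : 0 <= sp by case/andP: hsp.
have tr0 : 0 <= tr by case/andP: htr.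
have [||||||D [sD D1 _ _]] := simple_triangle lA lB r0p (geodesic_drop gA sp0)
  (geodesic_take (geodesic_rev gB) ltB)
  (geodesic_rev (geodesic_take (geodesic_drop gk p0) r0d)).
- by rewrite subr0 Bu -AdA; congr A; ring.
- by rewrite subr0 -Er; congr B; ring.
- by rewrite subrr !addr0 Ep.
- move=> s t /andP[s0 s1] /andP[t0 t1] E.
  have hs : 0 <= sp + s <= dA by apply/andP; clear -s0 s1 sp0; split; lra.
  have ht : 0 <= dB - t <= dB by apply/andP; clear -t0 t1 tr0; split; lra.
  by have [_] := AB _ _ hs ht E; clear; lra.
- move=> s t /andP[s0 s1] /andP[t0 t1] E; apply/eqP; rewrite eq_le t0 andbT leNgt; apply/negP => h'.
  apply: (rfirst (r0 - t)); first by apply/andP; clear -t1 h'; split; lra.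
  by exists (dB - s) => //=; rewrite in_itv/=; apply/andP; clear -s0 s1 tr0; split; lra.
- move=> s t /andP[s0 s1] /andP[t0 t1] E; apply/eqP; rewrite eq_le s1 leNgt; apply/negP => h'.
  apply: (plast (p + (r0 - s))); first by apply/andP; clear -s0 h' r0d; split; lra.
  by exists (sp + t) => //=; rewrite in_itv/=; apply/andP; clear -t0 t1 sp0; split; lra.
have Du : D u.
  have := D1 (du - sp); have -> : sp + (du - sp) = du by ring.
  by rewrite Adu; apply; apply/andP; clear -spu dAu; split; lra.
have Du' : D u'.
  have := D1 (dA - sp); have -> : sp + (dA - sp) = dA by ring.
  by rewrite AdA; apply; apply/andP; clear -lA; split; lra.
apply: kpG; rewrite -Ep; apply: (HG D sD u u' Du Du' Gu Gu' uu').
by have := D1 0; rewrite addr0; apply; rewrite lexx ltW.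
Qed.

(** The entry is locally constant off G. If S missed u, the points of S with entry u would form an
    open and closed part of S, hence all of S. *)
Lemma entry_connected S z z' u u' : connected S -> S z -> S z' ->
  entry G z u -> entry G z' u' -> u <> u' -> S u.
Proof.
have [cG gG HG] := satG.
move=> cS Sz Sz' ezu ezu' uu'; apply: contrapT => nSu.
have ne : S `&` [set w | entry G w u] !=set0 by exists z.
have cvx w w' e : (forall y, mdist w y < e -> ~ G y) -> mdist w w' < e ->
    forall v v', entry G w v -> entry G w' v' -> v = v'.
  move=> He ww' v v'; have [f [gf f0 f1 _]] := geoF (x := w) (y := w') I I.
  apply: (entry_avoid (mdist_ge0 w w') gf f0 f1) => t /andP[t0 t1].
  apply: He; apply: le_lt_trans ww'.
  rewrite -{1}f0 (geoE gf) ?lexx ?t0 ?mdist_ge0//.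
  by rewrite sub0r normrN ger0_norm.
suff E : S `&` [set w | entry G w u] = S.
  have : (S `&` [set w | entry G w u]) z' by rewrite E.
  by move=> [_ /= e']; apply: uu'; exact: entry_unique e' ezu'.
apply: cS => //.
- exists [set w | entry G w u /\ ~ G w].
    apply: open_mdist => w [ewu nGw]; have [e e0 He] := closed_far cG nGw.
    exists e => // w' ww'; split; last exact: He.
    have [v ev] := entry_exists w' (proj1 ewu).
    by rewrite (cvx _ _ _ He ww' _ _ ewu ev).
  apply/seteqP; split => w [Sw]; last by move=> [].
  move=> /= ewu; split => //; split => // Gw.
  by apply: nSu; rewrite (entry_unique ewu (entry_refl Gw)).
- exists [set w | entry G w u] => //.
  apply: closed_mdist => w nw.
  have [v ev] := entry_exists w (proj1 ezu).
  have vu : v <> u by move=> E; apply: nw; rewrite /= -E.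
  have [Gw|nGw] := pselect (G w).
    have wu : w <> u by move=> E; apply: nw; rewrite /= -E; exact: entry_refl.
    exists (mdist w u); first by rewrite mdist_gt0; apply/eqP.
    move=> w' ww' ew'; have := entry_dist ew' Gw.
    rewrite (metric_sym w' w) (metric_sym u w); have := mdist_ge0 w' u; lra.
  have [e e0 He] := closed_far cG nGw; exists e => // w' ww' ew'.
  by apply: vu; exact: cvx He ww' _ _ ev ew'.
Qed.

End Saturated.

Section TreeGraded.
Context (P : set (set F)) (tgP : tree_graded P).

Lemma piece_saturated B : P B -> triangle_saturated B.
Proof.
have [_ Pcg T1 T2] := tgP.
move=> PB; have [cB gB] := Pcg B PB; split => // D /T2 [B' PB' DB'] u v Du Dv Bu Bv uv.
have [->//|BB'] := pselect (B = B').
by case: uv; apply: (T1 B B' PB PB' BB'); split => //; exact: DB'.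
Qed.

Lemma topological_arc_connected x A : topological_arc x A -> connected A /\ A x.
Proof.
move=> [u [v [f [uv cf _ fu ->]]]]; split.
  exact: connected_continuous_connected (@segment_connected R u v) cf.
by exists u => //=; rewrite in_itv/= lexx.
Qed.

(** An arc from x to a would contain both entries if they differed, and it meets the piece at most
    once. *)
Lemma transversal_tree_entry x a B w w' : P B -> transversal_tree P x a ->
  entry B x w -> entry B a w' -> w = w'.
Proof.
move=> PB [A [arcA AB Aa]] ew ew'; have [cA Ax] := topological_arc_connected arcA.
have sB := piece_saturated PB; have [//|ww'] := pselect (w = w').
apply: (AB B PB); split; [|by case: ew| |by case: ew'].
  exact: (entry_connected sB cA Ax Aa ew ew').
by apply: (entry_connected sB cA Aa Ax ew' ew) => E; exact: ww'.
Qed.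

(** The points where the geodesic enters B from either end both equal the entry of x, so they
    coincide, and everything between them collapses. *)
Lemma transversal_geodesic x a b k d : transversal_tree P x a -> transversal_tree P x b ->
  0 <= d -> geodesic_on 0 d k -> k 0 = a -> k d = b ->
  forall B, P B -> is_subset1 ([set k t | t in `[0, d]] `&` B).
Proof.
move=> Ta Tb d0 gk k0 kd B PB.
have sB := piece_saturated PB; have [cB _ _] := sB.
suff H t1 t2 : 0 <= t1 -> t1 <= t2 -> t2 <= d -> B (k t1) -> B (k t2) -> t1 = t2.
  move=> _ _ [[t1 /= + <-] B1] [[t2 /= + <-] B2]; rewrite !in_itv/= => /andP[? ?] /andP[? ?].
  have [h|/ltW h] := leP t1 t2; first by congr k; exact: H.
  by apply/esym; congr k; exact: H.
move=> t10 t12 t2d B1 B2.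
have t1d := le_trans t12 t2d; have t20 := le_trans t10 t12.
have [s1 /andP[s10 s11] es1] := entry_geodesic cB t10 (geodesic_take gk t1d) B1.
have d2 : 0 <= d - t2 by rewrite subr_ge0.
have gr := geodesic_take (geodesic_rev gk) (_ : d - t2 <= d).
have [||s2 /andP[s20 s21]] := entry_geodesic cB d2 (gr _).
- by rewrite gerBl.
- by have -> : d - (d - t2) = t2 by ring.
rewrite subr0 kd => es2.
rewrite k0 in es1.
have [w ew] := entry_exists sB x B1.
have E : k s1 = k (d - s2).
  by rewrite -(transversal_tree_entry PB Ta ew es1) -(transversal_tree_entry PB Tb ew es2).
have : s1 = d - s2.
  by apply: (geodesic_inj gk) E; apply/andP; split; lra.
by lra.
Qed.

(** The initial part G of the geodesic up to k t is triangle-saturated for want of triangles: each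
    lies in a piece, which meets G at most once. The entry of b into G is k t and that of a is a, so
    a connected set containing a and b contains k t. *)
Lemma transversal_connected x a b k d S : transversal_tree P x a -> transversal_tree P x b ->
  0 <= d -> geodesic_on 0 d k -> k 0 = a -> k d = b -> connected S -> S a -> S b ->
  forall t, 0 <= t <= d -> S (k t).
Proof.
move=> Ta Tb d0 gk k0 kd cS Sa Sb t /andP[t0 td].
have [->//|ne] := pselect (k t = a).
have gkt := geodesic_take gk td.
pose G := [set k s | s in `[0, t]].
have Gk s : 0 <= s <= t -> G (k s) by move=> hs; exists s => //=; rewrite in_itv.
have satG : triangle_saturated G.
  have [_ _ _ T2] := tgP; split.
  - by apply: lip1_closed; exact: geodesic_lip1.
  - move=> _ _ [s1 /= + <-] [s2 /= + <-]; rewrite !in_itv/= => h1 h2.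
    rewrite (geoE gkt)//; have [h|/ltW h] := leP s1 s2.
      rewrite distrC ger0_norm ?subr_ge0//.
      exists (fun r => k (s1 + r)); split.
      + apply: (geodesic_on_iso (phi := fun r => s1 + r) gkt).
          by move=> r /andP[? ?]; apply/andP; split; lra.
        by move=> r r'; congr `|_|; ring.
      + by rewrite addr0.
      + by congr k; ring.
      + by move=> _ [r /= + <-]; rewrite in_itv/= => /andP[? ?]; apply: Gk; apply/andP; split; lra.
    rewrite ger0_norm ?subr_ge0//.
    exists (fun r => k (s1 - r)); split.
    + apply: (geodesic_on_iso (phi := fun r => s1 - r) gkt).
        by move=> r /andP[? ?]; apply/andP; split; lra.
      by move=> r r'; rewrite distrC; congr `|_|; ring.
    + by rewrite subr0.
    + by congr k; ring.
    + by move=> _ [r /= + <-]; rewrite in_itv/= => /andP[? ?]; apply: Gk; apply/andP; split; lra.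
  - move=> D /T2 [B PB DB] u v Du Dv Gu Gv uv; exfalso; apply: uv.
    have Gall w : G w -> [set k s | s in `[0, d]] w.
      by move=> [s /= + <-]; rewrite in_itv/= => /andP[? ?]; exists s => //=; rewrite in_itv/=; apply/andP; split; lra.
    apply: (transversal_geodesic Ta Tb d0 gk k0 kd PB).
      by split; [exact: Gall|exact: DB].
    by split; [exact: Gall|exact: DB].
have Ga : G a by rewrite -k0; apply: Gk; rewrite lexx.
have dt0 : 0 <= d - t by rewrite subr_ge0.
have dtd : d - t <= d by rewrite gerBl.
have eb : entry G b (k t).
  have := @entry_sub G _ (d - t) 0 (geodesic_take (geodesic_rev gk) dtd).
  rewrite subr0 kd; have -> : d - (d - t) = t by ring.
  apply; first by rewrite lexx.
    by apply: Gk; rewrite t0 lexx.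
  move=> r /andP[r0 rd] [s /=]; rewrite in_itv/= => /andP[s0 st] E.
  have : s = d - r by apply: (geodesic_inj gk) E; apply/andP; split; lra.
  by lra.
exact: (entry_connected satG cS Sb Sa eb (entry_refl Ga)).
Qed.

End TreeGraded.

End Entry.

(** * Tree-graded structures from separating lines *)

Section SeparatingLine.
Context {R : realType} {F : metricType R} (geoF : geodesic_set [set: F]).
Context (Q : R -> F) (K : R) (K0 : 0 < K).
Context (Qup : forall s t, mdist (Q s) (Q t) <= K * `|s - t|).
Context (Qlow : forall s t, `|s - t| <= K * mdist (Q s) (Q t)).
Context (sepQ : forall S, closed S -> connected S -> forall s r t, s <= r <= t ->
  S (Q s) -> S (Q t) -> S (Q r)).
Implicit Types (x y z : F) (S : set F) (u v w : R).

Lemma line_inj u v : Q u = Q v -> u = v.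
Proof.
move=> E; have := Qlow u v; rewrite E mdistxx mulr0 normr_le0 subr_eq0.
by move/eqP.
Qed.

Definition nearest z u := forall v, mdist z (Q u) <= mdist z (Q v).

Definition strictly_between u u' w := u < w < u' \/ u' < w < u.

Lemma strictly_between_third u u' (th : R) : u <> u' -> 0 < th < 1 ->
  strictly_between u u' (u + th * (u' - u)).
Proof.
move=> /eqP uu' /andP[t0 t1]; rewrite /strictly_between.
have [h|h|h] := ltgtP u u'; last by rewrite h eqxx in uu'.
- have h1 : 0 < th * (u' - u) by rewrite mulr_gt0// subr_gt0.
  have h2 : 0 < (1 - th) * (u' - u) by rewrite mulr_gt0// subr_gt0.
  by left; apply/andP; split; lra.
- have h1 : 0 < th * (u - u') by rewrite mulr_gt0// subr_gt0.
  have h2 : 0 < (1 - th) * (u - u') by rewrite mulr_gt0// subr_gt0.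
  by right; apply/andP; split; lra.
Qed.

Lemma line_cont u v : {within `[u, v], continuous Q}.
Proof.
apply/within_contP => x xuv e e0; exists (e / K); first by rewrite divr_gt0.
move=> t _; rewrite ltr_pdivlMr// mulrC; exact: le_lt_trans.
Qed.

(** F need not be proper; compactness is used for parameters only. Outside [-M, M] the lower bound
    puts Q v at least as far from z as Q 0. *)
Lemma nearest_exists z : exists u, nearest z u.
Proof.
have K0' := K0.
pose M := K * (2 * mdist z (Q 0)).
have M0 : 0 <= M by rewrite !mulr_ge0 ?mdist_ge0// ltW.
have MM : - M <= M by lra.
have cf : {within `[- M, M], continuous (fun v => mdist z (Q v))}.
  apply: continuous_subspaceT => x; apply/cvgrPdist_lt => e e0.
  apply/nbhs_ballP; exists (e / K) => /=; first by rewrite divr_gt0.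
  move=> t /=; rewrite ltr_pdivlMr// mulrC => h.
  apply: le_lt_trans h; apply: le_trans (Qup x t).
  have := metric_triangle z (Q x) (Q t); have := metric_triangle z (Q t) (Q x).
  by rewrite (metric_sym (Q t)) ler_norml => ? ?; apply/andP; split; lra.
have [c _ Hc] := EVT_min MM cf.
exists c => v; have [vM|vM] := boolP (v \in `[- M, M]); first exact: Hc.
have h0 : mdist z (Q c) <= mdist z (Q 0).
  by apply: Hc; rewrite in_itv/= oppr_le0 M0.
apply: (le_trans h0); rewrite leNgt; apply/negP => h.
move/negP: vM; apply; rewrite in_itv/= -ler_norml.
have := Qlow v 0; rewrite subr0 => /le_trans; apply; rewrite /M ler_wpM2l ?ltW//.
have := metric_triangle (Q v) z (Q 0); rewrite (metric_sym (Q v) z); lra.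
Qed.

Lemma nearest_segment z u : nearest z u -> exists S, [/\ closed S, connected S, S z, S (Q u) &
  forall w, S (Q w) -> w = u].
Proof.
move=> nz; have [f [gf f0 f1 _]] := geoF (x := z) (y := Q u) I I.
have D0 := mdist_ge0 z (Q u).
exists (f @` `[0, mdist z (Q u)]); split.
- by apply: lip1_closed; exact: geodesic_lip1.
- by apply: lip1_connected; exact: geodesic_lip1.
- by exists 0 => //=; rewrite in_itv/= lexx.
- by exists (mdist z (Q u)) => //=; rewrite in_itv/= lexx D0.
- move=> w [t /=]; rewrite in_itv/= => /andP[t0 t1] E.
  apply: line_inj; rewrite -E -[RHS]f1; congr f; apply/eqP; rewrite eq_le t1/=.
  apply: (le_trans (nz w)); rewrite -E -{1}f0 (geoE gf) ?lexx ?t0//.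
  by rewrite sub0r normrN ger0_norm.
Qed.

(** Adding to S geodesics from z and z' to their nearest points gives a closed connected set that
    contains Q u and Q u', hence Q w. The added geodesics meet the line only at Q u and Q u'. *)
Lemma nearest_cross S z z' u u' w : closed S -> connected S -> S z -> S z' ->
  nearest z u -> nearest z' u' -> strictly_between u u' w -> S (Q w).
Proof.
move=> cS kS Sz Sz' /nearest_segment[A [cA kA Az Au Aw]] /nearest_segment[B [cB kB Bz Bu Bw]] uwu.
have cT : closed (A `|` S `|` B) by apply: closedU => //; exact: closedU.
have kT : connected (A `|` S `|` B).
  apply: connectedU => //; first by exists z'; split => //; right.
  by apply: connectedU => //; exists z.
have Tu : (A `|` S `|` B) (Q u) by left; left.
have Tu' : (A `|` S `|` B) (Q u') by right.
have : (A `|` S `|` B) (Q w).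
  case: uwu => /andP[h1 h2].
    by apply: (sepQ cT kT _ Tu Tu'); rewrite !ltW.
  by apply: (sepQ cT kT _ Tu' Tu); rewrite !ltW.
by case=> [[/Aw E|//]|/Bw E]; move: uwu; rewrite E => -[] /andP[]; rewrite ltxx.
Qed.

(** Otherwise the one-point set {z} would contain two different points of the line. *)
Lemma nearest_unique z u u' : nearest z u -> nearest z u' -> u = u'.
Proof.
move=> nu nu'; apply: contrapT => uu'.
have cz : closed [set z].
  by apply: compact_closed; [exact: metric_hausdorff|exact: compact_set1].
have H th : 0 < th < 1 -> Q (u + th * (u' - u)) = z.
  move=> hth; have uw := strictly_between_third uu' hth.
  exact: (nearest_cross cz (@connected1 _ z) erefl erefl nu nu' uw).
have : u + 1 / 3 * (u' - u) = u + 1 / 2 * (u' - u).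
  by apply: line_inj; rewrite !H//; apply/andP; split; lra.
by move=> h; apply: uu'; lra.
Qed.

Definition fibers : set (set F) := [set [set z | nearest z u] | u in [set: R]].

Lemma fiber_closed u : closed [set z | nearest z u].
Proof.
apply: closed_mdist => z /= nz.
have [v hv] : exists v, mdist z (Q v) < mdist z (Q u).
  apply: contrapT => h; apply: nz => v; rewrite leNgt; apply/negP => hv; apply: h.
  by exists v.
exists ((mdist z (Q u) - mdist z (Q v)) / 2).
  by rewrite divr_gt0// subr_gt0.
move=> y zy /(_ v) h.
have := metric_triangle z y (Q u); have := metric_triangle y z (Q v).
by rewrite (metric_sym y z); lra.
Qed.

(** If f t had another nearest point, the two parts of the geodesic separated by f t would both
    contain every point of the line strictly between. They share f t only, whereas two such points
    are at hand. *)
Lemma fiber_geodesic u : geodesic_set [set z | nearest z u].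
Proof.
move=> x y nx ny; have [f [gf f0 f1 _]] := geoF (x := x) (y := y) I I.
exists f; split => // _ [t /= + <-]; rewrite in_itv/= => /andP[t0 td].
have [u' nu'] := nearest_exists (f t).
have [->//|uu'] := pselect (u = u'); exfalso.
have l1 := geodesic_lip1 (geodesic_take gf td).
have l2 : lip1 f t (mdist x y).
  move=> s s' /andP[ts sd] /andP[ts' sd']; rewrite (geoE gf)// ?sd ?sd' ?andbT.
    exact: le_trans ts.
  exact: le_trans ts'.
have H th : 0 < th < 1 -> Q (u + th * (u' - u)) = f t.
  move=> /(strictly_between_third uu') uw.
  have [||s1 /= h1 E1] := nearest_cross (lip1_closed l1) (lip1_connected l1) _ _ nx nu' uw.
  - by exists 0 => //=; rewrite in_itv/= lexx.
  - by exists t => //=; rewrite in_itv/= t0 lexx.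
  have uw' : strictly_between u' u (u + th * (u' - u)) by case: uw => h; [right|left].
  have [||s2 /= h2 E2] := nearest_cross (lip1_closed l2) (lip1_connected l2) _ _ nu' ny uw'.
  - by exists t => //=; rewrite in_itv/= td lexx.
  - by exists (mdist x y) => //=; rewrite in_itv/= td lexx.
  rewrite !in_itv/= in h1 h2; move: h1 h2 => /andP[h1 h1'] /andP[h2 h2'].
  have E : s1 = s2.
    apply: (geodesic_inj gf); [by rewrite h1 (le_trans h1')|by rewrite h2' (le_trans t0)|].
    by rewrite E1.
  by rewrite -E1; congr f; apply/eqP; rewrite eq_le h1' E h2.
have : u + 1 / 3 * (u' - u) = u + 1 / 2 * (u' - u).
  by apply: line_inj; rewrite !H//; apply/andP; split; lra.
by move=> h; apply: uu'; lra.
Qed.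

(** As for geodesics, with the two arcs of the triangle from c 0 to c t. They share two points
    instead of one, so three points of the line are needed for a contradiction. *)
Lemma fiber_triangle A : simple_geodesic_triangle A -> exists2 B, fibers B & A `<=` B.
Proof.
move=> [l [s1 [s2 [c [[l0 s10 s12 s2l] [g1 g2 g3] [c0l injc] ->]]]]].
have lc : lip1 c 0 l.
  apply: (@lip1_join _ _ _ _ s2); first by rewrite s2l (le_trans s10).
    apply: (@lip1_join _ _ _ _ s1); first by rewrite s10.
      exact: geodesic_lip1.
    exact: geodesic_lip1.
  exact: geodesic_lip1.
have [u nu] := nearest_exists (c 0).
exists [set z | nearest z u]; first by exists u.
move=> _ [t /= + <-]; rewrite in_itv/= => /andP[t0 tl].
have [u' nu'] := nearest_exists (c t).
have [->//|uu'] := pselect (u = u'); exfalso.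
have k1 : lip1 c 0 t.
  by move=> s s' /andP[h1 h2] /andP[h3 h4]; apply: lc; rewrite ?h1 ?h3 (le_trans _ tl).
have k2 : lip1 c t l.
  by move=> s s' /andP[h1 h2] /andP[h3 h4]; apply: lc; rewrite ?h2 ?h4 andbT (le_trans t0).
have H th : 0 < th < 1 -> Q (u + th * (u' - u)) = c t \/ Q (u + th * (u' - u)) = c 0.
  move=> /(strictly_between_third uu') uw.
  have [||a /= h1 E1] := nearest_cross (lip1_closed k1) (lip1_connected k1) _ _ nu nu' uw.
  - by exists 0 => //=; rewrite in_itv/= lexx.
  - by exists t => //=; rewrite in_itv/= t0 lexx.
  have uw' : strictly_between u' u (u + th * (u' - u)) by case: uw => h; [right|left].
  have [||b /= h2 E2] := nearest_cross (lip1_closed k2) (lip1_connected k2) _ _ nu' nu uw'.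
  - by exists t => //=; rewrite in_itv/= tl lexx.
  - by exists l => //=; rewrite in_itv/= tl lexx.
  rewrite !in_itv/= in h1 h2; move: h1 h2 => /andP[h1 h1'] /andP[h2 h2'].
  have [bl|bl] := eqVneq b l; first by right; rewrite -E2 bl -c0l.
  have bl' : b < l by rewrite lt_neqAle bl.
  left; have E : a = b.
    apply: injc; last by rewrite E1.
      by rewrite in_itv/= h1 (le_lt_trans h1')// (le_lt_trans h2).
    by rewrite in_itv/= bl' andbT (le_trans t0).
  by rewrite -E1; congr c; apply/eqP; rewrite eq_le h1' E h2.
have dif (a b : R) : a <> b -> Q (u + a * (u' - u)) <> Q (u + b * (u' - u)).
  move=> ab /line_inj /addrI h; apply: ab; apply: mulIf h.
  by rewrite subr_eq0; apply/eqP => h; apply: uu'.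
have i1 : 0 < (1 / 2 : R) < 1 by apply/andP; split; lra.
have i2 : 0 < (1 / 3 : R) < 1 by apply/andP; split; lra.
have i3 : 0 < (1 / 4 : R) < 1 by apply/andP; split; lra.
have d12 : (1 / 2 : R) <> 1 / 3 by lra.
have d13 : (1 / 2 : R) <> 1 / 4 by lra.
have d23 : (1 / 3 : R) <> 1 / 4 by lra.
have [e1|e1] := H _ i1; have [e2|e2] := H _ i2; have [e3|e3] := H _ i3;
  solve [ by apply: (dif _ _ d12); rewrite e1 e2
        | by apply: (dif _ _ d13); rewrite e1 e3
        | by apply: (dif _ _ d23); rewrite e2 e3].
Qed.

Lemma fibers_tree_graded : @is_complete R F -> tree_graded fibers.
Proof.
move=> cF; split => //.
- by move=> _ [u _ <-]; split; [exact: fiber_closed|exact: fiber_geodesic].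
- move=> _ _ [u _ <-] [v _ <-] uv x y [/= xu xv] _; exfalso; apply: uv.
  by rewrite (nearest_unique xu xv).
- exact: fiber_triangle.
Qed.

Lemma line_transversal u : transversal_tree fibers (Q 0) (Q u).
Proof.
(* The sign lets one parametrization by [0, |u|] serve both directions; for u = 0 the arc is a
   point. *)
pose f (t : R) := Q (t * Num.sg u).
have sg1 : u != 0 -> `|Num.sg u| = 1 by move=> u0; rewrite normr_sg u0.
have lf s t : mdist (f s) (f t) <= K * `|s - t|.
  apply: (le_trans (Qup _ _)); rewrite ler_wpM2l ?(ltW K0)// -mulrBl normrM.
  by rewrite ler_piMr// normr_sg lern1 leq_b1.
exists (f @` `[0, `|u|]); split.
- exists 0, `|u|, f; split => //.
  + apply/within_contP => x _ e e0; exists (e / K); first by rewrite divr_gt0.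
    by move=> t _; rewrite ltr_pdivlMr// mulrC; exact: le_lt_trans.
  + move=> s t; rewrite !in_itv/= => hs ht /line_inj h.
    have [u0|u0] := eqVneq u 0; last by apply: mulIf h; rewrite sgr_eq0.
    by move: hs ht; rewrite u0 normr0 => /le_anti <- /le_anti <-.
  + by rewrite /f mul0r.
- move=> _ [v _ <-] _ _ [[s _ <-] /= ns] [[t _ <-] /= nt].
  have H w : nearest (Q w) v -> Q w = Q v.
    move=> /(_ w); rewrite mdistxx => h; apply: mdist_positivity.
    by apply/eqP; rewrite eq_le h mdist_ge0.
  by rewrite /f (H _ ns) (H _ nt).
- exists `|u|; first by rewrite /= in_itv/= lexx normr_ge0.
  by rewrite /f mulrC -numEsg.
Qed.

End SeparatingLine.

(** * Asymptotic cones *)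

Section ConeClasses.
Local Open Scope quotient_scope.
Context {R : realType} {X : metricType R} (c : cone_data X).
Implicit Types (x y : nat -> X) (B e : R).

Local Notation d := (scale c).
Local Notation om := (omega c).

Lemma near_scale B : \forall n \near om, B <= d n.
Proof. by have /cvgryPge := scale_infty c; apply. Qed.

Lemma near_ge N : \forall n \near om, (N <= n)%N.
Proof.
elim: N => [|N IH]; first exact: nearW.
have nN : om (~` [set N]).
  by have [/omega_nonprincipal|] := in_ultra_setVsetC [set N] (omega_ultra c).
apply: filterS2 IH nN => n h1 h2; rewrite ltn_neqAle h1 andbT.
by apply/eqP => E; apply: h2; rewrite /= E.
Qed.

Lemma scaled_dist_le x y n B : (scaled_dist c x y n <= B) = (mdist (x n) (y n) <= B * d n).
Proof. by rewrite /scaled_dist ler_pdivrMr// scale_gt0. Qed.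

Lemma scaled_dist_lt x y n B : (scaled_dist c x y n < B) = (mdist (x n) (y n) < B * d n).
Proof. by rewrite /scaled_dist ltr_pdivrMr// scale_gt0. Qed.

Lemma scaled_dist_gt x y n B : (B < scaled_dist c x y n) = (B * d n < mdist (x n) (y n)).
Proof. by rewrite /scaled_dist ltr_pdivlMr// scale_gt0. Qed.

Lemma bounded_near_base x B : (\forall n \near om, mdist (x n) (basepoint c n) <= B * d n) ->
  bounded_seq c x.
Proof.
move=> H; apply: (@ultra_bounded_cvg _ _ c _ B).
by apply: filterS H => n; rewrite scaled_dist_ge0 scaled_dist_le.
Qed.

Lemma bounded_base : bounded_seq c (basepoint c).
Proof. by apply: (@bounded_near_base _ 0); apply: nearW => n; rewrite mdistxx mul0r. Qed.

Definition base_cone_seq : cone_seq c :=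
  exist (fun x => x \in bounded_seq c) (basepoint c) (mem_set bounded_base).

(** Made total by sending unbounded sequences to the base point, so that representatives can be
    written down without membership proofs. *)
Definition class_of x : cone c := \pi_(cone c) (insubd base_cone_seq x).

Lemma class_ofE x : bounded_seq c x -> exists2 s : cone_seq c, val s = x & class_of x = \pi_(cone c) s.
Proof.
move=> bx; exists (insubd base_cone_seq x) => //.
by rewrite val_insubd mem_set.
Qed.

Lemma class_of_surj (z : cone c) : exists2 x, bounded_seq c x & z = class_of x.
Proof.
exists (val (repr z)); first by have /set_mem := valP (repr z).
by rewrite /class_of valKd reprK.
Qed.

Lemma ultralimitP A z : ultralimit c A z <->
  exists x, [/\ bounded_seq c x, forall n, A (x n) & z = class_of x].
Proof.
split=> [[s As <-]|[x [bx Ax ->]]].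
  exists (val s); split => //; first by have /set_mem := valP s.
  by rewrite /class_of valKd.
by have [s sx ->] := class_ofE bx; exists s => //= n; rewrite sx.
Qed.

Lemma class_dist_cvg x y : bounded_seq c x -> bounded_seq c y ->
  scaled_dist c x y @ om --> mdist (class_of x) (class_of y).
Proof.
move=> /class_ofE[s <- ->] /class_ofE[t <- ->]; rewrite cone_mdistE.
exact: cone_seq_cvg.
Qed.

Lemma class_dist_le x y B : bounded_seq c x -> bounded_seq c y ->
  (\forall n \near om, mdist (x n) (y n) <= B * d n) ->
  mdist (class_of x) (class_of y) <= B.
Proof.
move=> bx by_ H; have cv := class_dist_cvg bx by_.
rewrite -(cvg_lim _ cv)//; apply: limr_le; first by apply/cvg_ex; exists (mdist (class_of x) (class_of y)).
by apply: filterS H => n; rewrite scaled_dist_le.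
Qed.

Lemma class_dist_ge x y B : bounded_seq c x -> bounded_seq c y ->
  (\forall n \near om, B * d n <= mdist (x n) (y n)) ->
  B <= mdist (class_of x) (class_of y).
Proof.
move=> bx by_ H; have cv := class_dist_cvg bx by_.
rewrite -(cvg_lim _ cv)//; apply: limr_ge; first by apply/cvg_ex; exists (mdist (class_of x) (class_of y)).
by apply: filterS H => n; rewrite /scaled_dist ler_pdivlMr// scale_gt0.
Qed.

Lemma class_dist_lt x y B : bounded_seq c x -> bounded_seq c y ->
  mdist (class_of x) (class_of y) < B -> \forall n \near om, mdist (x n) (y n) < B * d n.
Proof.
move=> bx by_ H; have /cvgr_lt/(_ _ H) := class_dist_cvg bx by_.
by apply: filterS => n; rewrite scaled_dist_lt.
Qed.

Lemma class_dist_gt x y B : bounded_seq c x -> bounded_seq c y ->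
  B < mdist (class_of x) (class_of y) -> \forall n \near om, B * d n < mdist (x n) (y n).
Proof.
move=> bx by_ H; have /cvgr_gt/(_ _ H) := class_dist_cvg bx by_.
by apply: filterS => n; rewrite scaled_dist_gt.
Qed.

Lemma class_eq x y : bounded_seq c x -> bounded_seq c y ->
  (forall e, 0 < e -> \forall n \near om, mdist (x n) (y n) <= e * d n) ->
  class_of x = class_of y.
Proof.
move=> bx by_ H; apply: mdist_positivity; apply/eqP; rewrite eq_le mdist_ge0 andbT.
apply/ler_addgt0Pl => e e0; rewrite addr0.
by apply: class_dist_le => //; exact: H.
Qed.

Lemma bounded_base_near x : bounded_seq c x ->
  \forall n \near om, mdist (x n) (basepoint c n) <= (mdist (class_of x) (class_of (basepoint c)) + 1) * d n.
Proof.
move=> bx; have := @class_dist_lt _ _ (mdist (class_of x) (class_of (basepoint c)) + 1) bx bounded_base.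
by rewrite ltrDl ltr01 => /(_ isT); apply: filterS => n /ltW.
Qed.

Lemma cone_bounded_near x y B : bounded_seq c y ->
  (\forall n \near om, mdist (x n) (y n) <= B * d n) -> bounded_seq c x.
Proof.
move=> /bounded_base_near by_ H.
apply: (@bounded_near_base _ (B + (mdist (class_of y) (class_of (basepoint c)) + 1))).
apply: filterS2 by_ H => n h1 h2; rewrite mulrDl.
by apply: (le_trans (metric_triangle _ (y n) _)); exact: lerD.
Qed.

Lemma cone_geodesic : geodesic_set [set: X] -> geodesic_set [set: cone c].
Proof.
move=> geoX z w _ _.
have [x bx zx] := class_of_surj z; have [y by_ wy] := class_of_surj w.
pose D n := mdist (x n) (y n).
have /choice[g Hg] : forall n, exists g : R -> X,
    [/\ geodesic_on 0 (D n) g, g 0 = x n & g (D n) = y n].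
  by move=> n; have [f [f1 f2 f3 _]] := geoX (x n) (y n) I I; exists f.
have D0 n : 0 <= D n by exact: mdist_ge0.
(* The n-th geodesic is run at speed d n and stopped at its end, so that fs t is defined for every t
   >= 0 and 1-Lipschitz after rescaling. *)
pose fs (t : R) n := g n (Order.min (t * d n) (D n)).
have dg n (s t : R) : 0 <= s -> s <= t -> mdist (fs s n) (fs t n) <= (t - s) * d n.
  move=> s0 st; have [gn _ _] := Hg n.
  have dn := ltW (scale_gt0 c n).
  have sd : 0 <= s * d n by rewrite mulr_ge0.
  have std : s * d n <= t * d n by rewrite ler_wpM2r.
  have m1 : 0 <= Order.min (s * d n) (D n) <= D n by rewrite le_min sd D0 ge_min lexx orbT.
  have m2 : 0 <= Order.min (t * d n) (D n) <= D n.
    by rewrite le_min (le_trans sd)// D0 ge_min lexx orbT.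
  rewrite (geoE gn m1 m2) mulrBl.
  by case: (leP (s * d n) (D n)) => h1; case: (leP (t * d n) (D n)) => h2;
    rewrite ler_norml; apply/andP; split; lra.
have f0 n : fs 0 n = x n.
  have [_ <- _] := Hg n; rewrite /fs mul0r; congr (g n _).
  by rewrite min_l.
have bfs t : 0 <= t -> bounded_seq c (fs t).
  move=> t0; apply: (@cone_bounded_near (fs t) x t bx); apply: nearW => n.
  by rewrite metric_sym -f0 (le_trans (dg n _ _ _ t0))// subr0.
pose f t := class_of (fs t).
have lf : lip1 f 0 (mdist z w).
  have H (s t : R) : 0 <= s -> s <= t -> mdist (f s) (f t) <= `|s - t|.
    move=> s0 st; rewrite distrC ger0_norm ?subr_ge0//.
    apply: class_dist_le; [exact: bfs|apply: bfs; exact: le_trans st|].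
    by apply: nearW => n; exact: dg.
  move=> s t /andP[s0 _] /andP[t0 _]; have [st|/ltW ts] := leP s t; first exact: H.
  by rewrite metric_sym distrC H.
have E0 : f 0 = z by rewrite zx /f; congr class_of; apply/funext.
have E1 : f (mdist z w) = w.
  rewrite [RHS]wy; apply: class_eq => //; first exact: bfs (mdist_ge0 _ _).
  move=> e e0; have : mdist (class_of x) (class_of y) < mdist z w + e.
    by rewrite -zx -wy ltrDl.
  move=> /(class_dist_lt bx by_); apply: filterS => n h.
  have [gn _ gD] := Hg n; rewrite -[X in mdist _ X <= _]gD /fs.
  have dn := scale_gt0 c n.
  have zd : 0 <= mdist z w * d n by rewrite mulr_ge0 ?mdist_ge0// ltW.
  have ed : 0 <= e * d n by rewrite mulr_ge0// ltW.
  have m1 : 0 <= Order.min (mdist z w * d n) (D n) <= D n.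
    by rewrite le_min zd D0 ge_min lexx orbT.
  have m2 : 0 <= D n <= D n by rewrite lexx D0.
  rewrite (geoE gn m1 m2).
  move: h; rewrite mulrDl -/(D n) => h.
  by case: (leP (mdist z w * d n) (D n)) => h1; rewrite ler_norml; apply/andP; split; lra.
exists f; split => //.
by apply: lip1_geodesic => //; [exact: mdist_ge0|rewrite E0 E1].
Qed.

(** A diagonal argument: kap n is the largest k <= n for which x k n is compatible with all earlier
    x i n. Each k is good for omega-almost all n, so the diagonal sequence ends up within 2 e k of
    every x k. *)
Lemma cone_complete : @is_complete R (cone c).
Proof.
move=> G PG /(cauchyP G) cG.
pose e (k : nat) : R := k.+1%:R^-1.
have e0 k : 0 < e k by rewrite invr_gt0 ltr0n.
have ele k l : (k <= l)%N -> e l <= e k.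
  by move=> kl; rewrite lef_pV2 ?posrE ?ltr0n// ler_nat ltnS.
have /choice[x Hx] : forall k, exists x : nat -> X, bounded_seq c x /\ G (ball (class_of x) (e k)).
  move=> k; have [z Gz] := cG (e k) (e0 k).
  by have [x bx zx] := class_of_surj z; exists x; rewrite -zx.
have bx k : bounded_seq c (x k) by case: (Hx k).
have dx i k : mdist (class_of (x i)) (class_of (x k)) < e i + e k.
  have [_ Gi] := Hx i; have [_ Gk] := Hx k.
  have [w [wi wk]] := filter_ex (filterI Gi Gk).
  rewrite !ballEmdist/= in wi wk.
  by rewrite (le_lt_trans (metric_triangle _ w _))// (metric_sym w) ltrD.
pose good n k := forall i, (i <= k)%N -> mdist (x i n) (x k n) <= (e i + e k) * d n.
have good0 n : good n 0%N.
  move=> i; rewrite leqn0 => /eqP ->; rewrite mdistxx mulr_ge0 ?addr_ge0 ?ltW//.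
  exact: scale_gt0.
have ngood k : \forall n \near om, good n k.
  have H m : \forall n \near om, forall i, (i < m)%N -> mdist (x i n) (x k n) <= (e i + e k) * d n.
    elim: m => [|m IH]; first exact: nearW.
    apply: filterS2 IH (class_dist_lt (bx m) (bx k) (dx m k)) => n h1 h2 i.
    by rewrite ltnS leq_eqVlt => /predU1P[->|/h1//]; exact: ltW.
  by apply: filterS (H k.+1) => n h i; rewrite -ltnS; exact: h.
have /choice[kap Hkap] : forall n, exists k, good n k /\ forall j, (j <= n)%N -> good n j -> (j <= k)%N.
  move=> n; have ex : exists k, `[< good n k /\ (k <= n)%N >] by exists 0%N; apply/asboolP.
  have bd k : `[< good n k /\ (k <= n)%N >] -> (k <= n)%N by move/asboolP => [].
  have [k /asboolP[gk _] kmax] := ex_maxnP ex bd.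
  by exists k; split => // j jn gj; apply: kmax; apply/asboolP.
pose y n := x (kap n) n.
have yk k : \forall n \near om, mdist (y n) (x k n) <= (2 * e k) * d n.
  apply: filterS2 (near_ge k) (ngood k) => n kn gk.
  have [gkap kmax] := Hkap n; have kk := kmax k kn gk.
  rewrite metric_sym; apply: (le_trans (gkap k kk)).
  apply: (ler_wpM2r (ltW (scale_gt0 c n))).
  by have := ele _ _ kk; lra.
have bdy : bounded_seq c y by exact: cone_bounded_near (bx 0%N) (yk 0%N).
exists (class_of y); apply/metricType_numDomainType.fcvgrPdist_lt => r r0.
have [k hk] := nat_ge (3 / r).
have ek : 3 * e k < r.
  rewrite ltr_pdivrMr ?ltr0n// mulrC -ltr_pdivrMr//.
  by apply: le_lt_trans hk _; rewrite ltr_nat.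
have [_ Gk] := Hx k; apply: filterS Gk => w; rewrite ballEmdist/= => kw.
apply: (le_lt_trans (metric_triangle _ (class_of (x k)) _)).
have := class_dist_le bdy (bx k) (yk k); lra.
Qed.

End ConeClasses.

(** The points of S reachable by e-chains inside S form an open and closed part of S. *)
Lemma connected_chain {R : realType} {F : metricType R} (S : set F) (e : R) x y :
  0 < e -> connected S -> S x -> S y ->
  exists2 c, path (step e) x c /\ last x c = y & {in x :: c, forall z, S z}.
Proof.
move=> e0 cS Sx Sy.
pose B := [set z | exists2 c, path (step e) x c /\ last x c = z & {in x :: c, forall z, S z}].
have BS z : B z -> S z by move=> [c [_ <-] H]; apply: H; exact: mem_last.
have Bstep z w : B z -> S w -> mdist z w <= e -> B w.
  move=> [c [pc lc] ic] Sw zw; exists (rcons c w).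
    by rewrite rcons_path pc last_rcons lc.
  move=> v; rewrite -rcons_cons mem_rcons inE => /predU1P[->//|]; exact: ic.
have Bx : B x by exists [::] => // z; rewrite inE => /eqP ->.
suff SB : S = B by move: Sy; rewrite {1}SB => -[c [pc lc] ic]; exists c.
apply/esym; apply: cS; first by exists x.
- exists [set w | exists2 z, B z & mdist z w < e].
    apply: open_mdist => w [z Bz zw]; exists (e - mdist z w); first by rewrite subr_gt0.
    move=> v wv; exists z => //; apply: (le_lt_trans (metric_triangle _ w _)).
    by rewrite addrC -ltrBrDr.
  apply/seteqP; split => w.
    by move=> Bw; split; [exact: BS|exists w => //; rewrite mdistxx].
  by move=> [Sw [z Bz /ltW zw]]; exact: Bstep zw.
- exists [set w | forall z, S z -> ~ B z -> e <= mdist z w].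
    apply: closed_mdist => w /existsNP[z /not_implyP[Sz /not_implyP[nBz /negP]]].
    rewrite -ltNge => zw; exists (e - mdist z w); first by rewrite subr_gt0.
    move=> v wv /(_ z Sz nBz); rewrite leNgt => /negP; apply.
    by apply: (le_lt_trans (metric_triangle _ w _)); rewrite addrC -ltrBrDr.
  apply/seteqP; split => w.
    move=> Bw; split; first exact: BS.
    move=> z Sz nBz; rewrite leNgt; apply/negP => zw; apply: nBz.
    by apply: Bstep Bw Sz _; rewrite metric_sym ltW.
  move=> [Sw H]; apply: contrapT => nBw; have := H w Sw nBw.
  by rewrite mdistxx leNgt e0.
Qed.

Lemma near_all_seq {T : Type} {I : eqType} (G : set_system T) {FG : Filter G} (P : I -> T -> Prop) (s : seq I) :
  {in s, forall i, \forall t \near G, P i t} -> \forall t \near G, {in s, forall i, P i t}.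
Proof.
elim: s => [|i s IH] H; first by apply: nearW => t i; rewrite in_nil.
have h1 := H i (mem_head _ _).
have h2 : \forall t \near G, {in s, forall j, P j t}.
  by apply: IH => j js; apply: H; rewrite inE js orbT.
apply: filterS2 h1 h2 => t p1 p2 j; rewrite inE => /predU1P[->//|]; exact: p2.
Qed.

(** * The limit line of q in a cone *)

Section ConeLine.
Context {R : realType} {X : metricType R} (c : cone_data X).
Context (q : R -> X) (L0 C0 : R) (L01 : 1 <= L0) (C00 : 0 <= C0).
Context (qgq : quasi_geodesic L0 C0 `]-oo, +oo[ q).
Context (r : nat -> R) (br : bounded_seq c (q \o r)).
Implicit Types (u v e : R).

Local Notation d := (scale c).
Local Notation om := (omega c).

Lemma near_const_scale B e : 0 < e -> \forall n \near om, B <= e * d n.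
Proof.
move=> e0; apply: filterS (near_scale c (B / e)) => n.
by rewrite ler_pdivrMr// mulrC.
Qed.

Lemma near_dist_scale (s t : nat -> R) u e : 0 < e ->
  (\forall n \near om, `|s n - t n| <= u * d n) ->
  \forall n \near om, mdist (q (s n)) (q (t n)) <= (L0 * u + e) * d n.
Proof.
move=> e0 H; apply: filterS2 H (near_const_scale C0 e0) => n h1 h2.
apply: (le_trans (qg_upper qgq _ _)); rewrite mulrDl; apply: lerD => //.
by rewrite -mulrA ler_wpM2l//; exact: le_trans ler01 L01.
Qed.

(** The ultralimit of q, parametrized from the class of q o r with parameters rescaled like
    distances; it is bi-Lipschitz, as C0 vanishes in the limit. *)
Definition cone_line u : cone c := class_of c (fun n => q (r n + u * d n)).

Lemma cone_line_shift u v n : `|r n + u * d n - (r n + v * d n)| = `|u - v| * d n.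
Proof.
have -> : r n + u * d n - (r n + v * d n) = (u - v) * d n by ring.
by rewrite normrM (gtr0_norm (scale_gt0 c n)).
Qed.

Lemma cone_line_bounded u : bounded_seq c (fun n => q (r n + u * d n)).
Proof.
have H : \forall n \near om,
    mdist (q (r n + u * d n)) ((q \o r) n) <= (L0 * `|u| + 1) * d n.
  apply: (@near_dist_scale _ r _ _ ltr01); apply: nearW => n /=.
  by have := cone_line_shift u 0 n; rewrite mul0r addr0 subr0 => ->.
exact: cone_bounded_near br H.
Qed.

Lemma cone_line_upper u v : mdist (cone_line u) (cone_line v) <= L0 * `|u - v|.
Proof.
apply/ler_addgt0Pr => e e0.
apply: class_dist_le; [exact: cone_line_bounded|exact: cone_line_bounded|].
by apply: near_dist_scale => //; apply: nearW => n; rewrite cone_line_shift.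
Qed.

Lemma cone_line_lower u v : `|u - v| <= L0 * mdist (cone_line u) (cone_line v).
Proof.
have L00 : 0 < L0 by exact: lt_le_trans L01.
rewrite mulrC -ler_pdivrMr//; apply/ler_addgt0Pr => e e0; rewrite -lerBlDr.
apply: class_dist_ge; [exact: cone_line_bounded|exact: cone_line_bounded|].
apply: filterS (near_const_scale C0 e0) => n h.
have := qg_lower L01 qgq (r n + u * d n) (r n + v * d n); rewrite cone_line_shift => h1.
rewrite mulrBl lerBlDr -mulrA (mulrC L0^-1) mulrA ler_pdivrMr//.
apply: (le_trans h1); by rewrite mulrC (ler_wpM2r (ltW L00))// lerD2l.
Qed.

Lemma ultra_bounded_limit (f : nat -> R) B : (\forall n \near om, `|f n| <= B) ->
  exists l, forall e, 0 < e -> \forall n \near om, `|f n - l| <= e.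
Proof.
move=> H; have : cvg ((f n + B) @[n --> om]).
  apply: (@ultra_bounded_cvg _ _ c _ (2 * B)); apply: filterS H => n.
  by rewrite ler_norml => /andP[? ?]; apply/andP; split; lra.
move=> /cvg_ex[l /cvgrPdist_le H']; exists (l - B) => e e0.
apply: filterS (H' e e0) => n; rewrite distrC.
by have -> : f n + B - l = f n - (l - B) by ring.
Qed.

(** u is the limit of (s n - r n) / d n. Its sign is recorded because the position of 0 between two
    such limits matters later. *)
Lemma cone_line_surj (s : nat -> R) : bounded_seq c (q \o s) ->
  exists u, [/\ class_of c (q \o s) = cone_line u, (forall n, s n <= r n) -> u <= 0 &
    (forall n, r n <= s n) -> 0 <= u].
Proof.
move=> bs; have L00 : 0 < L0 by exact: lt_le_trans L01.
pose D := mdist (class_of c (q \o s)) (class_of c (q \o r)).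
have H : \forall n \near om, `|(s n - r n) / d n| <= L0 * (D + 2).
  have D1 : D < D + 1 by rewrite ltrDl.
  apply: filterS2 (class_dist_lt bs br D1) (near_const_scale C0 (@ltr01 R)).
  move=> n /= h2 h3; rewrite normrM normfV (gtr0_norm (scale_gt0 c n)) ler_pdivrMr ?scale_gt0//.
  apply: (le_trans (qg_lower L01 qgq _ _)); rewrite -mulrA ler_wpM2l ?ltW//.
  by rewrite /D in h2 *; lra.
have [u Hu] := ultra_bounded_limit H.
exists u; split.
- apply: class_eq => //; first exact: cone_line_bounded.
  move=> e e0; have e20 : 0 < e / 2 by rewrite divr_gt0.
  have e2L : 0 < e / 2 / L0 by rewrite divr_gt0.
  have := @near_dist_scale s (fun n => r n + u * d n) (e / 2 / L0) (e / 2) e20.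
  rewrite (_ : L0 * (e / 2 / L0) + e / 2 = e); last by field; rewrite gt_eqF.
  apply.
  apply: filterS (Hu _ e2L) => n.
  have dn := scale_gt0 c n.
  have -> : (s n - r n) / d n - u = (s n - (r n + u * d n)) / d n.
    by field; rewrite gt_eqF.
  by rewrite normrM normfV (gtr0_norm dn) ler_pdivrMr.
- move=> sr; apply/ler_addgt0Pr => e e0; rewrite add0r.
  have [n hn] := filter_ex (Hu e e0).
  have h0 : (s n - r n) / d n <= 0.
    by rewrite pmulr_lle0 ?invr_gt0 ?scale_gt0// subr_le0.
  by move: hn; rewrite ler_norml => /andP[? ?]; lra.
- move=> rs; apply/ler_addgt0Pr => e e0.
  have [n hn] := filter_ex (Hu e e0).
  have h0 : 0 <= (s n - r n) / d n.
    by rewrite divr_ge0 ?subr_ge0// ltW// scale_gt0.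
  by move: hn; rewrite ler_norml => /andP[? ?]; lra.
Qed.

Lemma cone_line_ultralimit u : ultralimit c (range q) (cone_line u).
Proof.
apply/ultralimitP; exists (fun n => q (r n + u * d n)).
by split; [exact: cone_line_bounded|move=> n; exists (r n + u * d n)|].
Qed.

Lemma ultralimit_cone_line z : ultralimit c (range q) z -> exists u, z = cone_line u.
Proof.
move=> /ultralimitP[x [bx qx ->]].
have /choice[s Hs] : forall n, exists s, q s = x n.
  by move=> n; have [s _ <-] := qx n; exists s.
have xs : x = q \o s by apply/funext => n /=; rewrite Hs.
by rewrite xs in bx *; have [u [-> _ _]] := cone_line_surj bx; exists u.
Qed.

(** If S missed the point at p, it would stay at distance eps from it. A fine chain in S has a fixed
    number of points, which fixes D; it lifts to X for omega-almost all n with steps e d n, and D is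
    at most e d n there. The lifted chain then violates the bottleneck property, since (M + 1) e <
    eps. *)
Lemma bottleneck_separates : chain_bottleneck q -> forall S, closed S -> connected S ->
  forall s p t, s <= p <= t -> S (cone_line s) -> S (cone_line t) -> S (cone_line p).
Proof.
move=> [M M0 H] S cS kS s p t spt Ss St; apply: contrapT => nSp.
have [eps eps0 Heps] := closed_far cS nSp.
have far z : S z -> eps <= mdist (cone_line p) z.
  by move=> Sz; rewrite leNgt; apply/negP => h; exact: (Heps z h).
pose e := eps / (2 * (M + 2)).
have M2 : 0 < 2 * (M + 2) by lra.
have e0 : 0 < e by rewrite divr_gt0.
have eM : e * (2 * (M + 2)) = eps by rewrite divfK// gt_eqF.
have Me : 0 <= M * e by rewrite mulr_ge0// ltW.
have Mlt : M * e + e < eps by lra.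
have e20 : 0 < e / 2 by rewrite divr_gt0.
have [w [pw lw] iw] := connected_chain e20 kS Ss St.
have /choice[rep Hrep] : forall z : cone c, exists x, bounded_seq c x /\ z = class_of c x.
  by move=> z; have [x bx zx] := class_of_surj z; exists x.
have near_step (x y : cone c) : mdist x y <= e / 2 ->
    \forall n \near om, step (e * d n) (rep x n) (rep y n).
  move=> xy; have [bx xE] := Hrep x; have [by_ yE] := Hrep y.
  have h : mdist (class_of c (rep x)) (class_of c (rep y)) < e by rewrite -xE -yE; lra.
  have := class_dist_lt bx by_ h; apply: filterS => n /ltW.
  exact: id.
have near_path : \forall n \near om,
    path (step (e * d n)) (rep (cone_line s) n) [seq rep z n | z <- w].
  elim: w (cone_line s) pw {lw iw} => [|y w IH] x /=; first by move=> _; exact: nearW.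
  move=> /andP[xy pw]; apply: filterS2 (near_step _ _ xy) (IH y pw) => n h1 h2.
  by rewrite h1 h2.
pose a n := q (r n + s * d n); pose b n := q (r n + t * d n).
have near_end u : \forall n \near om, mdist (q (r n + u * d n)) (rep (cone_line u) n) <= e * d n.
  have [bu uE] := Hrep (cone_line u).
  have h : mdist (cone_line u) (class_of c (rep (cone_line u))) < e by rewrite -uE mdistxx.
  by have := class_dist_lt (@cone_line_bounded u) bu h; apply: filterS => n /ltW.
have near_far (z : cone c) x : S z -> bounded_seq c x -> z = class_of c x ->
    \forall n \near om, (M * e + e) * d n < mdist (q (r n + p * d n)) (x n).
  move=> Sz bx zx; apply: class_dist_gt => //; first exact: cone_line_bounded.
  by apply: (lt_le_trans Mlt); rewrite -/(cone_line p) -zx; exact: far.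
have near_far_w : \forall n \near om, {in cone_line s :: w, forall z,
    (M * e + e) * d n < mdist (q (r n + p * d n)) (rep z n)}.
  apply: near_all_seq => z zw; have [bz zE] := Hrep z.
  by apply: near_far bz zE; exact: iw.
have near_fa := near_far _ _ Ss (@cone_line_bounded s) erefl.
have near_fb := near_far _ _ St (@cone_line_bounded t) erefl.
have [D D0 HD] := H (size w).+2.
have [n [[[np nw] [na nb]] [[ns nt] nD]]] := filter_ex
  (filterI (filterI (filterI near_path near_far_w) (filterI near_fa near_fb))
  (filterI (filterI (near_end s) (near_end t)) (near_const_scale D e0))).
have dn := scale_gt0 c n.
have ed : 0 <= e * d n by rewrite mulr_ge0 ?ltW.
pose ch := rep (cone_line s) n :: rcons [seq rep z n | z <- w] (b n).
have pch : path (step (e * d n)) (a n) ch.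
  rewrite /ch /= rcons_path np /= last_map lw {1}/step ns /=.
  by rewrite /step metric_sym.
have lch : last (a n) ch = b n by rewrite /ch /= last_rcons.
have [||z zc] := HD (r n + s * d n) (r n + p * d n) (r n + t * d n) (e * d n) ch _ ed _ pch lch.
- by case/andP: spt => sp pt; rewrite !lerD2l !(ler_wpM2r (ltW dn)).
- by rewrite /ch /= size_rcons size_map.
rewrite leNgt => /negP; apply.
have : M * (e * d n) + D <= (M * e + e) * d n by rewrite mulrDl mulrA lerD2l.
move=> /le_lt_trans; apply.
move: zc; rewrite inE => /predU1P[->//|]; rewrite /ch -rcons_cons mem_rcons inE => /predU1P[->//|].
rewrite -[_ :: map _ _]/(map (fun z => rep z n) (cone_line s :: w)) => /mapP[z' z'w ->].
exact: nw.
Qed.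

End ConeLine.

(** * Bottleneck property and transversality in cones *)

Section ConeCondition.
Context {R : realType} {X : metricType R} (geoX : geodesic_set [set: X]).
Context (q : R -> X) (L0 C0 : R) (L01 : 1 <= L0) (C00 : 0 <= C0).
Context (qgq : quasi_geodesic L0 C0 `]-oo, +oo[ q).

Definition cones_transversal := forall c : cone_data X,
  ultralimit c (range q) = set0 \/
  exists P : set (set (cone c)), tree_graded P /\
    exists x : cone c, ultralimit c (range q) `<=` transversal_tree P x.

Lemma bottleneck_cones : chain_bottleneck q -> cones_transversal.
Proof.
move=> H c; have [->|/set0P[z0 /ultralimitP[x [bx qx _]]]] := eqVneq (ultralimit c (range q)) set0.
  by left.
have /choice[r Hr] : forall n, exists r, q r = x n.
  by move=> n; have [s _ <-] := qx n; exists s.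
have br : bounded_seq c (q \o r).
  by rewrite (_ : q \o r = x)//; apply/funext => n /=.
right; have L00 : 0 < L0 by exact: lt_le_trans L01.
have geoC := @cone_geodesic R X c geoX.
have up := cone_line_upper L01 qgq br.
have low := cone_line_lower L01 qgq br.
have sep := bottleneck_separates L01 qgq br H.
exists (fibers (cone_line c q r)); split.
  exact: (fibers_tree_graded geoC L00 up low sep (@cone_complete R X c)).
exists (cone_line c q r 0) => z /(ultralimit_cone_line L01 qgq br)[u ->].
exact: line_transversal L00 up low u.
Qed.

Lemma connected_through {F : metricType R} (geoF : geodesic_set [set: F]) (Z : nat -> F) k :
  (forall i, (i < k)%N -> mdist (Z i) (Z i.+1) <= 1) ->
  exists S, [/\ connected S, S (Z 0%N), S (Z k) &
    forall w, S w -> exists2 i, (i <= k)%N & mdist (Z i) w <= 1].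
Proof.
elim: k => [|k IH] H.
  exists [set Z 0%N]; split => //; first exact: connected1.
  by move=> w ->; exists 0%N; rewrite ?mdistxx.
have [S [cS S0 Sk HS]] := IH (fun i ik => H i (ltnW ik)).
have [f [gf f0 f1 _]] := geoF (Z k) (Z k.+1) I I.
have D0 := mdist_ge0 (Z k) (Z k.+1).
exists (S `|` f @` `[0, mdist (Z k) (Z k.+1)]); split.
- apply: connectedU => //; last by apply: lip1_connected; exact: geodesic_lip1.
  by exists (Z k); split => //; exists 0 => //=; rewrite in_itv/= lexx.
- by left.
- by right; exists (mdist (Z k) (Z k.+1)) => //=; rewrite in_itv/= lexx D0.
- move=> w [/HS[i ik iw]|[t /=]]; first by exists i => //; exact: leqW.
  rewrite in_itv/= => /andP[t0 t1] <-; exists k => //.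
  rewrite -[X in mdist X _]f0 (geoE gf) ?lexx ?t0//.
  by rewrite sub0r normrN ger0_norm// (le_trans t1)// H.
Qed.

(** Counterexamples with D = 2 (n + 1) and a common N are rescaled around q (r n). In the cone they
    become a chain with steps at most 1 at distance at least 2 from the point Q 0, whose connected
    hull contains the geodesic between two points of the line on either side of Q 0. *)
Lemma cones_bottleneck : cones_transversal -> chain_bottleneck q.
Proof.
move=> HC; exists 2 => // N; apply: contrapT => nH.
pose bad (n : nat) (p : R * R * R * R * seq X) :=
  let: (s, r, t, d, ch) := p in
  [/\ s <= r <= t, 0 <= d /\ (size ch <= N)%N, path (step d) (q s) ch, last (q s) ch = q t &
   {in q s :: ch, forall z, 2 * d + 2 * n.+1%:R < mdist (q r) z}].
have /choice[p Hp] : forall n, exists p, bad n p.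
  move=> n; apply: contrapT => nb; apply: nH; exists (2 * n.+1%:R); first by rewrite mulr_ge0.
  move=> s r t d ch srt d0 chN pc lc; apply: contrapT => nz; apply: nb.
  exists (s, r, t, d, ch); split => // z zc; rewrite ltNge; apply/negP => h.
  by apply: nz; exists z.
pose s n := (p n).1.1.1.1; pose r n := (p n).1.1.1.2; pose t n := (p n).1.1.2.
pose d n := (p n).1.2; pose ch n := (p n).2.
have {}Hp n : [/\ s n <= r n <= t n, 0 <= d n /\ (size (ch n) <= N)%N,
    path (step (d n)) (q (s n)) (ch n), last (q (s n)) (ch n) = q (t n) &
   {in q (s n) :: ch n, forall z, 2 * d n + 2 * n.+1%:R < mdist (q (r n)) z}].
  by move: (Hp n); rewrite /bad /s /r /t /d /ch; case: (p n) => [[[[]]]].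
(* The summand n + 1 makes the scale tend to infinity even if the steps stay bounded, and the bad
   distance 2 d + 2 (n + 1) is exactly twice the scale. *)
pose sc n := d n + n.+1%:R.
have sc0 n : 0 < sc n.
  by have [_ [d0 _] _ _ _] := Hp n; rewrite /sc ltr_wpDl// ltr0n.
have [om [uom oom]] := @ultraFilterLemma nat \oo _.
have nprin n : ~ om [set n].
  move=> on; have h : om [set m | (n < m)%N] by apply: oom; exact: nbhs_infty_gt.
  by have [m [/= -> ]] := filter_ex (filterI on h); rewrite ltnn.
have sinf : sc n @[n --> om] --> +oo.
  apply/cvgryPge => A; apply: oom.
  have [m hm] := nat_ge A; near=> n.
  have [_ [d0 _] _ _ _] := Hp n; rewrite /sc.
  have : m%:R <= n.+1%:R :> R by rewrite ler_nat leqW//; near: n; exact: nbhs_infty_ge.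
  lra.
pose c := ConeData uom nprin (q \o r) sc0 sinf.
have br : bounded_seq c (q \o r) by exact: (@bounded_base R X c).
have L00 : 0 < L0 by exact: lt_le_trans L01.
have ds n : d n <= sc n by rewrite /sc lerDl.
have s1 n : 1 <= sc n.
  have [_ [d0 _] _ _ _] := Hp n; rewrite /sc -natr1.
  by have : 0 <= n%:R :> R := ler0n _ _; lra.
pose Q := cone_line c q r.
have low : forall u v, _ := cone_line_lower L01 qgq br.
have inT u := cone_line_ultralimit L01 qgq br u.
have [E|[P [tgP [x Hx]]]] := HC c.
  by have := inT 0; rewrite E.
have TQ u : transversal_tree P x (Q u) by apply: Hx; exact: inT.
(* Padding with the last point yields N + 1 sequences, although the sizes of the chains vary with
   n. *)
pose z i n := nth (last (q (s n)) (ch n)) (q (s n) :: ch n) i.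
have zin i n : z i n \in q (s n) :: ch n.
  rewrite /z; have [h|h] := ltnP i (size (q (s n) :: ch n)); first exact: mem_nth.
  by rewrite nth_default//; exact: mem_last.
have zstep i n : mdist (z i n) (z i.+1 n) <= d n.
  have [_ [d0 _] pc _ _] := Hp n.
  have [h|h] := ltnP i (size (ch n)).
    by rewrite /z /=; move/(pathP (last (q (s n)) (ch n))) : pc => /(_ i h).
  have -> : z i n = last (q (s n)) (ch n).
    move: h; rewrite leq_eqVlt => /predU1P[<-|h]; last by rewrite /z nth_default.
    by rewrite /z -[size (ch n)]/(size (q (s n) :: ch n)).-1 nth_last.
  by rewrite /z /= nth_default// mdistxx.
have zN n : z N n = q (t n).
  have [_ [_ chN] _ lc _] := Hp n; rewrite /z.
  move: chN; rewrite leq_eqVlt => /predU1P[<-|h]; last by rewrite nth_default// lc.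
  by rewrite -[size (ch n)]/(size (q (s n) :: ch n)).-1 nth_last.
have N0 : 0 <= N%:R :> R by [].
have zs n i : mdist (q (s n)) (z i n) <= N%:R * d n.
  have [_ [d0 chN] pc _ _] := Hp n.
  apply: (le_trans (clen_mem (zin i n))); apply: (le_trans (clen_step pc)).
  by rewrite ler_wpM2r// ler_nat.
(* q s and q t are at most N d apart, so r, which lies between s and t, is mapped at distance O(d +
   1) from q s; this keeps the chains inside the cone based at q (r n). *)
have rs n : mdist (q (r n)) (q (s n)) <= (L0 * (L0 * (N%:R + C0)) + C0) * sc n.
  have [/andP[sr rt] [d0 chN] pc lc _] := Hp n.
  have := zs n N; rewrite zN => /(near_start L01 qgq (le_trans sr rt)) h.
  have {}h := h (r n); rewrite sr rt in h; have {}h := h isT.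
  apply: (le_trans h); rewrite mulrDl; apply: lerD; last by rewrite ler_peMr.
  rewrite -!mulrA !ler_wpM2l// ?(ltW L00)// mulrDl; apply: lerD.
    by rewrite ler_wpM2l.
  by rewrite ler_peMr.
have bz i : bounded_seq c (z i).
  have H : \forall n \near omega c, mdist (z i n) ((q \o r) n) <=
      (N%:R + (L0 * (L0 * (N%:R + C0)) + C0)) * scale c n.
    apply: nearW => n; rewrite mulrDl metric_sym addrC.
    apply: (le_trans (metric_triangle _ (q (s n)) _)); apply: lerD; first exact: rs.
    by apply: (le_trans (zs n i)); rewrite ler_wpM2l.
  exact: cone_bounded_near br H.
have z0E : z 0%N = q \o s by [].
have zNE : z N = q \o t by apply/funext => n; exact: zN.
have [|a [Ea a0 _]] := cone_line_surj L01 qgq br (s := s); first by rewrite -z0E; exact: bz.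
have [|b [Eb _ b0]] := cone_line_surj L01 qgq br (s := t); first by rewrite -zNE; exact: bz.
have {}a0 : a <= 0 by apply: a0 => n; have [/andP[]] := Hp n.
have {}b0 : 0 <= b by apply: b0 => n; have [/andP[]] := Hp n.
pose Z i := class_of c (z i).
have Zstep i : (i < N)%N -> mdist (Z i) (Z i.+1) <= 1.
  move=> _; apply: class_dist_le; [exact: bz|exact: bz|].
  by apply: nearW => n; rewrite mul1r (le_trans (zstep i n))//; exact: ds.
have Zfar i : 2 <= mdist (Q 0) (Z i).
  have bQ : bounded_seq c (fun n => q (r n + 0 * scale c n)).
    exact: (@cone_line_bounded _ _ c q L0 C0 L01 qgq r br 0).
  apply: (class_dist_ge bQ (bz i)).
  apply: nearW => n; rewrite mul0r addr0.
  have [_ _ _ _ far] := Hp n; have := far _ (zin i n).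
  by rewrite /= /sc mulrDr => /ltW.
have geoC := @cone_geodesic R X c geoX.
have [S [cS S0 SN HS]] := connected_through geoC Zstep.
rewrite /Z z0E Ea in S0; rewrite /Z zNE Eb in SN.
have [k [gk k0 kD _]] := geoC (Q a) (Q b) I I.
have D0 := mdist_ge0 (Q a) (Q b).
have onS := transversal_connected geoC tgP (TQ a) (TQ b) D0 gk k0 kD cS S0 SN.
have ab : a <= b by exact: le_trans b0.
have up := cone_line_upper L01 qgq br.
have lQ : {within `[a, b], continuous Q} by exact: (@line_cont _ _ Q L0 L00 up a b).
(* Applied to the line itself, [transversal_connected] puts the geodesic from Q a to Q b on the
   line. Its line parameter phi is Lipschitz and runs from a <= 0 to b >= 0, so the geodesic passes
   through Q 0. *)
have cQ : connected (Q @` `[a, b]).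
  exact: connected_continuous_connected (@segment_connected R a b) lQ.
have Qa : (Q @` `[a, b]) (Q a) by exists a => //=; rewrite in_itv/= lexx ab.
have Qb : (Q @` `[a, b]) (Q b) by exists b => //=; rewrite in_itv/= lexx ab.
have onQ := transversal_connected geoC tgP (TQ a) (TQ b) D0 gk k0 kD cQ Qa Qb.
have /choice[phi Hphi] : forall u, exists v, 0 <= u <= mdist (Q a) (Q b) -> k u = Q v.
  move=> u; have [hu|hu] := boolP (0 <= u <= mdist (Q a) (Q b)); last by exists 0.
  by have [v _ <-] := onQ u hu; exists v.
have phiL u v : 0 <= u <= mdist (Q a) (Q b) -> 0 <= v <= mdist (Q a) (Q b) ->
    `|phi u - phi v| <= L0 * `|u - v|.
  by move=> hu hv; apply: (le_trans (low _ _)); rewrite -/Q -!Hphi// (geoE gk).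
have injQ u v : Q u = Q v -> u = v := @line_inj _ _ _ _ low u v.
have h0 : 0 <= (0 : R) <= mdist (Q a) (Q b) by rewrite lexx.
have hD : 0 <= mdist (Q a) (Q b) <= mdist (Q a) (Q b) by rewrite lexx D0.
have phi0 : phi 0 = a by apply: injQ; rewrite -(Hphi _ h0).
have phiD : phi (mdist (Q a) (Q b)) = b by apply: injQ; rewrite -(Hphi _ hD).
have cphi : {within `[0, mdist (Q a) (Q b)], continuous phi}.
  apply/subspace_continuousP => u; rewrite /= in_itv/= => hu.
  apply/cvgrPdist_lt => e e0; apply/nbhs_ballP; exists (e / L0) => /=; first by rewrite divr_gt0.
  move=> v uv /=; rewrite in_itv/= => hv.
  have {}uv : `|u - v| < e / L0 by [].
  rewrite ltr_pdivlMr// mulrC in uv.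
  exact: le_lt_trans (phiL _ _ hu hv) uv.
have [|u + phiu] := IVT D0 cphi (v := 0).
  by rewrite phi0 phiD ge_min le_max a0 b0 orbT.
rewrite in_itv/= => hu.
have [i _ iu] := HS _ (onS u hu).
have := Zfar i; rewrite metric_sym -phiu -Hphi// => h.
have : (2 : R) <= 1 := le_trans h iu.
lra.
Unshelve. all: by end_near. Qed.

End ConeCondition.

Theorem proposition7p1 (R : realType) (X : metricType R)
    (geoX : geodesic_set [set: X])
    (lambda kappa : R) (lambda1 : 1 <= lambda) (kappa0 : 0 <= kappa)
    (L : X -> X -> set (interval_map R X))
    (sysL : quasi_geodesic_system lambda kappa L)
    (q : R -> X)
    (qgq : exists L0 C0 : R,
       [/\ 1 <= L0, 0 <= C0 & quasi_geodesic L0 C0 `]-oo, +oo[ q]) :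
  [<->
    (* (1) *)
    forall c : cone_data X,
      ultralimit c (range q) = set0 \/
      exists P : set (set (cone c)), tree_graded P /\
        exists x : cone c, ultralimit c (range q) `<=` transversal_tree P x;
    (* (2) *)
    morse q;
    (* (3) *)
    forall C : R, 1 <= C -> exists2 D : R, 0 <= D &
      forall (n : R) (p : interval_map R X), is_path p ->
        range q (im_source p) -> range q (im_target p) ->
        n <= mdist (im_source p) (im_target p) ->
        (path_length p <= (C * n)%:E)%E ->
        im_image p `&`
          tubular (middle_third q (im_source p) (im_target p)) D !=set0;
    (* (4) *)
    forall (C : R) (k : nat), 1 <= C -> (0 < k)%N -> exists2 D : R, 0 <= D &
      forall (a b : X) (ps : seq (interval_map R X)),
        range q a -> range q b ->
        size ps = k -> quasi_path L ps a b ->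
        quasi_length ps <= C * mdist a b ->
        quasi_path_image ps `&` tubular (middle_third q a b) D !=set0;
    (* (5) *)
    forall C eps : R, 1 <= C -> 0 < eps -> exists2 D : R, 0 <= D &
      forall (a b : X) (p : interval_map R X),
        range q a -> range q b -> D <= mdist a b ->
        is_path p -> im_source p = a -> im_target p = b ->
        (path_length p <= (C * mdist a b)%:E)%E ->
        sub_qg q a b `<=` tubular (im_image p) (eps * mdist a b)
  ].
Proof.
have [L0 [C0 [L01 C00 qg]]] := qgq.
rewrite -/(cones_transversal q) -/(paths_cross_middle q).
rewrite -/(quasi_paths_cross_middle L q) -/(paths_cover q).
tfae.
- move=> /(cones_bottleneck geoX L01 C00 qg) H.
  exact: (bottleneck_morse geoX L01 C00 qg H).
- move=> /(morse_bottleneck geoX L01 C00 qg) H.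
  exact: (bottleneck_paths_cross geoX L01 C00 qg H).
- move=> /(paths_cross_weak geoX L01 C00 qg) /(weak_bottleneckW geoX L01 C00 qg) H.
  exact: (bottleneck_quasi_paths_cross geoX L01 C00 qg lambda1 kappa0 sysL H).
- move=> /(quasi_paths_cross_weak L01 C00 qg lambda1 kappa0 sysL).
  by move=> /(weak_bottleneckW geoX L01 C00 qg) H; exact: (bottleneck_cover H).
- move=> /(paths_cover_weak geoX L01 C00 qg) /(weak_bottleneckW geoX L01 C00 qg) H.
  exact: (bottleneck_cones geoX L01 qg H).
Qed.
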